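(* Let $f$ be a convex, differentiable flux function with convex conjugate $g$, where $(f,g)$ is a strictly convex, differentiable conjugate pair. Let $u(x,t)$ be the viscosity solution of $u_t+f(u_x)=0$, $u(x,0)=u_0(x)$, given for $t>0$ by the Hopf–Lax formula $$u(x,t)=\inf_{y:\,y\le x}\Big\{u_0(y)+t\,g\Big(\frac{x-y}{t}\Big)\Big\}.$$ For $(x,t)\in\mathbb{R}\times(0,\infty)$ let $y^-(x,t)=\inf I(x,t)$ and $y^+(x,t)=\sup I(x,t)$ be the minimal and maximal elements of the set of minimizers $I(x,t)=\{y\le x: u(x,t)=u_0(y)+t\,g((x-y)/t)\}$, and define $\rho^\pm$ by the Lax–Oleinik formula $\rho^{\pm}(x,t)=g'\big((x-y^{\pm}(x,t))/t\big)$. Let $v_0$ be an arbitrary continuous function on $\mathbb{R}$ and define, for $(x,t)\in\mathbb{R}\times(0,\infty)$, $$v(x,t)=\theta(x,t)\,v_0(y^+(x,t))+\big(1-\theta(x,t)\big)\,v_0(y^-(x,t)),\qquad \theta(x,t)=\Theta(\rho^-(x,t),\rho^+(x,t)).$$ Then $v$ is a weak solution of the linear transport equation $v_t+f'(\rho(x,t))v_x=0$, $v|_{t=0}=v_0$, in the following sense: for all $\phi\in C_c^\infty(\mathbb{R}\times[0,\infty))$, $$\int_0^\infty\!\!\int_{\mathbb{R}}\phi_t(x,t)v(x,t)\,dx\,dt+\int_0^\infty dt\int_{\mathbb{R}}v(x,t)\,d\big[\phi(\cdot,t)f'(\rho^+(\cdot,t))\big](x)+\int_{\mathbb{R}}v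_0(x)\phi(x,0)\,dx=0.$$
   Context: The initial function $u_0:\mathbb{R}\to\mathbb{R}$ is nondecreasing and locally Lipschitz continuous, and satisfies a growth bound at $-\infty$ tailored to $g$, so that $u_0(y)+t\,g((x-y)/t)\to\infty$ as $y\to-\infty$ and each $I(x,t)$ is nonempty and compact (for $f(\rho)=\rho^2$, $g(x)=x^2/4$ the bound is $\lim_{y\to-\infty}|y|^{-2}u_0(y)=0$). For $\lambda\ne\rho$ the number $\Theta(\lambda,\rho)\in[0,1]$ is defined by $$\frac{f(\lambda)-f(\rho)}{\lambda-\rho}=\Theta(\lambda,\rho)f'(\rho)+(1-\Theta(\lambda,\rho))f'(\lambda).$$ When $\rho^-(x,t)=\rho^+(x,t)$ one has $y^-(x,t)=y^+(x,t)$ and the value of $\theta(x,t)$ is immaterial for $v(x,t)$. For fixed $t$, $\rho^-(x,t)=\rho^+(x,t)$ for all but at most countably many $x$; $\rho(x,t)$ denotes the common value, and it equals the $x$-derivative $u_x(x,t)$ of the viscosity solution. The function $\rho^+(\cdot,t)$ is the right-continuous version and is locally of bounded variation. For each $t$ the inner $x$-integral in the second term is with respect to the signed Lebesgue–Stieltjes measure $\mu$ determined by $\mu(a,b]=\phi(b,t)f'(\rho^+(b,t))-\phi(a,t)f'(\rho^+(a,t))$.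
   Formalization: θ(x,t) is taken as Θ(ρ⁺,ρ⁻), not Θ(ρ⁻,ρ⁺): the printed order fails for f(ρ)=ρ⁴, u₀=min(x,0), v₀(y)=y (the shock x=t needs θ=1/4, not 3/4). The time integral in the second term is improper at t=0, as it need not converge absolutely for merely continuous v₀. *)

(* Defs.v *)
From mathcomp Require Import all_boot all_order all_algebra.
From mathcomp Require Import all_classical all_reals all_analysis.

Set Implicit Arguments.
Unset Strict Implicit.
Unset Printing Implicit Defensive.

Import Order.TTheory GRing.Theory Num.Theory.
Import numFieldNormedType.Exports.

Local Open Scope ring_scope.
Local Open Scope classical_set_scope.

Definition strictly_convex (R : realType) (f : R -> R) : Prop :=
  forall x y s : R, x != y -> 0 < s -> s < 1 ->
    f (s * x + (1 - s) * y) < s * f x + (1 - s) * f y.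

(* [g] is the convex conjugate of [f]; the supremum is taken in [\bar R], so
   its finiteness is part of the assertion. *)
Definition is_conjugate (R : realType) (f g : R -> R) : Prop :=
  forall x : R, ereal_sup [set (x * r - f r)%:E | r in [set: R]] = (g x)%:E.

Definition conjugate_pair (R : realType) (f g : R -> R) : Prop :=
  [/\ is_conjugate f g, is_conjugate g f,
      strictly_convex f /\ strictly_convex g,
      (forall r, derivable f r 1) & (forall x, derivable g x 1)].

(* Functions of (x, t) are curried. *)
Definition dx (R : realType) (p : R -> R -> R) : R -> R -> R :=
  fun x t => derive1 (p^~ t) x.

Definition dt (R : realType) (p : R -> R -> R) : R -> R -> R :=
  fun x t => derive1 (p x) t.

Definition continuous2 (R : realType) (p : R -> R -> R) : Prop :=
  continuous (fun z : R * R => p z.1 z.2).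

Fixpoint Ck (R : realType) (k : nat) (p : R -> R -> R) : Prop :=
  if k is j.+1 then
    [/\ continuous2 p,
        (forall x t, derivable (p^~ t) x 1 /\ derivable (p x) t 1),
        Ck j (dx p) & Ck j (dt p)]
  else continuous2 p.

(* C_c^oo(R x [0, oo)): a function smooth up to the boundary t = 0 is the
   restriction of a smooth function on the plane, so test functions are given
   by such an extension. The support condition concerns t >= 0 only; the
   values at t < 0 are never used. *)
Definition test_function (R : realType) (p : R -> R -> R) : Prop :=
  (forall k, Ck k p) /\
  exists M : R, forall x t, 0 <= t -> M < `|x| \/ M < t -> p x t = 0.

(* Crandall-Lions viscosity solution of u_t + f(u_x) = 0, u(., 0) = u0. *)
Definition viscosity_solution (R : realType) (f u0 : R -> R)
    (u : R -> R -> R) : Prop :=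
  [/\ {within [set z : R * R | 0 <= z.2], continuous (fun z => u z.1 z.2)},
      (forall x, u x 0 = u0 x),
      (forall (psi : R -> R -> R) (x t : R), Ck 1 psi -> 0 < t ->
         (\forall z \near (x, t), u z.1 z.2 - psi z.1 z.2 <= u x t - psi x t) ->
         dt psi x t + f (dx psi x t) <= 0) &
      (forall (psi : R -> R -> R) (x t : R), Ck 1 psi -> 0 < t ->
         (\forall z \near (x, t), u x t - psi x t <= u z.1 z.2 - psi z.1 z.2) ->
         0 <= dt psi x t + f (dx psi x t))].

Definition hopf_lax (R : realType) (g u0 : R -> R) (x t : R) : R :=
  inf [set u0 y + t * g ((x - y) / t) | y in [set y : R | y <= x]].

Definition growth_bound (R : realType) (g u0 : R -> R) : Prop :=
  forall x t : R, 0 < t ->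
    u0 y + t * g ((x - y) / t) @[y --> -oo] --> +oo.

Definition minimizers (R : realType) (g u0 : R -> R) (u : R -> R -> R)
    (x t : R) : set R :=
  [set y | y <= x /\ u x t = u0 y + t * g ((x - y) / t)].

Definition y_minus (R : realType) (g u0 : R -> R) (u : R -> R -> R)
    (x t : R) : R := inf (minimizers g u0 u x t).

Definition y_plus (R : realType) (g u0 : R -> R) (u : R -> R -> R)
    (x t : R) : R := sup (minimizers g u0 u x t).

Definition rho_minus (R : realType) (g u0 : R -> R) (u : R -> R -> R)
    (x t : R) : R := derive1 g ((x - y_minus g u0 u x t) / t).

Definition rho_plus (R : realType) (g u0 : R -> R) (u : R -> R -> R)
    (x t : R) : R := derive1 g ((x - y_plus g u0 u x t) / t).

(* Determines [Theta l r] for [l != r]; the diagonal values are arbitrary. *)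
Definition secant_weight (R : realType) (f : R -> R)
    (Theta : R -> R -> R) : Prop :=
  forall l r : R, l != r ->
    [/\ 0 <= Theta l r, Theta l r <= 1 &
        (f l - f r) / (l - r) =
        Theta l r * derive1 f r + (1 - Theta l r) * derive1 f l].

(* The argument order in [Theta] is essential. At a shock of speed s, with
   a+ = f'(rho+) and a- = f'(rho-), the weak formulation below holds for the
   value th * v+ + (1 - th) * v- of v on the shock iff
     s = th * a- + (1 - th) * a+,
   that is th = Theta(rho+, rho-), whereas Theta(rho-, rho+) = 1 - th.
   The two agree when f is quadratic, but not in general: for f(r) = r^4,
   u0(x) = min(x, 0), v0(y) = y the shock is x = t, with rho- = 1, rho+ = 0,
   y- = -3t, y+ = t and s = 1; the identity requires the value -2t, i.e.
   th = 1/4, while Theta(rho-, rho+) = 3/4. *)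
Definition transported (R : realType) (g u0 v0 : R -> R) (u : R -> R -> R)
    (Theta : R -> R -> R) (x t : R) : R :=
  let theta := Theta (rho_plus g u0 u x t) (rho_minus g u0 u x t) in
  theta * v0 (y_plus g u0 u x t) + (1 - theta) * v0 (y_minus g u0 u x t).

(* [l] is the integral of [h] against the finite signed Lebesgue-Stieltjes
   measure [nu] determined by nu ]a, b] = F b - F a; existence of [nu] and
   integrability of [h] against both parts of a Jordan decomposition of [nu]
   are part of the assertion. *)
Definition is_stieltjes_integral (R : realType) (F h : R -> R) (l : R) : Prop :=
  exists nu : {charge set (measurableTypeR R) -> \bar R},
    (forall a b : R, a <= b -> nu `]a, b]%classic = (F b - F a)%:E) /\
    exists (P N : set (measurableTypeR R)) (nuPN : hahn_decomposition nu P N),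
      [/\ (jordan_pos nuPN).-integrable setT (EFin \o h),
          (jordan_neg nuPN).-integrable setT (EFin \o h) &
          l = \int[jordan_pos nuPN]_(x in setT) h x
              - \int[jordan_neg nuPN]_(x in setT) h x].

(* [l] is the integral of [h] over ]0, +oo[, improper at 0. *)
Definition is_improper_integral (R : realType) (h : R -> R) (l : R) : Prop :=
  (forall tau : R, 0 < tau ->
     (@lebesgue_measure R).-integrable `[tau, +oo[ (EFin \o h)) /\
  \int[@lebesgue_measure R]_(t in `[tau, +oo[) h t @[tau --> 0^'+] --> l.

(* Weak solution of v_t + a v_x = 0, v(., 0) = v0, for [a ^~ t] right-continuous
   and locally of bounded variation. The signed measure of [phi ^~ t * a ^~ t]
   may have total variation of order 1 / t as t -> 0, and for a merely
   continuous [v0] the time integral of the second term need not converge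
   absolutely at t = 0, whence the improper integral. *)
Definition weak_transport_solution (R : realType) (v0 : R -> R)
    (a v : R -> R -> R) : Prop :=
  forall phi : R -> R -> R, test_function phi ->
  exists (J : R -> R) (l : R),
    [/\ (forall t, 0 < t -> (@lebesgue_measure R).-integrable setT
           (fun x => (dt phi x t * v x t)%:E)),
        (@lebesgue_measure R).-integrable `]0, +oo[
           (fun t => (\int[@lebesgue_measure R]_(x in setT)
                        (dt phi x t * v x t))%:E),
        (forall t, 0 < t ->
           is_stieltjes_integral (fun x => phi x t * a x t) (v^~ t) (J t)),
        is_improper_integral J l &
        \int[@lebesgue_measure R]_(t in `]0, +oo[)
          (\int[@lebesgue_measure R]_(x in setT) (dt phi x t * v x t))
        + l
        + \int[@lebesgue_measure R]_(x in setT) (v0 x * phi x 0) = 0].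

(* Main.v *)
Require Import Defs.
From HB Require Import structures.
From mathcomp Require Import all_boot all_order all_algebra.
From mathcomp Require Import all_classical all_reals all_analysis.
From mathcomp Require Import measurable_realfun.
From mathcomp Require Import ring lra.
Import Order.TTheory GRing.Theory Num.Theory.
Import numFieldNormedType.Exports.
Local Open Scope ring_scope.
Local Open Scope classical_set_scope.

Set Implicit Arguments.
Unset Strict Implicit.
Unset Printing Implicit Defensive.

(** For a level [c] let [X c t], the inf of all [x] with [c < y_plus x t], be the
    front separating the points with minimizers below [c] from those with
    minimizers above [c].
    Every point of the open segment from [(y0, 0)] to [(x1, t1)], where [y0]
    minimizes at [(x1, t1)], has [y0] as its only minimizer; hence [X c] is
    nondecreasing and locally Lipschitz on [t > 0], and the extreme minimizers at
    [(X c t, t)] are right-continuous in [t]. Comparing the increments of [u]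
    along the front with the linear minorants given by Fenchel-Young shows that
    its right derivative is the shock speed
    [th (x - y_minus) / t + (1 - th) (x - y_plus) / t].
    Differentiating [int_(X c t)^oo phi dx] then gives the weak transport
    equation when [v0] is the indicator of [y > c], the value at the front being
    exactly the one prescribed by [th].

    A continuous [v0] is, on compact sets, a uniform limit of step functions, so
    [v] is a uniform limit of combinations of front indicators. On [t >= tau > 0]
    both terms of the equation are continuous for the sup norm, the second because
    the flux measure has total variation O(1 / t). This yields the identity on
    [tau <= t] with boundary term [int phi(., tau) v(., tau)], and one lets [tau]
    tend to 0. *)

(** * Conjugate pairs *)

(** At a shock [v] and the flux density [phi f'(rho_plus)] jump at the same abscissa, so the second
    term hinges on the value of [v] at one point. The flux measure of the closed and of the open ray
    to the right of a front is minus the left and minus the right limit of the density there, and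
    the weight [th] mixes these two masses into exactly minus [phi] times the shock speed. Since
    [th] depends on the point alone, neither on [c] nor on [v0], the function [v] is linear in [v0]
    and fronts superpose, also after several of them have merged. Merging is the reason for working
    with right derivatives: a front has a kink where shocks meet, and the extreme minimizers along
    it are in general continuous from the right only. A Lipschitz function with a right derivative
    everywhere is still the integral of that derivative, so differentiability almost everywhere is
    never invoked. *)

Section Convex.
Context {R : realType}.
Implicit Types f g : R -> R.

Lemma continuous_epsP (f : R -> R) (x : R) :
  {for x, continuous f} <->
  forall e : R, 0 < e -> exists2 d : R, 0 < d & forall y : R, `|y - x| < d -> `|f y - f x| < e.
Proof.
split.
- move=> /cvgrPdist_lt fx e e0.
  have /nbhs_ballP[d /= d0 H] := fx _ e0.
  exists d => // y xy; rewrite distrC; apply: H.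
  by rewrite /ball /= distrC.
- move=> H; apply/cvgrPdist_lt => e /H[d d0 {}H].
  apply/nbhs_ballP; exists d => //= y; rewrite /ball /= => xy.
  by rewrite distrC; apply: H; rewrite distrC.
Qed.

Lemma cvg_continuous (T : Type) (F : set_system T) {FF : Filter F} (h : R -> R) (k : T -> R)
  (a : R) : continuous h -> k @ F --> a -> (fun x => h (k x)) @ F --> h a.
Proof. by move=> ch ck; exact: (continuous_cvg _ (ch a) ck). Qed.

Lemma derivable_eps (f : R -> R) (x : R) : derivable f x 1 ->
  forall e : R, 0 < e -> exists2 d : R, 0 < d & forall h : R, h != 0 -> `|h| < d ->
    `|(f (x + h) - f x) / h - derive1 f x| < e.
Proof.
move=> df e e0; have := df; rewrite /derivable => /cvgrPdist_lt /(_ _ e0).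
move=> /nbhs_ballP[d /= d0 H]; exists d => // h h0 hd.
have := H h; rewrite /ball /= sub0r normrN => /(_ hd h0).
rewrite distrC derive1E /derive !scaler1 /GRing.scale /= mulrC (addrC h x).
by rewrite /GRing.scale /=.
Qed.

Lemma derive1_convex_le f (x y : R) : strictly_convex f -> derivable f x 1 ->
  f x + derive1 f x * (y - x) <= f y.
Proof.
move=> cf df; have [->|xy] := eqVneq y x; first by rewrite subrr mulr0 addr0.
rewrite leNgt; apply/negP => lt.
(* [e] is the defect of the slope of the chord from [x] to [y] against the derivative. Convexity
   passes at least this defect on to every shorter chord from [x], which contradicts the limit of
   the difference quotients. *)
pose e := (f x + derive1 f x * (y - x) - f y) / `|y - x|.
have yx0 : 0 < `|y - x| by rewrite normr_gt0 subr_eq0.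
have e0 : 0 < e by rewrite divr_gt0 // subr_gt0.
have [d d0 H] := derivable_eps df e0.
pose s := Num.min (1/2) (d / (2 * `|y - x|)).
have s0 : 0 < s by rewrite lt_min; apply/andP; split; [lra|rewrite divr_gt0 // mulr_gt0].
have s1 : s < 1 by apply: le_lt_trans (_ : s <= 1/2) _; [by rewrite ge_min lexx|lra].
have s0' : s != 0 by rewrite gt_eqF.
have yx' : y - x != 0 by rewrite subr_eq0.
have syx : s * (y - x) != 0 by rewrite mulf_neq0.
have sd : `|s * (y - x)| < d.
  rewrite normrM (gtr0_norm s0).
  apply: (@le_lt_trans _ _ (d / 2)); last by lra.
  rewrite -ler_pdivlMr // -mulrA -invfM /s ge_min; apply/orP; right.
  by rewrite lexx.
have := H _ syx sd.
have -> : x + s * (y - x) = s * y + (1 - s) * x by ring.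
have := cf y x s xy s0 s1; set A := f (_ + _) => HA.
have nn : 0 < `|s * (y - x)| by rewrite normr_gt0.
rewrite -(ltr_pM2r nn) -normrM mulrBl divfK // /e.
rewrite normrM (gtr0_norm s0) mulrA (mulrC (_ / _) s) -mulrA divfK ?gt_eqF //.
by move=> /ltr_normlP[h _]; move: h HA; lra.
Qed.

Lemma conjugate_pair_sym f g : conjugate_pair f g -> conjugate_pair g f.
Proof. by case=> h1 h2 [h3 h4] h5 h6. Qed.

Lemma fenchel_young f g : conjugate_pair f g -> forall x r : R, x * r <= f r + g x.
Proof.
case=> h1 _ _ _ _ x r; rewrite -lerBlDl.
by rewrite -lee_fin -h1; apply: ereal_sup_ubound; exists r.
Qed.

(** The supremum that defines [f] at the slope of [g] at [x] is attained at [x], because the tangent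
    line at [x] lies below [g]. *)
Lemma fenchel_young_eq f g : conjugate_pair f g ->
  forall x : R, f (derive1 g x) + g x = x * derive1 g x.
Proof.
move=> fg x; apply/eqP; rewrite eq_le; apply/andP; split; last exact: (fenchel_young fg).
case: fg => _ h2 [_ cg] _ dg; rewrite -lerBrDr.
rewrite -lee_fin -h2; apply: ge_ereal_sup => _ [z _ <-]; rewrite lee_fin.
have := derive1_convex_le z cg (dg x); lra.
Qed.

(** By the two Fenchel-Young lemmas [r -> f r - x * r] is minimal at the slope of [g] at [x], so its
    derivative [k] vanishes there. *)
Lemma derive1_conjugateK f g : conjugate_pair f g ->
  cancel (derive1 g) (derive1 f).
Proof.
move=> fg x; set p : R := derive1 g x; apply/eqP; rewrite -subr_eq0; apply/eqP.
have df : derivable f p 1 by case: fg.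
pose k : R := derive1 f p - x; apply: contrapT => /eqP; rewrite -/k => k0.
have k00 : 0 < `|k| by rewrite normr_gt0.
have [d d0 H] := derivable_eps df (divr_gt0 k00 (@ltr0n R 2)).
(* A step against the sign of [k], which would take [f r - x * r] below its minimum. *)
pose h : R := - Num.sg k * (d / 2).
have h0 : h != 0 by rewrite mulf_neq0 ?oppr_eq0 ?sgr_eq0 // gt_eqF //; lra.
have hd : `|h| < d.
  by rewrite normrM normrN normr_sg k0 mul1r gtr0_norm; lra.
have := H h h0 hd.
have A := fenchel_young fg x (p + h).
have B := fenchel_young_eq fg x.
have kE : k = Num.sg k * `|k| by exact: numEsg.
have sk : Num.sg k * Num.sg k = 1.
  by rewrite -expr2 sqr_sg k0.
have C : 0 <= f (p + h) - f p - x * h by move: A B; rewrite -/p; lra.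
have hk : h * k = - (d / 2 * `|k|).
  rewrite /h {2}kE; transitivity (- (Num.sg k * Num.sg k) * (d / 2 * `|k|)); first by ring.
  by rewrite sk mulN1r.
have nh : 0 < `|h| by rewrite normr_gt0.
rewrite -(ltr_pM2r nh) -normrM mulrBl divfK //.
have -> : `|h| = d / 2 by rewrite normrM normrN normr_sg k0 mul1r gtr0_norm; lra.
move=> /ltr_normlP[_].
have : f (p + h) - f p - derive1 f p * h = f (p + h) - f p - x * h - h * k.
  by rewrite /k; ring.
by rewrite hk; nra.
Qed.

Lemma derive1_conjugate_lt f g : conjugate_pair f g ->
  {mono (derive1 g) : x y / x < y}.
Proof.
move=> fg; apply/leW_mono/le_mono => x y xy.
rewrite lt_neqAle; apply/andP; split.
  apply/eqP => E; have := derive1_conjugateK fg x; rewrite E (derive1_conjugateK fg).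
  by move=> yx; move: xy; rewrite yx ltxx.
case: fg => _ _ [_ cg] _ dg.
have := derive1_convex_le x cg (dg y); have := derive1_convex_le y cg (dg x); nra.
Qed.

(** A strictly increasing function that is onto has no jumps; [derive1 f] supplies the preimages of
    the ends of the target interval. *)
Lemma derive1_conjugate_continuous f g : conjugate_pair f g -> continuous (derive1 g).
Proof.
move=> fg x; apply/continuous_epsP => e e0.
have fg' := conjugate_pair_sym fg.
have mono := derive1_conjugate_lt fg; have K := derive1_conjugateK fg'.
pose a := derive1 f (derive1 g x - e); pose b := derive1 f (derive1 g x + e).
have ax : a < x by rewrite -mono K; lra.
have xb : x < b by rewrite -mono K; lra.
exists (Num.min (x - a) (b - x)); first by rewrite lt_min; apply/andP; split; lra.
move=> y; rewrite lt_min => /andP[/ltr_normlP[h1 _] /ltr_normlP[_ h2]].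
have : derive1 g a < derive1 g y by rewrite mono; lra.
have : derive1 g y < derive1 g b by rewrite mono; lra.
rewrite !K => h3 h4; apply/ltr_normlP; split; lra.
Qed.

End Convex.

(** * The Hopf-Lax inequality from the subsolution property *)

Section SubsolutionBound.
Context {R : realType}.

Lemma barrier_test_Ck1 (y q k C : R) (p dp : R -> R) :
  (forall s : R, is_derive s (1 : R) p (dp s)) -> continuous dp ->
  let psi := fun z s : R => s * k + C * (z - y - q * s) ^+ 2 + p s in
  [/\ Ck 1 psi, (forall z s : R, dx psi z s = 2 * C * (z - y - q * s)) &
     (forall z s : R, dt psi z s = k - 2 * C * q * (z - y - q * s) + dp s)].
Proof.
move=> Hp cdp psi.
have Dx (z s : R) : is_derive z (1 : R) (psi^~ s) (2 * C * (z - y - q * s)).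
  apply: is_derive_eq; rewrite /GRing.scale /=; ring.
have Dt (z s : R) : is_derive s (1 : R) (psi z) (k - 2 * C * q * (z - y - q * s) + dp s).
  apply: is_derive_eq; rewrite /GRing.scale /=; ring.
have dxE (z s : R) : dx psi z s = 2 * C * (z - y - q * s).
  by rewrite /dx derive1E; exact: derive_val.
have dtE (z s : R) : dt psi z s = k - 2 * C * q * (z - y - q * s) + dp s.
  by rewrite /dt derive1E; exact: derive_val.
have cp : continuous p.
  move=> s; apply: differentiable_continuous; apply/derivable1_diffP.
  by have [] := Hp s.
have cw : continuous (fun z : R * R => z.1 - y - q * z.2).
  move=> z; apply: cvgB; first by apply: cvgB; [exact: cvg_fst|exact: cvg_cst].
  by apply: cvgM; [exact: cvg_cst|exact: cvg_snd].
split => //; split => //.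
- move=> z /=; apply: cvgD; last first.
    by apply: (continuous_comp (f := snd)); [exact: cvg_snd|exact: cp].
  apply: cvgD; first by apply: cvgM; [exact: cvg_snd|exact: cvg_cst].
  apply: cvgM; first exact: cvg_cst.
  rewrite expr2; under eq_fun do rewrite expr2.
  by apply: cvgM; exact: cw.
- have -> : dx psi = fun z s : R => 2 * C * (z - y - q * s).
    by apply/funext => z; apply/funext => s; exact: dxE.
  rewrite /= /continuous2 => z /=.
  by apply: cvgM; [exact: cvg_cst|exact: cw].
- have -> : dt psi = fun z s : R => k - 2 * C * q * (z - y - q * s) + dp s.
    by apply/funext => z; apply/funext => s; exact: dtE.
  rewrite /= /continuous2 => z /=.
  apply: cvgD; last first.
    by apply: (continuous_comp (f := snd)); [exact: cvg_snd|exact: cdp].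
  apply: cvgB; first exact: cvg_cst.
  by apply: cvgM; [exact: cvg_cst|exact: cw].
Qed.

(** A high power of [s / t1] costs only [eta] at [t1] but is as large as desired at [2 * t1]. In
    [subsolution_le] this keeps the maximum off the top of the tube, and the nonnegative derivative
    preserves the strict inequality there. *)
Lemma power_barrier (t1 eta A : R) : 0 < t1 -> 0 < eta ->
  exists p dp : R -> R,
  [/\ (forall s : R, is_derive s (1 : R) p (dp s)), continuous dp,
      (forall s : R, 0 <= s -> 0 <= p s /\ 0 <= dp s), p t1 = eta & A <= p (2 * t1)].
Proof.
move=> t0 e0; pose n := Num.bound `|A / eta|.
have An : A / eta < n%:R by apply: le_lt_trans (ler_norm _) _; exact/archi_boundP/normr_ge0.
exists (fun s => eta / t1 ^+ n.+1 * s ^+ n.+1), (fun s => eta / t1 ^+ n.+1 * (n.+1%:R * s ^+ n)).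
have c0 : 0 <= eta / t1 ^+ n.+1 by rewrite divr_ge0 ?exprn_ge0 // ltW.
split.
- move=> s; have := is_deriveZ (eta / t1 ^+ n.+1) (is_deriveX n.+1 (is_derive_id s (1:R))).
  rewrite (_ : _ \*: _ = fun s0 : R => eta / t1 ^+ n.+1 * s0 ^+ n.+1); last first.
    by apply/funext => w /=; rewrite exprfctE.
  by move/is_derive_eq; apply; rewrite /GRing.scale /= mulr1.
- move=> s; apply: cvgM; first exact: cvg_cst.
  by apply: cvgM; [exact: cvg_cst|exact: exprn_continuous].
- by move=> s s0; have sn := exprn_ge0 _ s0; split; rewrite mulr_ge0 // mulr_ge0.
- by rewrite divfK // expf_neq0 // gt_eqF.
- have -> : eta / t1 ^+ n.+1 * (2 * t1) ^+ n.+1 = eta * 2 ^+ n.+1.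
    by rewrite exprMn; field; rewrite expf_neq0 // gt_eqF.
  rewrite -ler_pdivrMl // mulrC; apply: ltW; apply: lt_trans An _.
  by rewrite -natrX ltr_nat; apply: leq_trans (ltn_expl n (isT : (1 < 2)%N)) _; rewrite leq_exp2l.
Qed.

(* For [y > x1] this is not contained in the Hopf-Lax formula. If it failed, the
   test function [s (g q + d) + C (z - y - q s)^2 + p s] would touch [u] from
   above inside a tube around the segment from [(y, 0)] to [(x1, t1)], where
   Fenchel-Young gives [psi_t + f (psi_x) >= d > 0]. *)
Lemma subsolution_le (f g u0 : R -> R) (u : R -> R -> R) (y x1 t1 : R) :
  conjugate_pair f g -> viscosity_solution f u0 u -> continuous u0 -> 0 < t1 ->
  u x1 t1 <= u0 y + t1 * g ((x1 - y) / t1).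
Proof.
move=> fg [cu u_init sub _] cu0 t0; rewrite leNgt; apply/negP => lt.
pose q : R := (x1 - y) / t1; have qE : q * t1 = x1 - y by rewrite divfK // gt_eqF.
pose Gam : R := u x1 t1 - u0 y - t1 * g q.
have Gam0 : 0 < Gam by rewrite /Gam /q; lra.
(* A quarter of the gap [Gam] is spent on [d * t1] and a quarter on [p t1], so [u - psi] at
   [(x1, t1)] still exceeds [u0 y] by [Gam / 2]. This is the oscillation of [u0] allowed within the
   radius [r]. *)
pose d : R := Gam / (4 * t1).
have d0 : 0 < d by rewrite divr_gt0 // mulr_gt0.
have dE : d * t1 = Gam / 4 by rewrite /d; field; rewrite gt_eqF.
pose k : R := g q + d.
pose a : R := y - `|q| * (2 * t1) - 1; pose b : R := y + `|q| * (2 * t1) + 1.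
pose K : set (R * R) := `[a, b] `*` `[0, 2 * t1].
have cK : compact K by apply: compact_setX; exact: segment_compact.
have qs (s : R) : 0 <= s -> s <= 2 * t1 -> `|q * s| <= `|q| * (2 * t1).
  by move=> s0 s2; rewrite normrM ler_wpM2l // ger0_norm.
have K1 : K (x1, t1).
  have /ler_normlP[h1 h2] := qs t1 (ltW t0) ltac:(lra).
  by split; rewrite /= in_itv /=; apply/andP; split; rewrite /a /b; lra.
have K0 : K !=set0 by exists (x1, t1).
have uK : {within K, continuous (fun z => u z.1 z.2)}.
  apply: continuous_subspaceW cu => -[z s] [_] /=.
  by rewrite in_itv /= => /andP[].
have [S maxS] : exists S : R, forall w : R * R, K w -> u w.1 w.2 <= S.
  have [[z s] _ m] := compact_EVT_max K0 cK uK.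
  by exists (u z s) => w Kw; exact: m (mem_set Kw).
pose B : R := S + 2 * t1 * `|k| - u0 y.
have [r r0 Hr] := (continuous_epsP u0 y).1 (cu0 y) (Gam / 2) ltac:(lra).
(* The penalty has to exceed [B] in two places: on the sides of the tube, where the squared distance
   is at least 1, and at time 0 outside the [r]-neighbourhood of [y], where it is at least
   [r ^+ 2]. *)
pose C : R := (`|B| + 1) * (1 + (r ^+ 2)^-1).
have r20 : 0 < r ^+ 2 by rewrite exprn_gt0.
have CB : B < C.
  have := ler_norm B; have : 0 < (r ^+ 2)^-1 by rewrite invr_gt0.
  rewrite /C; have := normr_ge0 B; nra.
have CrB : B < C * r ^+ 2.
  have -> : C * r ^+ 2 = (`|B| + 1) * (r ^+ 2 + 1) by rewrite /C; field; rewrite gt_eqF.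
  have := ler_norm B; have := normr_ge0 B; nra.
have C0 : 0 < C by rewrite mulr_gt0 // ltr_wpDl // ?addr_gt0 ?invr_gt0.
have [p [dp [Hp cdp p_ge0 pt1 pA]]] := power_barrier (`|B| + 1) t0 (divr_gt0 Gam0 (@ltr0n R 4)).
have := barrier_test_Ck1 y q k C Hp cdp; cbv zeta; set psi := (fun z s : R => _).
case=> [Cpsi dxE dtE].
have cpsi : continuous (fun z : R * R => psi z.1 z.2) by case: Cpsi.
have pK : {within K, continuous (fun z : R * R => psi z.1 z.2)}.
  by apply: continuous_subspaceT; exact: cpsi.
have FK : {within K, continuous (fun z : R * R => u z.1 z.2 - psi z.1 z.2)}.
  move=> z; apply: cvgB; first exact: uK.
  exact: pK.
have [z [s [Kz maxF]]] : exists z s : R, K (z, s) /\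
    forall w : R * R, K w -> u w.1 w.2 - psi w.1 w.2 <= u z s - psi z s.
  have [[z s] /set_mem Kz m] := compact_EVT_max K0 cK FK.
  by exists z, s; split => // w Kw; exact: m (mem_set Kw).
have F1 : u0 y + Gam / 2 <= u z s - psi z s.
  apply: le_trans (maxF _ K1); rewrite /= /psi pt1.
  have -> : x1 - y - q * t1 = 0 by rewrite qE; ring.
  rewrite expr0n /= mulr0 addr0 /k; move: dE; rewrite /Gam; lra.
have := Kz; rewrite /K /= !in_itv /= => -[/andP[az zb] /andP[s0 s2]].
have uS : u z s <= S := maxS _ Kz.
have [ps0 dps0] := p_ge0 _ s0.
have sk : - (2 * t1 * `|k|) <= s * k.
  have := normr_ge0 k; have /ler_normlP[h1 h2] := lexx `|k|; nra.
have Cw : 0 <= C * (z - y - q * s) ^+ 2 by rewrite mulr_ge0 ?sqr_ge0 // ltW.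
have s_gt0 : 0 < s.
  rewrite lt_neqAle s0 andbT; apply/eqP => s_0; move: F1 Cw ps0; rewrite /psi -s_0 u_init.
  rewrite !mulr0 mul0r !subr0 add0r => F1 Cw ps0.
  have [zr|zr] := ltP `|z - y| r.
    have /ltr_normlP[_] := Hr z zr; lra.
  have : r ^+ 2 <= (z - y) ^+ 2 by rewrite -(real_normK (num_real (z - y))) lerXn2r ?nnegrE // ltW.
  rewrite -(ler_pM2l C0) => h; move: uS; rewrite -s_0 u_init.
  have : 0 <= 2 * t1 * `|k| by rewrite !mulr_ge0 // ltW.
  move: CrB; rewrite /B; lra.
have s_lt : s < 2 * t1.
  rewrite lt_neqAle s2 andbT; apply/eqP => sE.
  move: pA F1 (ler_norm B); rewrite -sE /psi /B; lra.
have side : 1 <= (z - y - q * s) ^+ 2 -> False.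
  rewrite -(ler_pM2l C0) => h; move: F1 CB; rewrite /psi /B; lra.
have /ler_normlP[q1 q2] := qs s s0 s2.
have az' : a < z.
  rewrite lt_neqAle az andbT; apply/eqP => zE; apply: side.
  rewrite -zE /a expr2; nra.
have zb' : z < b.
  rewrite lt_neqAle zb andbT; apply/eqP => zE; apply: side.
  rewrite zE /b expr2; nra.
have nK : nbhs (z, s) K.
  exists (`]a, b[%classic, `]0, 2 * t1[%classic); first split => /=.
  - by apply: near_in_itvoo; rewrite in_itv /= az' zb'.
  - by apply: near_in_itvoo; rewrite in_itv /= s_gt0 s_lt.
  by move=> [z' s'] [] /= h1 h2; split => /=; apply: subset_itv_oo_cc.
have := sub psi z s Cpsi s_gt0.
have H : \forall w \near (z, s), u w.1 w.2 - psi w.1 w.2 <= u z s - psi z s.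
  by apply: filterS nK => w; exact: maxF.
move=> /(_ H); rewrite dtE dxE.
have := fenchel_young fg q (2 * C * (z - y - q * s)); rewrite /k.
move: dps0; lra.
Qed.

End SubsolutionBound.

(** * Minimizers *)

Definition action {R : realType} (g u0 : R -> R) (y x t : R) : R :=
  u0 y + t * g ((x - y) / t).

(** [hs_le] covers all [y], also those to the right of [x]: in [hopf_lax_increment] the competitor
    is a minimizer belonging to another point and may lie beyond [x]. *)
Record hopf_lax_setting {R : realType} (f g u0 : R -> R) (u : R -> R -> R) : Prop :=
  HopfLaxSetting {
  hs_pair : conjugate_pair f g;
  hs_init : continuous u0;
  hs_growth : growth_bound g u0;
  hs_cont : forall x t : R, 0 < t ->
    {for (x, t), continuous (fun z : R * R => u z.1 z.2)};
  hs_hopf : forall x t : R, 0 < t -> u x t = hopf_lax g u0 x t;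
  hs_le : forall y x t : R, 0 < t -> u x t <= action g u0 y x t }.

Section Minimizers.
Context {R : realType} (f g u0 : R -> R) (u : R -> R -> R).
Hypothesis HS : hopf_lax_setting f g u0 u.
Let fg := hs_pair HS.
Let cu0 := hs_init HS.
Let growth := hs_growth HS.
Let cu := hs_cont HS.
Let u_hopf := hs_hopf HS.
Let u_le := hs_le HS.
Local Notation G := (action g u0).
Local Notation I := (minimizers g u0 u).
Local Notation ym := (y_minus g u0 u).
Local Notation yp := (y_plus g u0 u).

Lemma conjugate_continuous : continuous g.
Proof.
by move=> x; apply: differentiable_continuous; apply/derivable1_diffP; case: fg.
Qed.

(** Each slope [r] gives a minorant linear in [(z, t)], exact at one ratio by [perspective_eq]; this
    makes actions at different points and times comparable. *)
Lemma perspective_ge (r z t : R) : 0 < t -> r * z - t * f r <= t * g (z / t).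
Proof.
move=> t0; have := fenchel_young fg (z / t) r.
by rewrite -(ler_pM2l t0) mulrDr mulrA mulrC (mulrC t) divfK ?gt_eqF // mulrC; lra.
Qed.

Lemma perspective_eq (z t : R) : 0 < t ->
  t * g (z / t) = derive1 g (z / t) * z - t * f (derive1 g (z / t)).
Proof.
move=> t0; have := fenchel_young_eq fg (z / t); set r : R := derive1 g _.
move=> /(congr1 (fun w => t * w)); rewrite mulrDr mulrA (mulrC t (z / t)) divfK ?gt_eqF //.
lra.
Qed.

Lemma cvg_snd_fst (y x t : R) : (fun w : R * (R * R) => w.2.1) @ (y, (x, t)) --> x.
Proof.
have H : {for (y, (x, t)), continuous ((@fst R R) \o (@snd R (R * R)))}.
  by apply: continuous_comp; [exact: cvg_snd|exact: cvg_fst].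
exact: H.
Qed.

Lemma cvg_snd_snd (y x t : R) : (fun w : R * (R * R) => w.2.2) @ (y, (x, t)) --> t.
Proof.
have H : {for (y, (x, t)), continuous ((@snd R R) \o (@snd R (R * R)))}.
  by apply: continuous_comp; exact: cvg_snd.
exact: H.
Qed.

Lemma action_continuous (y x t : R) : 0 < t ->
  {for (y, (x, t)), continuous (fun w : R * (R * R) => G w.1 w.2.1 w.2.2)}.
Proof.
move=> t0; apply: cvgD.
  by apply: (continuous_comp (f := fst)); [exact: cvg_fst|exact: cu0].
have c2 : (fun w : R * (R * R) => w.2.2) @ (y, (x, t)) --> t.
  exact: cvg_snd_snd.
have c1 : (fun w : R * (R * R) => w.2.1) @ (y, (x, t)) --> x.
  exact: cvg_snd_fst.
apply: cvgM => //=.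
have H : (fun w : R * (R * R) => (w.2.1 - w.1) / w.2.2) @ (y, (x, t)) --> (x - y) / t.
  apply: cvgM; first by apply: cvgB => //; exact: cvg_fst.
  by apply: cvgV => //=; rewrite gt_eqF.
exact: (continuous_cvg _ (@conjugate_continuous ((x - y) / t)) H).
Qed.

Lemma action_continuous_y (x t : R) : 0 < t -> continuous (fun y => G y x t).
Proof.
move=> t0 y; apply: cvgD; first exact: cu0.
apply: cvgM; first exact: cvg_cst.
apply: (continuous_comp (f := fun w : R => (x - w) / t)); last exact: conjugate_continuous.
apply: cvgM; last exact: cvg_cst.
by apply: cvgB => //; exact: cvg_cst.
Qed.

Lemma growth_lt (x t A : R) : 0 < t -> exists B : R, forall y : R, y < B -> A < G y x t.
Proof.
move=> t0; have /cvgryPgt/(_ A)[B [_ HB]] := growth x t0.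
by exists B => y /HB.
Qed.

Lemma minimizers_neq0 (x t : R) : 0 < t -> I x t !=set0.
Proof.
move=> t0; have [B HB] := growth_lt x (u x t + 1) t0.
pose B' : R := Num.min B x.
have B'x : B' <= x by rewrite ge_min lexx orbT.
have : {within `[B', x], continuous (fun y => G y x t)}.
  by apply: continuous_subspaceT; exact: action_continuous_y.
move=> /(EVT_min B'x)[c]; rewrite in_itv /= => /andP[c1 c2] minc.
exists c; split => //; apply/eqP; rewrite eq_le; apply/andP; split; first exact: u_le.
rewrite leNgt; apply/negP => lt.
have : inf [set G y x t | y in [set y : R | y <= x]] < Num.min (G c x t) (u x t + 1).
  by rewrite -[X in X < _](u_hopf x t0) lt_min lt ltrDl ltr01.
move=> /inf_lt[|_ [y yx <-]]; first by exists (G x x t); exists x => /=.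
rewrite lt_min => /andP[h1 h2].
have By : B <= y by rewrite leNgt; apply/negP => /HB; lra.
have := minc y; rewrite in_itv /= ge_min By yx => /(_ isT); lra.
Qed.

(** The growth bound at the single time [T] serves all earlier times, because
    [action g u0 y x0 t - t * g 0] does not increase with [t]: its change is controlled by
    [f r >= - g 0] for the slope [r] at time [T]. *)
Lemma minimizers_lbound (x0 T : R) : 0 < T -> exists B : R,
  forall t y : R, 0 < t -> t < T -> I x0 t y -> B <= y.
Proof.
move=> T0; have [B HB] := growth_lt x0 (u0 x0 + T * g 0) T0.
exists B => t y t0 tT [yx uE]; rewrite leNgt; apply/negP => /HB.
have := u_le x0 x0 t0; rewrite uE /action subrr mul0r.
have /= := perspective_eq (x0 - y) T0; set r : R := derive1 g _ => ->.
have := perspective_ge r (x0 - y) t0.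
have := fenchel_young fg 0 r; rewrite mul0r.
nra.
Qed.

Lemma minimizers_le (x t y : R) : I x t y -> y <= x. Proof. by case. Qed.

Lemma minimizersP (x t y : R) : 0 < t -> I x t y <-> y <= x /\ G y x t <= u x t.
Proof.
move=> t0; split=> [[h1 h2]|[h1 h2]]; split => //; first by rewrite -/(G y x t) in h2; rewrite h2.
by apply/eqP; rewrite eq_le h2 andbT; exact: u_le.
Qed.

Lemma minimizers_closed (x t y : R) : 0 < t ->
  (forall e : R, 0 < e -> exists2 y', I x t y' & `|y' - y| < e) -> I x t y.
Proof.
move=> t0 H; apply/minimizersP => //; split; rewrite leNgt; apply/negP => lt.
  have [|y' /minimizers_le y'x /ltr_normlP[h1 h2]] := H (y - x); lra.
have [|d d0 Hd] := (continuous_epsP _ _).1 (@action_continuous_y x t t0 y) (G y x t - u x t); first lra.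
have [y' Iy' /Hd /ltr_normlP[h1 h2]] := H d d0.
by have [_] := (minimizersP _ _ t0).1 Iy'; lra.
Qed.

Lemma minimizers_bounded (x t : R) : 0 < t -> has_lbound (I x t) /\ has_ubound (I x t).
Proof.
move=> t0; split; last by exists x => y [].
have [B HB] := @minimizers_lbound x (t + 1) ltac:(lra).
by exists B => y Iy; apply: HB Iy => //; lra.
Qed.

Lemma ypP (x t : R) : 0 < t -> I x t (yp x t) /\ forall y, I x t y -> y <= yp x t.
Proof.
move=> t0; have [lb ub] := minimizers_bounded x t0; have ne := minimizers_neq0 x t0.
split; last by move=> y Iy; exact: ub_le_sup.
apply: minimizers_closed => // e e0.
have [y Iy lt] := sup_adherent e0 (conj ne ub); exists y => //.
have : y <= yp x t by exact: ub_le_sup.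
rewrite /y_plus => h; apply/ltr_normlP; split; lra.
Qed.

Lemma ymP (x t : R) : 0 < t -> I x t (ym x t) /\ forall y, I x t y -> ym x t <= y.
Proof.
move=> t0; have [lb ub] := minimizers_bounded x t0; have ne := minimizers_neq0 x t0.
split; last by move=> y Iy; exact: ge_inf.
apply: minimizers_closed => // e e0.
have [y Iy lt] := inf_adherent e0 (conj ne lb); exists y => //.
have : ym x t <= y by exact: ge_inf.
rewrite /y_minus => h; apply/ltr_normlP; split; lra.
Qed.

Lemma ym_le_yp (x t : R) : 0 < t -> ym x t <= yp x t.
Proof. by move=> t0; apply: (ypP x t0).2; case: (ymP x t0). Qed.

Lemma yp_le (x t : R) : 0 < t -> yp x t <= x.
Proof. by move=> t0; case: (ypP x t0) => /minimizers_le. Qed.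

(** Characteristics do not cross. If [y2 < y1], exchanging the two minimizers replaces the arguments
    of [g] by convex combinations of them with complementary weights, and strict convexity lowers
    the total action. *)
Lemma minimizers_mono (x1 x2 t y1 y2 : R) : 0 < t -> x1 < x2 ->
  I x1 t y1 -> I x2 t y2 -> y1 <= y2.
Proof.
move=> t0 x12 [yx1 uE1] [yx2 uE2]; rewrite leNgt; apply/negP => y21.
have [_ _ [_ sg] _ _] := fg.
pose D : R := (x2 - x1) + (y1 - y2); have D0 : 0 < D by rewrite /D; lra.
pose s : R := (y1 - y2) / D.
have sD : s * D = y1 - y2 by rewrite divfK // gt_eqF.
have s0 : 0 < s by rewrite divr_gt0 //; lra.
have s1 : s < 1 by rewrite -(ltr_pM2r D0) sD /D; lra.
have ne : (x1 - y1) / t != (x2 - y2) / t.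
  by apply/eqP => /(mulIf (invr_neq0 (lt0r_neq0 t0))); lra.
have := sg _ _ _ ne s0 s1.
have := sg _ _ (1 - s) ne ltac:(lra) ltac:(lra).
have -> : (1 - s) * ((x1 - y1) / t) + (1 - (1 - s)) * ((x2 - y2) / t) = (x1 - y2) / t.
  rewrite !mulrA -mulrDl; congr (_ / _); move: sD; rewrite /D; lra.
have -> : s * ((x1 - y1) / t) + (1 - s) * ((x2 - y2) / t) = (x2 - y1) / t.
  rewrite !mulrA -mulrDl; congr (_ / _); move: sD; rewrite /D; lra.
have := u_le y2 x1 t0; have := u_le y1 x2 t0; rewrite uE1 uE2 /action; nra.
Qed.

Lemma yp_le_ym (x1 x2 t : R) : 0 < t -> x1 < x2 -> yp x1 t <= ym x2 t.
Proof.
by move=> t0 x12; apply: (minimizers_mono t0 x12); [case: (ypP x1 t0)|case: (ymP x2 t0)].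
Qed.

Lemma yp_nd (t : R) : 0 < t -> {homo yp^~ t : x1 x2 / x1 <= x2}.
Proof.
move=> t0 x1 x2; rewrite le_eqVlt => /predU1P[-> //|x12].
by apply: le_trans (yp_le_ym t0 x12) (ym_le_yp _ t0).
Qed.

Lemma ym_nd (t : R) : 0 < t -> {homo ym^~ t : x1 x2 / x1 <= x2}.
Proof.
move=> t0 x1 x2; rewrite le_eqVlt => /predU1P[-> //|x12].
by apply: le_trans (ym_le_yp _ t0) (yp_le_ym t0 x12).
Qed.

(* The point of the segment from (y0, 0) to (x1, t1) at height t. *)
Lemma segment_minimizer (x1 t1 t y0 y : R) : 0 < t -> t < t1 -> I x1 t1 y0 ->
  I (x1 - (t1 - t) * ((x1 - y0) / t1)) t y -> y = y0.
Proof.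
move=> t0 tt1 [yx1 uE1]; have t10 : 0 < t1 by lra.
set sig : R := (x1 - y0) / t1; set z : R := x1 - _; move=> [yz uE].
have sE : sig * t1 = x1 - y0 by rewrite divfK // gt_eqF.
have [E|ne] := eqVneq ((z - y) / t) sig.
  have : z - y = sig * t by rewrite -E divfK // gt_eqF.
  rewrite /z; lra.
have [_ _ [_ sg] _ _] := fg.
have s1 : t / t1 < 1 by rewrite ltr_pdivrMr // mul1r.
have s0 : 0 < t / t1 by rewrite divr_gt0.
(* If the slopes differ, the straight path from [(y, 0)] to [(x1, t1)] is strictly cheaper than the
   one bent at [(z, t)]; hence it would also beat the path from [y0], against the minimality of
   [y0]. *)
have := sg _ _ _ ne s0 s1.
have -> : t / t1 * ((z - y) / t) + (1 - t / t1) * sig = (x1 - y) / t1.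
  by rewrite /z; field; rewrite !gt_eqF.
rewrite -(ltr_pM2l t10).
have -> : t1 * (t / t1 * g ((z - y) / t) + (1 - t / t1) * g sig) =
    t * g ((z - y) / t) + (t1 - t) * g sig by field; rewrite gt_eqF.
have := u_le y x1 t10; rewrite uE1.
have := u_le y0 z t0; rewrite uE /action.
have -> : (z - y0) / t = sig.
  have -> : z - y0 = sig * t by rewrite /z; lra.
  by rewrite mulfK // gt_eqF.
rewrite -/sig; lra.
Qed.

(** Upper semicontinuity of the set of minimizers. A [y] that fails to minimize at [(x, t)] fails,
    together with its neighbours, at all nearby points; compactness makes the neighbourhood uniform
    in [y]. *)
Lemma minimizers_usc (x t e : R) : 0 < t -> 0 < e -> exists2 d : R, 0 < d &
  forall x' t' y : R, `|x' - x| < d -> `|t' - t| < d -> I x' t' y ->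
   ym x t - e < y /\ y < yp x t + e.
Proof.
move=> t0 e0.
have [B HB] := @minimizers_lbound (x - 1) (t + 1) ltac:(lra).
pose P (w : R * R) (y : R) := I w.1 w.2 y -> ym x t - e < y /\ y < yp x t + e.
have near_y (y : R) : \forall p \near (y, (x, t)), P p.2 p.1.
  have [xy|yx] := ltP x y.
    have cxy : (fun p : R * (R * R) => p.1 - p.2.1) @ (y, (x, t)) --> y - x.
      apply: cvgB; first exact: cvg_fst.
      exact: cvg_snd_fst.
    apply: filterS (cvgr_gt _ cxy (0 : R) _); last by rewrite subr_gt0.
    by move=> p; rewrite subr_gt0 => h [/(lt_le_trans h)]; rewrite ltxx.
  have [lt|ge] := ltP (u x t) (G y x t).
    have ch : (fun p : R * (R * R) => G p.1 p.2.1 p.2.2 - u p.2.1 p.2.2) @ (y, (x, t))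
        --> G y x t - u x t.
      apply: cvgB; first exact: (@action_continuous y x t t0).
      have H : (fun w : R * (R * R) => w.2) @ (y, (x, t)) --> (x, t) by exact: cvg_snd.
      exact: (continuous_cvg _ (@cu x t t0) H).
    apply: filterS (cvgr_gt _ ch (0 : R) _); last by rewrite subr_gt0.
    by move=> p; rewrite subr_gt0 => h [_ E]; move: h; rewrite E /action ltxx.
  have Iy : I x t y by apply/minimizersP.
  have c1 : (fun p : R * (R * R) => p.1) @ (y, (x, t)) --> y by exact: cvg_fst.
  have l1 : ym x t - e < y by have := (ymP x t0).2 _ Iy; lra.
  have l2 : y < yp x t + e by have := (ypP x t0).2 _ Iy; lra.
  have n1 := cvgr_gt _ c1 _ l1; have n2 := cvgr_lt _ c1 _ l2.
  by apply: filterS2 (n1 _) (n2 _) => p h1 h2 _.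
have cK : compact `[B, x + 1]%classic by exact: segment_compact.
have := (compact_near_coveringP _).1 cK (R * R)%type (nbhs (x, t)) P _.
move=> /(_ _ (fun y _ => near_y y)) /nbhs_ballP[d /= d0 Hd].
exists (Num.min d (Num.min 1 t)); first by rewrite !lt_min d0 ltr01 t0.
move=> x' t' y; rewrite !lt_min => /and3P[x1 x2 _] /and3P[t1 t2 t3] Iy.
have /ltr_normlP[h1 h2] := x2; have /ltr_normlP[h3 h4] := t3; have /ltr_normlP[h5 h6] := t2.
apply: (Hd (x', t')) => //=.
  by split; rewrite /ball /= distrC.
rewrite in_itv /=; apply/andP; split; last by have := minimizers_le Iy; lra.
have t'0 : 0 < t' by lra.
(* The bound [B] concerns the one abscissa [x - 1]; monotonicity carries it to every [x'] to the
   right of it. *)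
apply: (@le_trans _ _ (ym (x - 1) t')).
  by apply: HB (ymP (x - 1) t'0).1; lra.
by apply: (minimizers_mono t'0 _ (ymP (x - 1) t'0).1 Iy); lra.
Qed.

(** A slope [p] so steep that [p * e] exceeds what [u0] can gain by moving left makes any
    displacement of at least [e] too expensive, once [t] is small enough for the terms [t * f p] and
    [t * g 0] to be harmless. *)
Lemma minimizers_init (x e : R) : 0 < e -> exists2 d : R, 0 < d &
  forall t y : R, 0 < t -> t < d -> I x t y -> x - e < y.
Proof.
move=> e0; have [B HB] := @minimizers_lbound x 1 ltac:(lra).
pose B' : R := Num.min B x.
have B'x : B' <= x by rewrite ge_min lexx orbT.
have : {within `[B', x], continuous u0} by apply: continuous_subspaceT.
move=> /(EVT_min B'x)[c _ minc].
pose p : R := (`|u0 x - u0 c| + 1) / e.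
have pe : p * e = `|u0 x - u0 c| + 1 by rewrite divfK // gt_eqF.
have p0 : 0 < p by rewrite divr_gt0 // ltr_wpDl.
have a0 : 0 < `|f p + g 0| + 1 by rewrite ltr_wpDl.
exists (Num.min 1 (`|f p + g 0| + 1)^-1); first by rewrite lt_min ltr01 invr_gt0.
move=> t y t0; rewrite lt_min => /andP[t1 ta] Iy; rewrite ltNge; apply/negP => yx.
have By : B <= y by apply: HB Iy.
have := minc y; rewrite in_itv /= ge_min By (minimizers_le Iy) => /(_ isT) cy.
case: Iy => _ uE.
have := u_le x x t0; rewrite uE /action subrr mul0r.
have := perspective_ge p (x - y) t0.
have := ler_norm (u0 x - u0 c); have : t * (`|f p + g 0| + 1) < 1.
  by rewrite -ltr_pdivlMr // mul1r.
have := ler_norm (f p + g 0); nra.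
Qed.

End Minimizers.

(** * Fronts *)

Definition front {R : realType} (g u0 : R -> R) (u : R -> R -> R) (c t : R) : R :=
  inf [set x | c < y_plus g u0 u x t].

Section Front.
Context {R : realType} (f g u0 : R -> R) (u : R -> R -> R).
Hypothesis HS : hopf_lax_setting f g u0 u.
Let fg := hs_pair HS.
Let cu0 := hs_init HS.
Let u_le := hs_le HS.
Local Notation I := (minimizers g u0 u).
Local Notation ym := (y_minus g u0 u).
Local Notation yp := (y_plus g u0 u).
Local Notation X := (front g u0 u).

(** Far to the right the slope of [g] is at least [r], so moving the foot from some [y <= c] to
    [c + 1] saves at least [r]. This outweighs the change of [u0] over the compact range to which a
    minimizer below [c] would be confined. *)
Lemma front_set_neq0 (c t : R) : 0 < t -> [set x | c < yp x t] !=set0.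
Proof.
move=> t0; apply: contrapT => H.
have {}H (x : R) : yp x t <= c by rewrite leNgt; apply/negP => lt; apply: H; exists x.
have : {within `[yp c t, c], continuous u0} by apply: continuous_subspaceT.
move=> /(EVT_min (H c))[c' _ minc].
pose r : R := Num.max (`|u0 (c + 1) - u0 c'| + 1) (derive1 g 0).
pose z : R := t * derive1 f r.
have zt : z / t = derive1 f r by rewrite /z mulrC mulKf // gt_eqF.
have fg' := conjugate_pair_sym fg.
have gz : derive1 g (z / t) = r by rewrite zt (derive1_conjugateK fg').
have z0 : 0 <= z.
  apply: mulr_ge0; first exact: ltW.
  rewrite leNgt -(derive1_conjugate_lt fg) (derive1_conjugateK fg') -leNgt.
  by rewrite le_max lexx orbT.
pose x : R := c + 1 + z.
have [[yx uE] _] := ypP HS x t0.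
have yc : yp c t <= yp x t by apply: (yp_nd HS t0); rewrite /x; lra.
have := minc (yp x t); rewrite in_itv /= yc H => /(_ isT) h1.
have := u_le (c + 1) x t0; rewrite uE /action.
have -> : x - (c + 1) = z by rewrite /x; ring.
have := perspective_eq HS z t0; rewrite gz.
have := perspective_ge HS r (x - yp x t) t0.
have : `|u0 (c + 1) - u0 c'| + 1 <= r by rewrite le_max lexx.
have := ler_norm (u0 (c + 1) - u0 c'); have := normr_ge0 (u0 (c + 1) - u0 c').
have := H x; rewrite /x; nra.
Qed.

Lemma front_set_lbound (c t : R) : 0 < t -> lbound [set x | c < yp x t] c.
Proof. by move=> t0 x /= /ltW h; apply: le_trans h (yp_le HS x t0). Qed.

Lemma le_front (c t : R) : 0 < t -> c <= X c t.
Proof.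
by move=> t0; apply: lb_le_inf; [exact: front_set_neq0|exact: front_set_lbound].
Qed.

Lemma front_le (c x t : R) : 0 < t -> c < yp x t -> X c t <= x.
Proof. by move=> t0 h; apply: ge_inf => //; exists c; exact: front_set_lbound. Qed.

(** If [c < ym x t], semicontinuity keeps the minimizers slightly to the left of [x] above [c], so
    the front is strictly to the left of [x]. *)
Lemma front_lt (c x t : R) : 0 < t -> (X c t < x) = (c < ym x t).
Proof.
move=> t0; apply/idP/idP.
  move=> /inf_lt -/(_ (front_set_neq0 c t0))[x' /= cx' x'x].
  exact: lt_le_trans cx' (yp_le_ym HS t0 x'x).
move=> cx; have [d d0 Hd] := minimizers_usc HS x t0 (e := ym x t - c) ltac:(lra).
apply: (@le_lt_trans _ _ (x - d / 2)); last by lra.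
apply: front_le => //.
have := (Hd (x - d / 2) t _ _ _ (ypP HS (x - d / 2) t0).1).1; rewrite subrr normr0.
have -> : x - d / 2 - x = - (d / 2) by ring.
by rewrite normrN gtr0_norm; last lra; move=> /(_ ltac:(lra) d0); lra.
Qed.

Lemma front_le_yp (c x t : R) : 0 < t -> X c t <= x -> c <= yp x t.
Proof.
move=> t0 h; rewrite leNgt; apply/negP => lt.
have [d d0 Hd] := minimizers_usc HS x t0 (e := c - yp x t) ltac:(lra).
have : c < ym (x + d / 2) t by rewrite -front_lt //; lra.
have := (Hd (x + d / 2) t _ _ _ (ymP HS (x + d / 2) t0).1).2; rewrite subrr normr0.
have -> : x + d / 2 - x = d / 2 by ring.
by rewrite gtr0_norm; last lra; move=> /(_ ltac:(lra) d0); lra.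
Qed.

Lemma ym_front (c t : R) : 0 < t -> ym (X c t) t <= c.
Proof. by move=> t0; rewrite leNgt -front_lt // ltxx. Qed.

(** The segment from the front down to its least minimizer carries that minimizer alone. As it is at
    most [c], the segment cannot be strictly to the right of the front at an earlier time. *)
Lemma front_backward_minus (c t t' : R) : 0 < t -> t < t' ->
  X c t' - (t' - t) * ((X c t' - ym (X c t') t') / t') <= X c t.
Proof.
move=> t0 tt'; have t'0 : 0 < t' by lra.
rewrite leNgt front_lt //; set z : R := _ - _ * _.
rewrite (segment_minimizer HS t0 tt' (ymP HS _ t'0).1 (ymP HS z t0).1).
by rewrite -leNgt ym_front.
Qed.

(** The mirror image of [front_backward_minus], except that the greatest minimizer at the front may
    equal [c]. The segment is therefore drawn from a point [x''] slightly to the right, where all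
    minimizers exceed [c], and semicontinuity controls the error. *)
Lemma front_backward_plus (c t t' : R) : 0 < t -> t < t' ->
  X c t <= X c t' - (t' - t) * ((X c t' - yp (X c t') t') / t').
Proof.
move=> t0 tt'; have t'0 : 0 < t' by lra.
set x' : R := X c t'; set z : R := _ - _ * _; rewrite leNgt; apply/negP => lt.
pose e : R := (X c t - z) / 2; have e0 : 0 < e by rewrite /e; lra.
have [d d0 Hd] := minimizers_usc HS x' t'0 e0.
pose m : R := Num.min d e; have m0 : 0 < m by rewrite lt_min d0.
have md : m <= d by rewrite ge_min lexx.
have me : m <= e by rewrite ge_min lexx orbT.
pose x'' : R := x' + m / 2.
have cy : c < ym x'' t' by rewrite -front_lt // -/x' /x''; lra.
have := (Hd x'' t' _ _ _ (ymP HS x'' t'0).1).2; rewrite subrr normr0.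
have -> : x'' - x' = m / 2 by rewrite /x''; ring.
rewrite gtr0_norm; last lra.
move=> /(_ ltac:(lra) d0) h.
pose z'' : R := x'' - (t' - t) * ((x'' - ym x'' t') / t').
have : X c t <= z''.
  apply: front_le => //.
  by rewrite (segment_minimizer HS t0 tt' (ymP HS _ t'0).1 (ypP HS z'' t0).1).
have zE (a y : R) : a - (t' - t) * ((a - y) / t') = (t / t') * a + (1 - t / t') * y.
  by field; rewrite gt_eqF.
have : 0 < t / t' by rewrite divr_gt0.
have : t / t' < 1 by rewrite ltr_pdivrMr // mul1r.
have : z = (t / t') * x' + (1 - t / t') * yp x' t' by rewrite /z zE.
have : z'' = (t / t') * x'' + (1 - t / t') * ym x'' t' by rewrite /z'' zE.
have : X c t = z + 2 * e by rewrite /e; field.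
by rewrite /x''; set s : R := t / t'; nra.
Qed.

(** Along a front the range of minimizers only widens with time, as a shock absorbs characteristics.
    This is the half of right continuity that semicontinuity does not give. *)
Lemma ym_front_mono (c t t' : R) : 0 < t -> t < t' -> ym (X c t') t' <= ym (X c t) t.
Proof.
move=> t0 tt'; have t'0 : 0 < t' by lra.
have := front_backward_minus c t0 tt'; set z : R := _ - _ * _.
have zm := segment_minimizer HS t0 tt' (ymP HS _ t'0).1 (ymP HS z t0).1.
by move=> /(ym_nd HS t0); rewrite zm.
Qed.

Lemma yp_front_mono (c t t' : R) : 0 < t -> t < t' -> yp (X c t) t <= yp (X c t') t'.
Proof.
move=> t0 tt'; have t'0 : 0 < t' by lra.
have := front_backward_plus c t0 tt'; set z : R := _ - _ * _.
have zm := segment_minimizer HS t0 tt' (ypP HS _ t'0).1 (ypP HS z t0).1.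
by move=> /(yp_nd HS t0); rewrite zm.
Qed.

Lemma front_slope_ge (c t t' : R) : 0 < t -> t < t' ->
  (X c t' - yp (X c t') t') / t' <= (X c t' - X c t) / (t' - t).
Proof.
move=> t0 tt'; rewrite ler_pdivlMr; last lra.
have := front_backward_plus c t0 tt'; lra.
Qed.

Lemma front_slope_le (c t t' : R) : 0 < t -> t < t' ->
  (X c t' - X c t) / (t' - t) <= (X c t' - ym (X c t') t') / t'.
Proof.
move=> t0 tt'; rewrite ler_pdivrMr; last lra.
have := front_backward_minus c t0 tt'; lra.
Qed.

Lemma front_nd (c t t' : R) : 0 < t -> t <= t' -> X c t <= X c t'.
Proof.
move=> t0; rewrite le_eqVlt => /predU1P[-> //|tt']; have t'0 : 0 < t' by lra.
have h1 := front_slope_ge c t0 tt'; have h2 := yp_le HS (X c t') t'0.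
have : 0 <= (X c t' - X c t) / (t' - t).
  by apply: le_trans h1; apply: divr_ge0; [lra|exact: ltW].
by rewrite pmulr_lge0 ?invr_gt0 ?subr_gt0 // subr_ge0.
Qed.

Lemma front_lipschitz (c tau T : R) : 0 < tau -> exists2 L : R, 0 <= L &
  forall t t' : R, tau <= t -> t <= t' -> t' <= T ->
    0 <= X c t' - X c t <= L * (t' - t).
Proof.
move=> tau0; have [Ttau|tauT] := ltP T tau.
  by exists 0 => // t t' h1 h2 h3; lra.
have [B HB] := @minimizers_lbound _ _ _ _ _ HS c (T + 1) ltac:(lra).
have ymB (t : R) : tau <= t -> t <= T -> B <= ym (X c t) t.
  move=> h1 h2; have t0 : 0 < t by lra.
  apply: le_trans (ym_nd HS t0 (le_front c t0)).
  by apply: HB (ymP HS c t0).1; lra.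
(* [M] comes from solving [front_slope_le] between [tau] and [t] for [X c t], with [B] as lower
   bound of the minimizer. *)
pose M : R := T / tau * (`|X c tau| + `|B|).
have a0 : 0 <= `|X c tau| + `|B| by rewrite addr_ge0.
have a1 : X c tau <= `|X c tau| := ler_norm _.
have a2 : - B <= `|B| by rewrite -normrN ler_norm.
have a3 : 0 <= `|B| := normr_ge0 _.
have XM (t : R) : tau <= t -> t <= T -> X c t <= M.
  move=> h1 h2; have t0 : 0 < t by lra.
  apply: (@le_trans _ _ (t / tau * (`|X c tau| + `|B|))); last first.
    by apply: ler_wpM2r => //; apply: ler_wpM2r => //; rewrite invr_ge0 ltW.
  rewrite mulrAC ler_pdivlMr //.
  move: h1; rewrite le_eqVlt => /predU1P[<-|h1]; first by rewrite mulrC ler_pM2l //; lra.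
  have := front_slope_le c tau0 h1; have := ymB t (ltW h1) h2.
  rewrite ler_pdivrMr ?subr_gt0 // mulrAC ler_pdivlMr //; nra.
exists ((M - B) / tau).
  have h := XM tau (lexx _) tauT; have h' := ymB tau (lexx _) tauT.
  have := minimizers_le (ymP HS (X c tau) tau0).1 => h''.
  by apply: divr_ge0; [lra|exact: ltW].
move=> t t' h1; rewrite le_eqVlt => /predU1P[<- _|h2 h3]; first by rewrite !subrr mulr0 lexx.
have t0 : 0 < t by lra. have t'0 : 0 < t' by lra.
rewrite subr_ge0 (front_nd c t0 (ltW h2)) /= -ler_pdivrMr ?subr_gt0 //.
apply: le_trans (front_slope_le c t0 h2) _.
have tt' : tau <= t' by lra.
have h := XM t' tt' h3; have h' := ymB t' tt' h3.
have h'' := minimizers_le (ymP HS (X c t') t'0).1.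
apply: ler_pM; [lra|by rewrite invr_ge0 ltW|lra|].
by rewrite lef_pV2 ?posrE.
Qed.

(* Used forward and backward in time, this sandwiches the slope of a front
   between two secant slopes of [f]. *)
Lemma hopf_lax_increment (x x' t t' y : R) : 0 < t -> 0 < t' -> I x' t' y ->
  let r := derive1 g ((x - y) / t) in
  r * (x' - x) - f r * (t' - t) <= u x' t' - u x t.
Proof.
move=> t0 t'0 [_ uE] /=; rewrite uE; set r : R := derive1 g _.
have := u_le y x t0; rewrite /action (perspective_eq HS (x - y) t0) -/r.
have := perspective_ge HS r (x' - y) t'0; lra.
Qed.

Variable Theta : R -> R -> R.
Hypothesis hTheta : secant_weight f Theta.

(* Where the two minimizers agree, [Theta] is evaluated on the diagonal, where it is
   arbitrary; the weight is set to 0 there. *)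
Definition shock_weight (x t : R) : R :=
  if ym x t < yp x t then Theta (rho_plus g u0 u x t) (rho_minus g u0 u x t) else 0.

Definition front_speed (x t : R) : R :=
  shock_weight x t * ((x - ym x t) / t) + (1 - shock_weight x t) * ((x - yp x t) / t).

Let rp := rho_plus g u0 u.
Let rm := rho_minus g u0 u.

Lemma rho_lt (x t : R) : 0 < t -> ym x t < yp x t -> rp x t < rm x t.
Proof.
move=> t0 lt; rewrite (derive1_conjugate_lt fg) ltr_pM2r ?invr_gt0 //; lra.
Qed.

Lemma f_rho_plus (x t : R) : derive1 f (rp x t) = (x - yp x t) / t.
Proof. exact: (derive1_conjugateK fg). Qed.

Lemma shock_weight01 (x t : R) : 0 < t -> 0 <= shock_weight x t <= 1.
Proof.
move=> t0; rewrite /shock_weight; case: ifPn => [lt|_]; last by rewrite lexx ler01.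
by have [|-> -> _] := @hTheta (rp x t) (rm x t); rewrite ?lt_eqF ?rho_lt.
Qed.

(** The Rankine-Hugoniot speed: the quotients in [front_speed] are the characteristic speeds
    [f'(rho)], and the secant weight is defined by this very mixture. *)
Lemma shock_speed (x t : R) : 0 < t -> ym x t < yp x t ->
  front_speed x t = (f (rp x t) - f (rm x t)) / (rp x t - rm x t).
Proof.
move=> t0 lt; rewrite /front_speed /shock_weight lt.
have [|_ _ ->] := @hTheta (rp x t) (rm x t); first by rewrite lt_eqF ?rho_lt.
by rewrite f_rho_plus /rm /rho_minus (derive1_conjugateK fg).
Qed.

Lemma front_minimizers_cvg (c t : R) : 0 < t ->
  [/\ X c (t + h) @[h --> 0^'+] --> X c t,
      ym (X c (t + h)) (t + h) @[h --> 0^'+] --> ym (X c t) t &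
      yp (X c (t + h)) (t + h) @[h --> 0^'+] --> yp (X c t) t].
Proof.
move=> t0; have [L L0 HL] := @front_lipschitz c t (t + 1) t0.
have cX : X c (t + h) @[h --> 0^'+] --> X c t.
  apply/cvgrPdist_lt => e e0; near=> h.
  have h0 : 0 < h by [].
  have h1 : h < 1 by near: h; apply: nbhs_right_lt.
  have he : h < e / (L + 1) by near: h; apply: nbhs_right_lt; rewrite divr_gt0 // ltr_wpDl.
  have := HL t (t + h) (lexx _) ltac:(lra) ltac:(lra).
  rewrite addrAC subrr add0r distrC => /andP[k1 k2]; rewrite ger0_norm //.
  apply: le_lt_trans k2 _; move: he; rewrite ltr_pdivlMr ?ltr_wpDl //; nra.
have usc (e : R) : 0 < e -> \forall h \near (0 : R)^'+,
    ym (X c t) t - e < ym (X c (t + h)) (t + h) /\ yp (X c (t + h)) (t + h) < yp (X c t) t + e.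
  move=> e0; have [d d0 Hd] := minimizers_usc HS (X c t) t0 e0.
  near=> h; have h0 : 0 < h by [].
  have hd : h < d by near: h; apply: nbhs_right_lt.
  have th0 : 0 < t + h by lra.
  have Xd : `|X c (t + h) - X c t| < d.
    by near: h; move/cvgrPdist_lt: cX => /(_ d d0); apply: filterS => h; rewrite distrC.
  have td : `|t + h - t| < d by rewrite addrAC subrr add0r gtr0_norm.
  split; first by have [] := Hd _ _ _ Xd td (ymP HS _ th0).1.
  by have [] := Hd _ _ _ Xd td (ypP HS _ th0).1.
split => //; apply/cvgrPdist_lt => e e0; near=> h; have h0 : 0 < h by [].
- have := ym_front_mono c t0 (_ : t < t + h) => /(_ ltac:(lra)) h1.
  have [h2 _] : ym (X c t) t - e < ym (X c (t + h)) (t + h) /\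
    yp (X c (t + h)) (t + h) < yp (X c t) t + e by near: h; exact: usc.
  by apply/ltr_normlP; split; lra.
- have := yp_front_mono c t0 (_ : t < t + h) => /(_ ltac:(lra)) h1.
  have [_ h2] : ym (X c t) t - e < ym (X c (t + h)) (t + h) /\
    yp (X c (t + h)) (t + h) < yp (X c t) t + e by near: h; exact: usc.
  by apply/ltr_normlP; split; lra.
Unshelve. all: by end_near.
Qed.

Lemma front_right_derivative (c t : R) : 0 < t ->
  (X c (t + h) - X c t) / h @[h --> 0^'+] --> front_speed (X c t) t.
Proof.
move=> t0; have [cX cm cp] := front_minimizers_cvg c t0.
have cth : t + h @[h --> (0 : R)^'+] --> t.
  rewrite -[X in _ --> X]addr0; apply: cvgD; first exact: cvg_cst.
  by apply: cvg_at_right_filter; exact: cvg_id.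
have cthV : (t + h)^-1 @[h --> (0 : R)^'+] --> t^-1 by apply: cvgV => //; rewrite gt_eqF.
have pos (h : R) : 0 < h -> 0 < t + h /\ t < t + h by split; lra.
have hE (h : R) : t + h - t = h by ring.
have cf : continuous f.
  by move=> x; apply: differentiable_continuous; apply/derivable1_diffP; case: fg.
have cg' := derive1_conjugate_continuous fg.
have := ym_le_yp HS (X c t) t0; rewrite le_eqVlt => /predU1P[eq|lt].
  have -> : front_speed (X c t) t = (X c t - ym (X c t) t) / t.
    by rewrite /front_speed -eq; ring.
  apply: (@squeeze_cvgr _ _ _ _ (fun h => (X c (t + h) - yp (X c (t + h)) (t + h)) / (t + h))
    (fun h => (X c (t + h) - ym (X c (t + h)) (t + h)) / (t + h))).
  - near=> h; have /pos[h0 h1] : 0 < h by [].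
    have := front_slope_ge c t0 h1; have := front_slope_le c t0 h1; rewrite hE => -> ->.
    by [].
  - by rewrite eq; apply: cvgM => //; exact: cvgB.
  - by apply: cvgM => //; exact: cvgB.
rewrite shock_speed //.
have rlt := rho_lt t0 lt.
(* The [r1] slopes join the old point to new minimizers and bound the increment of [u] from below;
   the [r2] slopes join the new point to old minimizers and bound it from above. Pairing a plus
   slope with a minus slope eliminates [u]. *)
pose r1p (h : R) : R := derive1 g ((X c t - yp (X c (t + h)) (t + h)) / t).
pose r1m (h : R) : R := derive1 g ((X c t - ym (X c (t + h)) (t + h)) / t).
pose r2p (h : R) : R := derive1 g ((X c (t + h) - yp (X c t) t) / (t + h)).
pose r2m (h : R) : R := derive1 g ((X c (t + h) - ym (X c t) t) / (t + h)).
have c1p : r1p h @[h --> 0^'+] --> rp (X c t) t.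
  apply: (@cvg_continuous R R _ _ (derive1 g) (fun h => (X c t - yp (X c (t + h)) (t + h)) / t) _ cg').
  by apply: cvgM; [apply: cvgB => //; exact: cvg_cst|exact: cvg_cst].
have c1m : r1m h @[h --> 0^'+] --> rm (X c t) t.
  apply: (@cvg_continuous R R _ _ (derive1 g) (fun h => (X c t - ym (X c (t + h)) (t + h)) / t) _ cg').
  by apply: cvgM; [apply: cvgB => //; exact: cvg_cst|exact: cvg_cst].
have c2p : r2p h @[h --> 0^'+] --> rp (X c t) t.
  apply: (@cvg_continuous R R _ _ (derive1 g) (fun h => (X c (t + h) - yp (X c t) t) / (t + h)) _ cg').
  by apply: cvgM => //; apply: cvgB => //; exact: cvg_cst.
have c2m : r2m h @[h --> 0^'+] --> rm (X c t) t.
  apply: (@cvg_continuous R R _ _ (derive1 g) (fun h => (X c (t + h) - ym (X c t) t) / (t + h)) _ cg').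
  by apply: cvgM => //; apply: cvgB => //; exact: cvg_cst.
have incr (h : R) : 0 < h ->
    [/\ r1p h * (X c (t + h) - X c t) - f (r1p h) * h <= u (X c (t + h)) (t + h) - u (X c t) t,
        r1m h * (X c (t + h) - X c t) - f (r1m h) * h <= u (X c (t + h)) (t + h) - u (X c t) t,
        u (X c (t + h)) (t + h) - u (X c t) t <= r2p h * (X c (t + h) - X c t) - f (r2p h) * h &
        u (X c (t + h)) (t + h) - u (X c t) t <= r2m h * (X c (t + h) - X c t) - f (r2m h) * h].
  move=> /pos[h0 h1]; split.
  - by have := hopf_lax_increment (X c t) t0 h0 (ypP HS (X c (t + h)) h0).1; rewrite /= hE.
  - by have := hopf_lax_increment (X c t) t0 h0 (ymP HS (X c (t + h)) h0).1; rewrite /= hE.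
  - have := hopf_lax_increment (X c (t + h)) h0 t0 (ypP HS (X c t) t0).1; rewrite /= /r2p; lra.
  - have := hopf_lax_increment (X c (t + h)) h0 t0 (ymP HS (X c t) t0).1; rewrite /= /r2m; lra.
apply: (@squeeze_cvgr _ _ _ _ (fun h => (f (r1p h) - f (r2m h)) / (r1p h - r2m h))
    (fun h => (f (r2p h) - f (r1m h)) / (r2p h - r1m h))).
- near=> h; have h0 : 0 < h by [].
  have [i1 i2 i3 i4] := incr h h0.
  have n1 : r1p h - r2m h < 0.
    by near: h; apply: (cvgr_lt _ (cvgB c1p c2m)); rewrite subr_lt0.
  have n2 : r2p h - r1m h < 0.
    by near: h; apply: (cvgr_lt _ (cvgB c2p c1m)); rewrite subr_lt0.
  apply/andP; split.
    rewrite ler_pdivlMr // mulrAC ler_ndivrMr //; lra.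
  rewrite ler_pdivrMr // mulrAC ler_ndivlMr //; lra.
- apply: cvgM; first by apply: cvgB; apply: (cvg_continuous cf).
  by apply: cvgV; [rewrite subr_eq0 lt_eqF|exact: cvgB].
- apply: cvgM; first by apply: cvgB; apply: (cvg_continuous cf).
  by apply: cvgV; [rewrite subr_eq0 lt_eqF|exact: cvgB].
Unshelve. all: by end_near.
Qed.

End Front.

(** * Integration along fronts *)

Section BoundedIntegrals.
Context d {T : measurableType d} {R : realType} (mu : {measure set T -> \bar R}).
Variables (A : set T) (mA : measurable A) (Afin : (mu A < +oo)%E).

Lemma bounded_integrable (f : T -> R) (C : R) : measurable_fun A f ->
  (forall x, A x -> `|f x| <= C) -> mu.-integrable A (EFin \o f).
Proof.
move=> mf fC; apply: measurable_bounded_integrable => //.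
by exists C; split; [exact: num_real|move=> y Cy x Ax; apply: le_trans (fC x Ax) (ltW Cy)].
Qed.

Lemma normr_Rintegral_le (f : T -> R) (C : R) : measurable_fun A f ->
  (forall x, A x -> `|f x| <= C) -> `|\int[mu]_(x in A) f x| <= C * fine (mu A).
Proof.
move=> mf fC; have fi := bounded_integrable mf fC.
apply: le_trans (le_normr_Rintegral mA fi) _.
rewrite -Rintegral_cst //; apply: le_Rintegral => //.
- exact: (integrable_norm fi).
- by apply: (@bounded_integrable _ `|C|); [exact: measurable_cst|move=> x Ax].
Qed.

Lemma bounded_convergence (f_ : nat -> T -> R) (f : T -> R) (C : R) :
  (forall n, measurable_fun A (f_ n)) ->
  (forall x, A x -> f_ ^~ x @ \oo --> f x) ->
  (forall n x, A x -> `|f_ n x| <= C) ->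
  [/\ measurable_fun A f, (forall x, A x -> `|f x| <= C) &
    (fun n => \int[mu]_(x in A) f_ n x) @ \oo --> \int[mu]_(x in A) f x].
Proof.
move=> mf_ cf fC; have mf := measurable_fun_cvg mf_ cf.
have fleC x : A x -> `|f x| <= C.
  move=> Ax; have h : (fun n => `|f_ n x|) @ \oo --> `|f x| by apply: cvg_norm; exact: cf.
  rewrite -(cvg_lim (@Rhausdorff R) h); apply: limr_le.
    by apply/cvg_ex; eexists; exact: h.
  by apply: nearW => n; exact: fC.
split => //.
have fi := bounded_integrable mf fleC.
have cE : (fun n => \int[mu]_(x in A) (f_ n x)%:E)%E @ \oo --> (\int[mu]_(x in A) (f x)%:E)%E.
  apply: (@dominated_cvg _ _ _ mu A mA _ _ (cst C%:E)) => //.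
  - by move=> n; apply/measurable_EFinP.
  - by move=> x Ax; apply: cvg_EFin; [exact: nearW|exact: cf].
  - by apply: (@bounded_integrable (cst C) `|C|); [exact: measurable_cst|move=> x Ax /=; exact: lexx].
apply: (fine_cvg (a := \int[mu]_(x in A) f x)).
by rewrite /Rintegral fineK //; exact: integrable_fin_num.
Qed.

End BoundedIntegrals.

(** * Integrating a right derivative *)

Section RightDerivative.
Context {R : realType}.
Notation mu := (@lebesgue_measure R).

Lemma itv_fin (a b : R) : (mu `[a, b]%classic < +oo)%E.
Proof. by rewrite lebesgue_measure_itv /=; case: ifP => _; rewrite ltry. Qed.

Lemma continuous_itv_measurable (f : R -> R) (a b : R) :
  {within `[a, b], continuous f} -> measurable_fun (`[a, b]%classic : set R) f.
Proof. by move=> cf; apply: subspace_continuous_measurable_fun. Qed.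

Lemma continuous_itv_integrable (f : R -> R) (a b : R) :
  {within `[a, b], continuous f} -> mu.-integrable `[a, b] (EFin \o f).
Proof. by move=> cf; apply: continuous_compact_integrable => //; exact: segment_compact. Qed.

Lemma lipschitz_continuous_within (H : R -> R) (L a b : R) :
  (forall t t' : R, a <= t <= b -> a <= t' <= b -> `|H t' - H t| <= L * `|t' - t|) ->
  {within `[a, b], continuous H}.
Proof.
move=> HL; apply/subspace_continuousP => x /=; rewrite in_itv /= => xab.
apply/cvgrPdist_lt => e e0; apply/nbhs_ballP.
have L0 : 0 < `|L| + 1 by rewrite ltr_wpDl.
exists (e / (`|L| + 1)); first by rewrite /= divr_gt0.
move=> y; rewrite /ball /= ltr_pdivlMr // => xy; rewrite in_itv /= => yab.
apply: le_lt_trans (HL _ _ yab xab) _; apply: le_lt_trans xy.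
rewrite mulrC ler_wpM2l //; have := ler_norm L; lra.
Qed.

Lemma antiderivative_exists (H : R -> R) (m : R) : continuous H ->
  exists K : R -> R, forall x : R, m < x -> is_derive x (1 : R) K (H x).
Proof.
move=> cH; exists (fun x => \int[mu]_(t in `[m, x]) H t) => x mx.
have xx : x < x + 1 by lra.
have Hi : mu.-integrable `[m, x + 1] (EFin \o H).
  by apply: continuous_itv_integrable; exact: continuous_subspaceT.
have [dK KE] := continuous_FTC1_closed xx Hi mx (cH x).
by split; [exact: dK|rewrite -derive1E; exact: KE].
Qed.

Lemma Rintegral_derive (F H : R -> R) (a b : R) : a < b ->
  (forall x : R, a <= x <= b -> is_derive x (1 : R) F (H x)) -> {within `[a, b], continuous H} ->
  \int[mu]_(t in `[a, b]) H t = F b - F a.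
Proof.
move=> ab dF cH; rewrite /Rintegral (@continuous_FTC2 R H F a b ab) //.
- have cF (x : R) : a <= x <= b -> {for x, continuous F}.
    move=> /dF [dx _]; apply: differentiable_continuous.
    by apply/derivable1_diffP.
  split.
  + move=> x; rewrite in_itv /= => /andP[ax xb].
    by have [] := dF x; rewrite ?(ltW ax) ?(ltW xb).
  + by apply: cvg_at_right_filter; apply: cF; rewrite lexx ltW.
  + by apply: cvg_at_left_filter; apply: cF; rewrite lexx ltW.
- move=> x; rewrite in_itv /= => /andP[ax xb].
  by have := dF x; rewrite (ltW ax) (ltW xb) => /(_ isT)[_ <-]; rewrite derive1E.
Qed.

(* The difference quotients of [H], extended to the line by clamping, are bounded
   by [L], so dominated convergence applies. *)
Lemma FTC_right_derivative (H d : R -> R) (L a b b' : R) : a < b -> b < b' ->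
  (forall t t' : R, a <= t <= b' -> a <= t' <= b' -> `|H t' - H t| <= L * `|t' - t|) ->
  (forall t : R, a <= t <= b -> (H (t + h) - H t) / h @[h --> 0^'+] --> d t) ->
  [/\ measurable_fun (`[a, b]%classic : set R) d,
    (forall t : R, a <= t <= b -> `|d t| <= L) &
    \int[mu]_(t in `[a, b]) d t = H b - H a].
Proof.
move=> ab bb' HL Hd.
pose cl (t : R) : R := Num.max a (Num.min t b').
pose H' (t : R) : R := H (cl t).
have clE (t : R) : a <= t <= b' -> cl t = t.
  by move=> /andP[h1 h2]; rewrite /cl min_l // max_r.
have cl_in (t : R) : a <= cl t <= b'.
  by rewrite /cl le_max lexx /= ge_max ge_min lexx orbT andbT; lra.
have cl_lip (t t' : R) : `|cl t' - cl t| <= `|t' - t|.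
  rewrite /cl /Num.max /Num.min; do !case: ifPn; rewrite -?leNgt => *; apply/ler_normlP;
  have := ler_norm (t' - t); have := ler_norm (- (t' - t)); rewrite normrN; split; lra.
have L0 : 0 <= L.
  have := HL a b; rewrite !lexx (ltW ab) (ltW bb') (ltW (lt_trans ab bb')) => /(_ isT isT) h.
  have : 0 <= L * `|b - a| := le_trans (normr_ge0 _) h.
  by rewrite pmulr_lge0 // gtr0_norm; lra.
have H'L (t t' : R) : `|H' t' - H' t| <= L * `|t' - t|.
  by apply: le_trans (HL _ _ (cl_in t) (cl_in t')) _; rewrite ler_wpM2l.
have cH' : continuous H'.
  move=> x; apply/continuous_epsP => e e0; exists (e / (L + 1)); first by rewrite divr_gt0 //; lra.
  move=> y; rewrite ltr_pdivlMr; last lra.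
  by move=> h; apply: le_lt_trans (H'L _ _) _; have := normr_ge0 (y - x); nra.
have [K dK] := antiderivative_exists (a - 1) cH'.
(* The steps stay below [b' - b], so that [t + e n] remains where the Lipschitz bound of [H] holds
   and clamping has no effect. *)
pose e (n : nat) : R := (b' - b) * harmonic n.
have e0 n : 0 < e n by rewrite mulr_gt0 ?invr_gt0 // subr_gt0.
have eb n : e n <= b' - b.
  by rewrite /e ler_piMr ?subr_ge0 ?(ltW bb') // invf_le1 // ler1n.
have ce : e @ \oo --> (0 : R).
  by rewrite -(mulr0 (b' - b)); apply: cvgM; [exact: cvg_cst|exact: cvg_harmonic].
pose q (n : nat) (t : R) : R := (H' (t + e n) - H' t) / e n.
have cq n : continuous (q n).
  move=> t; apply: cvgM; last exact: cvg_cst.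
  apply: cvgB; last exact: cH'.
  by apply: (cvg_continuous cH'); apply: cvgD; [exact: cvg_id|exact: cvg_cst].
have cqi n : {within `[a, b], continuous (q n)} by apply: continuous_subspaceT.
have qd (t : R) : a <= t <= b -> (fun n => q n t) @ \oo --> d t.
  move=> tab; have /cvg_at_rightP/(_ e) := Hd t tab => /(_ (conj e0 ce)).
  apply: cvg_trans; apply: near_eq_cvg; apply: nearW => n.
  have := e0 n; have := eb n; move: tab => /andP[h1 h2] h3 h4.
  by rewrite /q /H' !clE //; apply/andP; split; lra.
have qL n (t : R) : `|q n t| <= L.
  rewrite /q normrM normfV (gtr0_norm (e0 n)) ler_pdivrMr //.
  by apply: le_trans (H'L _ _) _; rewrite addrAC subrr add0r gtr0_norm.
have [md dL cint] : [/\ measurable_fun (`[a, b]%classic : set R) d,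
    (forall t : R, `[a, b]%classic t -> `|d t| <= L) &
    (fun n => \int[mu]_(x in `[a, b]) q n x) @ \oo --> \int[mu]_(x in `[a, b]) d x].
  apply: (@bounded_convergence _ _ _ mu `[a, b]%classic _ (itv_fin a b) q d L) => //.
  by move=> n; exact: continuous_itv_measurable.
split=> //.
(* Integrating the difference quotient of [H'] amounts to taking the difference quotient of its
   antiderivative [K] at the two ends, which tends to [H'] there. *)
have intq n : \int[mu]_(x in `[a, b]) q n x =
    (K (b + e n) - K b) / e n - (K (a + e n) - K a) / e n.
  apply: (@Rintegral_derive (fun t => (K (t + e n) - K t) / e n)) => // x /andP[h1 h2].
  have k1 : is_derive x (1 : R) K (H' x) by apply: dK; lra.
  have k2 : is_derive (x + e n) (1 : R) K (H' (x + e n)) by apply: dK; have := e0 n; lra.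
  have k3 : is_derive x (1 : R) (fun t => t + e n) (1 : R).
    by apply: is_derive_eq; rewrite addr0.
  have k4 : is_derive x (1 : R) (K \o (fun t => t + e n)) (H' (x + e n) * 1).
    by have := @is_derive1_comp R K (fun t => t + e n) x _ _ k2 k3.
  rewrite [X in is_derive _ _ X _](_ : _ = (e n)^-1 \*: ((K \o (fun t => t + e n)) - K)); last first.
    by apply/funext => t /=; rewrite mulrC.
  by apply: is_derive_eq; rewrite /q mulr1 /GRing.scale /= mulrC.
have climK (x : R) : a - 1 < x -> (fun n => (K (x + e n) - K x) / e n) @ \oo --> H' x.
  move=> ax; have [dKx KE] := dK x ax.
  apply/cvgrPdist_lt => eps eps0; have [r r0 Hr] := derivable_eps dKx eps0.
  near=> n; rewrite distrC -KE -derive1E; apply: Hr; first by rewrite gt_eqF.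
  rewrite gtr0_norm //; near: n.
  exact: (cvgr_lt _ ce).
have E : \int[mu]_(x in `[a, b]) d x = H' b - H' a.
  have cint2 : (fun n => \int[mu]_(x in `[a, b]) q n x) @ \oo --> H' b - H' a.
    by rewrite (funext intq); apply: cvgB; apply: climK; lra.
  by rewrite -(cvg_lim (@Rhausdorff R) cint) (cvg_lim (@Rhausdorff R) cint2).
by rewrite E /H' !clE //; apply/andP; split; lra.
Unshelve. all: by end_near.
Qed.

End RightDerivative.

(** * Bounds for functions of two variables *)

Section Planar.
Context {R : realType}.
Notation mu := (@lebesgue_measure R).

Lemma continuous2_eps (k : R -> R -> R) (x t e : R) : continuous2 k -> 0 < e ->
  exists2 d : R, 0 < d & forall y s : R, `|y - x| < d -> `|s - t| < d -> `|k y s - k x t| < e.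
Proof.
move=> ck e0; have /cvgrPdist_lt/(_ e e0) := ck (x, t).
move=> /nbhs_ballP[d /= d0 Hd]; exists d => // y s h1 h2.
by rewrite distrC; apply: (Hd (y, s)); split; rewrite /ball /= distrC.
Qed.

Lemma continuous2_bound (k : R -> R -> R) (a b p q : R) : continuous2 k ->
  exists2 C : R, 0 <= C & forall x t : R, a <= x <= b -> p <= t <= q -> `|k x t| <= C.
Proof.
move=> ck; have [ab|ba] := leP a b; last by exists 0 => // x t; lra.
have [pq|qp] := leP p q; last by exists 0 => // x t; lra.
pose K : set (R * R) := `[a, b] `*` `[p, q].
have cK : compact K by apply: compact_setX; exact: segment_compact.
have K0 : K !=set0 by exists (a, p); split; rewrite /= in_itv /= lexx ?ab ?pq.
have nk : {within K, continuous (fun z : R * R => `|k z.1 z.2|)}.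
  by apply: continuous_subspaceT => z; apply: cvg_norm; exact: ck.
have [[x0 t0] _ m] := compact_EVT_max K0 cK nk.
exists `|k x0 t0| => // x t xab tpq; apply: (m (x, t)); apply: mem_set.
by split; rewrite /= in_itv.
Qed.

Lemma continuous2_fst (k : R -> R -> R) (t : R) : continuous2 k -> continuous (k^~ t).
Proof.
move=> ck x; apply/continuous_epsP => e e0; have [d d0 Hd] := continuous2_eps x t ck e0.
by exists d => // y xy; apply: Hd => //; rewrite subrr normr0.
Qed.

Lemma lipschitz_snd (k : R -> R -> R) (a b p q : R) :
  (forall x t : R, derivable (k x) t 1) -> continuous2 (dt k) ->
  exists2 C : R, 0 <= C & forall x t t' : R, a <= x <= b -> p <= t <= q -> p <= t' <= q ->
    `|k x t' - k x t| <= C * `|t' - t|.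
Proof.
move=> dk cdk; have [C C0 HC] := continuous2_bound a b p q cdk.
exists C => // x t t' xab.
wlog: t t' / t <= t' => [H|tt'] tpq t'pq.
  by case/orP: (le_total t t') => h; [|rewrite distrC (distrC t')]; exact: H.
have D s : is_derive s (1 : R) (k x) (dt k x s).
  by split; [exact: dk|rewrite /dt derive1E].
have [|c] := @MVT_segment _ (k x) (dt k x) t t' tt' (fun s _ => D s).
  apply: continuous_subspaceT => s; apply: differentiable_continuous.
  by apply/derivable1_diffP; exact: dk.
rewrite in_itv /= => cin ->; rewrite normrM ler_wpM2r //; apply: HC => //.
by move: tpq t'pq cin; lra.
Qed.

Lemma Rintegral_itv_split (k : R -> R) (a x b : R) : continuous k -> a <= x -> x <= b ->
  \int[mu]_(y in `[a, b]) k y = \int[mu]_(y in `[a, x]) k y + \int[mu]_(y in `[x, b]) k y.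
Proof.
move=> ck ax xb.
have ki (p q : R) : mu.-integrable `[p, q] (EFin \o k).
  by apply: continuous_itv_integrable; exact: continuous_subspaceT.
have := @Rintegral_itvB R k (BLeft a) (BRight b) x (ki a b); rewrite !bnd_simp => /(_ ax xb) h.
rewrite -(@Rintegral_itv_obnd_cbnd _ x (BRight b)); first by rewrite -h; ring.
by apply: integrableS (ki x b) => //; apply: subset_itvr; rewrite bnd_simp.
Qed.

Lemma fine_itv (a b : R) : a <= b -> fine (mu `[a, b]%classic) = b - a.
Proof.
rewrite lebesgue_measure_itv /= lte_fin le_eqVlt => /predU1P[->|->]; rewrite ?EFinN //=.
by rewrite ltxx subrr.
Qed.

Lemma normr_Rintegral_itv_le (k : R -> R) (a b C : R) : continuous k -> a <= b ->
  (forall x : R, a <= x <= b -> `|k x| <= C) -> `|\int[mu]_(y in `[a, b]) k y| <= C * (b - a).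
Proof.
move=> ck ab kC; rewrite -fine_itv //; apply: normr_Rintegral_le => //.
- exact: itv_fin.
- by apply: continuous_itv_measurable; exact: continuous_subspaceT.
Qed.

End Planar.

(** * Integrals to the right of a front *)

Section FrontIntegrals.
Context {R : realType} (f g u0 : R -> R) (u Theta : R -> R -> R).
Notation mu := (@lebesgue_measure R).
Hypothesis HS : hopf_lax_setting f g u0 u.
Hypothesis hTheta : secant_weight f Theta.
Local Notation X := (front g u0 u).
Local Notation speed := (front_speed g u0 u Theta).

Definition front_integral (k : R -> R -> R) (c K t : R) : R :=
  \int[mu]_(x in `[X c t, K]) k x t.

Lemma front_integral_lipschitz (k : R -> R -> R) (c K tau T : R) : 0 < tau ->
  continuous2 k -> (forall x t : R, derivable (k x) t 1) -> continuous2 (dt k) ->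
  X c T <= K -> exists L : R, forall t t' : R, tau <= t <= T -> tau <= t' <= T ->
    `|front_integral k c K t' - front_integral k c K t| <= L * `|t' - t|.
Proof.
move=> tau0 ck dk cdk XK.
have [L L0 HL] := front_lipschitz HS c T tau0.
have [C0 C00 HC0] := continuous2_bound c K tau T ck.
have [C1 C10 HC1] := lipschitz_snd c K tau T dk cdk.
have XKt (t : R) : tau <= t <= T -> c <= X c t <= K.
  move=> /andP[h1 h2]; rewrite (le_front HS) ?(lt_le_trans tau0) //=.
  by apply: le_trans (front_nd HS c (lt_le_trans tau0 h1) h2) XK.
(* The first term accounts for the change of [k] over an interval inside [[c, K]], the second for
   the strip swept by the front. *)
exists (C1 * (K - c) + C0 * L) => t t'.
wlog: t t' / t <= t' => [H|tt'] tT t'T.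
  by case/orP: (le_total t t') => h; [|rewrite distrC (distrC t')]; exact: H.
have /andP[h1 h2] := XKt t tT; have /andP[h3 h4] := XKt t' t'T.
have /andP[] := HL t t' ltac:(lra) tt' ltac:(lra); rewrite subr_ge0 => h5 h6.
have kt s : continuous (k^~ s) by exact: continuous2_fst.
rewrite /front_integral (Rintegral_itv_split (kt t) h5 h4).
have ki (s p q : R) : mu.-integrable `[p, q] (EFin \o (k^~ s)).
  by apply: continuous_itv_integrable; apply: continuous_subspaceT; exact: kt.
set I1 := Rintegral _ _ _; set I2 := Rintegral _ _ _; set I3 := Rintegral _ _ _.
have -> : I1 - (I2 + I3) = (I1 - I3) - I2 by ring.
have E : I1 - I3 = \int[mu]_(x in `[X c t', K]) (k x t' - k x t).
  by rewrite RintegralB.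
have b1 : `|I1 - I3| <= C1 * (t' - t) * (K - X c t').
  rewrite E; apply: normr_Rintegral_itv_le => //; first by move=> x; apply: cvgB; exact: kt.
  move=> x xX; have := HC1 x t t' _ tT t'T; rewrite (ger0_norm (_ : 0 <= t' - t)); last lra.
  by apply; lra.
have b2 : `|I2| <= C0 * (X c t' - X c t).
  apply: normr_Rintegral_itv_le => // x xX; apply: HC0 => //; lra.
apply: le_trans (ler_normB _ _) _; rewrite (ger0_norm (_ : 0 <= t' - t)); last lra.
have : C1 * (t' - t) * (K - X c t') <= C1 * (t' - t) * (K - c).
  by rewrite ler_wpM2l ?mulr_ge0 //; lra.
nra.
Qed.

Lemma front_integral_right_derivative (k : R -> R -> R) (c K t T : R) : 0 < t -> t < T ->
  continuous2 k -> (forall x t : R, derivable (k x) t 1) -> continuous2 (dt k) ->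
  X c T <= K ->
  (front_integral k c K (t + h) - front_integral k c K t) / h @[h --> 0^'+] -->
    front_integral (dt k) c K t - k (X c t) t * speed (X c t) t.
Proof.
move=> t0 tT ck dk cdk XK.
have [L L0 HL] := front_lipschitz HS c T t0.
have kt s : continuous (k^~ s) by exact: continuous2_fst.
have ki (s p q : R) : mu.-integrable `[p, q] (EFin \o (k^~ s)).
  by apply: continuous_itv_integrable; apply: continuous_subspaceT; exact: kt.
(* [F] freezes the moving end point, so it can be differentiated under the integral. [E] is the
   error of replacing [k] on the swept strip by its value at the front; it is o(h), since the strip
   has width O(h) and [k] is continuous. *)
pose F (s : R) : R := \int[mu]_(x in `[X c t, K]) k x s.
pose E (h : R) : R := \int[mu]_(x in `[X c t, X c (t + h)]) (k x (t + h) - k (X c t) t).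
have dF : (F (t + h) - F t) / h @[h --> 0^'+] --> front_integral (dt k) c K t.
  have [C C0 HC] := continuous2_bound (X c t) K (t - 1) (t + 1) cdk.
  have := @cvg_differentiation_under_integral R _ _ mu (fun s x => k x s) `[X c t, K]%classic
    _ t (t - 1) (t + 1) _ _ _ (cst C) _ _ _.
  have I0 : `]t - 1, t + 1[%classic t by rewrite /= in_itv /=; apply/andP; split; lra.
  have iC : mu.-integrable `[X c t, K] (EFin \o cst C).
    by apply: continuous_itv_integrable; apply: continuous_subspaceT => x; exact: cvg_cst.
  move=> /(_ (measurable_itv _) I0 (fun s _ => ki s _ _) (fun s x _ _ => dk x s)).
  move=> /(_ (fun _ => C0) iC) H.
  have {}H : h^-1 *: (F (h + t) - F t) @[h --> 0^'] --> front_integral (dt k) c K t.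
    apply: H => s x /=; rewrite !in_itv /= => /andP[s1 s2] xX.
    by apply: (HC x s xX); rewrite !ltW.
  have {}H : h^-1 *: (F (h + t) - F t) @[h --> 0^'+] --> front_integral (dt k) c K t.
    apply: cvg_trans H; apply: cvg_app; apply: within_subset => h /=.
    by rewrite lt_neqAle eq_sym => /andP[].
  suff -> : (fun h : R => (F (t + h) - F t) / h) = (fun h => h^-1 *: (F (h + t) - F t)) by [].
  by apply/funext => h; rewrite (addrC h) /GRing.scale /= mulrC.
have cE : E h / h @[h --> 0^'+] --> (0 : R).
  apply/cvgrPdist_lt => e e0; have eL : 0 < e / (L + 1) by rewrite divr_gt0 //; lra.
  have [d d0 Hd] := continuous2_eps (X c t) t ck eL.
  have [cX _ _] := front_minimizers_cvg HS c t0.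
  near=> h; have h0 : 0 < h by [].
  have hd : h < d by near: h; apply: nbhs_right_lt.
  have hT : h < T - t by near: h; apply: nbhs_right_lt; rewrite subr_gt0.
  have Xd : `|X c t - X c (t + h)| < d by near: h; move/cvgrPdist_lt: cX; apply.
  have /andP[] := HL t (t + h) (lexx _) ltac:(lra) ltac:(lra).
  rewrite addrAC subrr add0r subr_ge0 => X1 X2.
  have bE : `|E h| <= e / (L + 1) * (X c (t + h) - X c t).
    apply: normr_Rintegral_itv_le => //.
      by move=> x; apply: cvgB; [exact: kt|exact: cvg_cst].
    move=> x /andP[x1 x2]; apply: ltW; apply: Hd; last by rewrite addrAC subrr add0r gtr0_norm.
    by move: Xd; rewrite distrC !ger0_norm; lra.
  rewrite sub0r normrN normrM normfV (gtr0_norm h0) ltr_pdivrMr //.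
  apply: le_lt_trans bE _; rewrite mulrAC ltr_pdivrMr; last lra.
  by rewrite -mulrA ltr_pM2l //; nra.
have split_h : \forall h \near (0 : R)^'+,
    (F (t + h) - F t) / h - E h / h - k (X c t) t * ((X c (t + h) - X c t) / h) =
    (front_integral k c K (t + h) - front_integral k c K t) / h.
  near=> h; have h0 : 0 < h by [].
  have hT : h < T - t by near: h; apply: nbhs_right_lt; rewrite subr_gt0.
  have X1 : X c t <= X c (t + h) by apply: (front_nd HS) => //; lra.
  have X2 : X c (t + h) <= K by apply: le_trans (front_nd HS c _ _) XK; lra.
  have -> : E h = \int[mu]_(x in `[X c t, X c (t + h)]) k x (t + h)
      - k (X c t) t * (X c (t + h) - X c t).
    rewrite /E RintegralB //; last first.
      by apply: continuous_itv_integrable; apply: continuous_subspaceT => x; exact: cvg_cst.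
    by rewrite Rintegral_cst // fine_itv.
  rewrite /F /front_integral (Rintegral_itv_split (kt (t + h)) X1 X2).
  by field; rewrite gt_eqF.
apply: cvg_trans (near_eq_cvg split_h) _.
have -> : front_integral (dt k) c K t - k (X c t) t * speed (X c t) t =
  front_integral (dt k) c K t - 0 - k (X c t) t * speed (X c t) t by rewrite subr0.
apply: cvgB; first exact: cvgB.
by apply: cvgM; [exact: cvg_cst|exact: (front_right_derivative HS hTheta)].
Unshelve. all: by end_near.
Qed.

End FrontIntegrals.

(** * The flux as a charge *)

Section Stieltjes.
Context {R : realType}.
Notation T := (measurableTypeR R).

Definition clip (a b z : R) : R := Num.max a (Num.min z b).

Lemma clip_itvoc (a b x y : R) :
  `]x, y] `&` `]a, b] = `](clip a b x), (clip a b y)]%classic.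
Proof.
apply/seteqP; split=> z /=; rewrite !in_itv /= /clip gt_max gt_min le_max le_min.
  by move=> [/andP[-> ->] /andP[-> ->]]; rewrite orbT.
move=> /andP[/andP[az xb] /orP[za|/andP[zy zb]]]; first by move: az; rewrite ltNge za.
case/orP: xb => [xz|bz]; last by move: bz; rewrite ltNge zb.
by split; apply/andP; split.
Qed.

Lemma clip_ray (a b x : R) :
  `]x, +oo[ `&` `]a, b] = `](clip a b x), b]%classic.
Proof.
apply/seteqP; split=> z /=; rewrite !in_itv /= andbT /clip gt_max gt_min.
  by move=> [-> /andP[-> ->]].
move=> /andP[/andP[az xb] zb]; case/orP: xb => [xz|bz]; last by move: bz; rewrite ltNge zb.
by rewrite az.
Qed.

Lemma clip_in (a b x : R) : a < b -> a <= clip a b x <= b.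
Proof. by move=> ab; rewrite /clip le_max lexx /= ge_max ge_min lexx orbT andbT ltW. Qed.

Lemma clip_le (a b x y : R) : x <= y -> clip a b x <= clip a b y.
Proof. by move=> xy; rewrite /clip /Num.max /Num.min; do !case: ifPn; rewrite -?leNgt; lra. Qed.

(** Restricting the Lebesgue-Stieltjes measure of [D] to []a, b]] makes it finite, as needed for a
    charge; on intervals the restriction clips the end points. *)
Lemma clipped_stieltjes (D : R -> R) (a b : R) : a < b -> {homo D : x y / x <= y} ->
  (forall x : R, D @ x^'+ --> D x) ->
  exists m : {finite_measure set T -> \bar R},
   [/\ (forall x y : R, x <= y -> m `]x, y]%classic = (D (clip a b y) - D (clip a b x))%:E),
      (forall x : R, m `]x, +oo[%classic = (D b - D (clip a b x))%:E),
      m setT = (D b - D a)%:E & m (~` `]a, b]) = 0%E].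
Proof.
move=> ab Dnd Drc.
pose D' : cumulative R R := HB.pack D (isCumulative.Build R _ R D Dnd Drc).
pose l := lebesgue_stieltjes_measure D'.
have lE (x y : R) : x <= y -> l (`]x, y]%classic : set T) = (D y - D x)%:E.
  move=> xy; rewrite /l /lebesgue_stieltjes_measure /measure_extension measurable_mu_extE /=.
    by rewrite wlength_itv_bnd.
  exact: is_ocitv.
have mD : measurable (`]a, b]%classic : set T) by exact: measurable_itv.
have lfin : (l `]a, b]%classic < +oo)%E by rewrite lE ?ltW // ltry.
exists (mfrestr mD lfin); split; rewrite /= /mfrestr /mrestr -/l.
- by move=> x y xy; rewrite clip_itvoc // lE // clip_le.
- by move=> x; rewrite clip_ray // lE //; case/andP: (clip_in x ab).
- by rewrite setTI lE // ltW.
- by rewrite setICl; exact: (@measure0 _ _ _ (lebesgue_stieltjes_measure D')).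
Qed.

(** As [D] majorizes the variation of [F], both [(D + F) / 2] and [(D - F) / 2] are nondecreasing,
    and the charge is the difference of their measures. These dominate the Jordan parts, whence the
    bound on the total variation. Rays are evaluated because front indicators are built from
    them. *)
Lemma stieltjes_charge (F D : R -> R) (a b : R) : a < b ->
  (forall x y : R, x <= y -> `|F y - F x| <= D y - D x) ->
  (forall x : R, D @ x^'+ --> D x) -> (forall x : R, F @ x^'+ --> F x) ->
  (forall x : R, x <= a -> F x = 0) -> (forall x : R, b <= x -> F x = 0) ->
  exists (nu : {charge set T -> \bar R}) (P N : set T) (nuPN : hahn_decomposition nu P N),
  let p := jordan_pos nuPN in let n := jordan_neg nuPN in
  [/\ (forall x y : R, x <= y -> nu `]x, y]%classic = (F y - F x)%:E),
      fine (p setT) + fine (n setT) <= D b - D a,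
      p (~` `]a, b]) = 0%E /\ n (~` `]a, b]) = 0%E,
      (forall x : R, fine (p `]x, +oo[%classic) - fine (n `]x, +oo[%classic) = - F x) &
      (forall x l : R, F @ x^'- --> l ->
         fine (p `[x, +oo[%classic) - fine (n `[x, +oo[%classic) = - l)].
Proof.
move=> ab FD Drc Frc Fa Fb.
pose D1 (x : R) : R := (D x + F x) / 2; pose D2 (x : R) : R := (D x - F x) / 2.
have D1nd : {homo D1 : x y / x <= y}.
  by move=> x y /FD /ler_normlP[h1 h2]; rewrite /D1; lra.
have D2nd : {homo D2 : x y / x <= y}.
  by move=> x y /FD /ler_normlP[h1 h2]; rewrite /D2; lra.
have D1rc (x : R) : D1 @ x^'+ --> D1 x.
  by apply: cvgM; [apply: cvgD|exact: cvg_cst].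
have D2rc (x : R) : D2 @ x^'+ --> D2 x.
  by apply: cvgM; [apply: cvgB|exact: cvg_cst].
have Fclip (x : R) : F (clip a b x) = F x.
  rewrite /clip /Num.max /Num.min; do !case: ifPn; rewrite -?leNgt => h1 h2 //.
  - by rewrite !Fb.
  - by rewrite !Fa // ltW.
  - by rewrite !Fa //; lra.
have [m1 [m1oc m1ray m1T m1C]] := clipped_stieltjes ab D1nd D1rc.
have [m2 [m2oc m2ray m2T m2C]] := clipped_stieltjes ab D2nd D2rc.
pose c1 : {charge set T -> \bar R} := charge_of_finite_measure m1.
pose c2 : {charge set T -> \bar R} := charge_of_finite_measure m2.
pose nu : {charge set T -> \bar R} := cadd c1 (copp c2).
have nuE (A : set T) : nu A = (m1 A - m2 A)%E by [].
have [P [N nuPN]] := Hahn_decomposition nu.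
exists nu, P, N, nuPN; cbv zeta.
set p := jordan_pos nuPN; set n := jordan_neg nuPN.
have [[mP _] [mN _] _ _] := nuPN.
have pE (A : set T) : measurable A -> p A = (m1 (A `&` P) - m2 (A `&` P))%E.
  by move=> mA; rewrite /p jordan_posE cjordan_posE /crestr0 mem_set.
have nE (A : set T) : measurable A -> n A = (- (m1 (A `&` N) - m2 (A `&` N)))%E.
  by move=> mA; rewrite /n jordan_negE cjordan_negE /crestr0 mem_set.
have p_le (A : set T) : measurable A -> (p A <= m1 A)%E.
  move=> mA; rewrite pE //; apply: (@le_trans _ _ (m1 (A `&` P))).
    by rewrite leeBlDr ?fin_num_measure ?leeDl //; exact: measurableI.
  by apply: le_measure; rewrite ?inE //; exact: measurableI.
have n_le (A : set T) : measurable A -> (n A <= m2 A)%E.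
  move=> mA; rewrite nE // fin_num_oppeB ?fin_num_measure //; try exact: measurableI.
  rewrite addeC; apply: (@le_trans _ _ (m2 (A `&` N))).
    by rewrite leeBlDr ?fin_num_measure ?leeDl //; exact: measurableI.
  by apply: le_measure; rewrite ?inE //; exact: measurableI.
have mC : measurable (~` `]a, b]%classic : set T) by apply: measurableC; exact: measurable_itv.
have pnE (A : set T) : measurable A -> fine (p A) - fine (n A) = fine (m1 A) - fine (m2 A).
  move=> mA; have := jordan_decomp nuPN mA; rewrite nuE /cadd /= cscaleN1 -/p -/n => /(congr1 fine).
  by rewrite !fineB ?fin_num_measure.
have ray (x : R) : fine (p `]x, +oo[%classic) - fine (n `]x, +oo[%classic) = - F x.
  rewrite pnE; last exact: measurable_itv.
  by rewrite m1ray m2ray /= -(Fclip x) /D1 /D2 (Fb b (lexx _)); field.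
split.
- move=> x y xy; rewrite nuE m1oc // m2oc // -EFinB -(Fclip x) -(Fclip y) /D1 /D2.
  by congr EFin; field.
- have h1 : fine (p setT) <= D1 b - D1 a.
    by rewrite -lee_fin fineK ?fin_num_measure // -m1T; exact: p_le.
  have h2 : fine (n setT) <= D2 b - D2 a.
    by rewrite -lee_fin fineK ?fin_num_measure // -m2T; exact: n_le.
  by move: h1 h2; rewrite /D1 /D2; lra.
- split; apply/eqP; rewrite eq_le measure_ge0 andbT; first by rewrite -m1C; exact: p_le.
  by rewrite -m2C; exact: n_le.
- exact: ray.
- move=> x l Fl.
  (* The closed ray is the decreasing limit of open rays, so its mass involves the left limit of [F]
     instead of the value at [x]. *)
  pose E (k : nat) : set T := `]x - harmonic k, +oo[%classic.
  have EE : \bigcap_k E k = `[x, +oo[%classic.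
    apply/seteqP; split=> z /=.
      rewrite in_itv /= andbT => h; rewrite leNgt; apply/negP => zx.
      move/ltr_add_invr: zx => [k zk]; have := h k I; rewrite /E /= in_itv /= andbT.
      by rewrite ltrBlDr => /lt_trans/(_ zk); rewrite ltxx.
    rewrite in_itv /= andbT => xz k _; rewrite /E /= in_itv /= andbT.
    by apply: lt_le_trans xz; rewrite ltrBlDr ltrDl invr_gt0.
  have mE k : measurable (E k) by exact: measurable_itv.
  have Enon : nonincreasing_seq E.
    move=> i j ij; apply/subsetPset => z; rewrite /E /= !in_itv /= !andbT.
    by apply: le_lt_trans; rewrite lerD2l lerN2 lef_pV2 ?posrE // ler_nat ltnS.
  have cE (m : {finite_measure set T -> \bar R}) : (fun k => fine (m (E k))) @ \oo --> fine (m `[x, +oo[%classic).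
    have mI : measurable (`[x, +oo[%classic : set T) by exact: measurable_itv.
    apply: fine_cvg; rewrite fineK; last by apply: fin_num_measure.
    rewrite -EE; apply: nonincreasing_cvg_mu => //.
    - by rewrite ltey_eq fin_num_measure.
    - exact: bigcap_measurable.
  have c1' : (fun k => fine (p (E k)) - fine (n (E k))) @ \oo -->
      fine (p `[x, +oo[%classic) - fine (n `[x, +oo[%classic) by apply: cvgB; exact: cE.
  have c2' : (fun k => fine (p (E k)) - fine (n (E k))) @ \oo --> - l.
    rewrite (_ : (fun k => _) = (fun k => - F (x - harmonic k))); last first.
      by apply/funext => k; rewrite /E ray.
    apply: cvgN; move/cvg_at_leftP: Fl; apply; split; first by move=> k; rewrite ltrBlDr ltrDl invr_gt0.
    rewrite -[X in _ --> X]subr0; apply: cvgB; [exact: cvg_cst|exact: cvg_harmonic].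
  by rewrite -(cvg_lim (@Rhausdorff R) c1') (cvg_lim (@Rhausdorff R) c2').
Qed.

End Stieltjes.

(** * Finite measures concentrated on a set *)

Section Concentrated.
Context d {T : measurableType d} {R : realType} (m : {finite_measure set T -> \bar R}).
Variables (A : set T) (mA : measurable A) (mCA : m (~` A) = 0%E).

Lemma concentrated_bounded (v : T -> R) (C : R) : measurable_fun setT v ->
  (forall x, A x -> `|v x| <= C) ->
  m.-integrable setT (EFin \o v) /\ `|\int[m]_x v x| <= C * fine (m setT).
Proof.
move=> mv vC.
have vi : m.-integrable setT (EFin \o v).
  apply/(negligible_integrable (measurableC mA) measurableT _ mCA).
    exact/measurable_EFinP.
  rewrite setTD setCK; apply: (@bounded_integrable _ _ _ m A mA _ v C) => //.
  - by rewrite ltey_eq fin_num_measure.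
  - exact: measurable_funS mv.
split => //; have -> : m setT = m A.
  have := measureU m mA (measurableC mA) (setICr A).
  by rewrite setUv => ->; rewrite -[RHS]adde0; congr (_ + _)%E; exact: mCA.
have -> : \int[m]_x v x = \int[m]_(x in A) v x.
  rewrite /Rintegral (negligible_integral (measurableC mA) measurableT vi mCA).
  by rewrite setTD setCK.
apply: normr_Rintegral_le => //; first by rewrite ltey_eq fin_num_measure.
exact: measurable_funS mv.
Qed.

End Concentrated.

(** * Approximation by sums of front indicators *)

Section Grid.
Context {R : realType}.

(** Only [y] is confined to the compact interval, because the grid of [step_approximation] begins to
    the left of it. *)
Lemma uniform_continuity (v : R -> R) (a b e : R) : continuous v -> 0 < e ->
  exists2 d : R, 0 < d & forall y y' : R, a <= y <= b -> `|y' - y| < d -> `|v y' - v y| <= e.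
Proof.
move=> cv e0; have e20 : 0 < e / 2 by lra.
have cK : compact `[a, b]%classic by exact: (@segment_compact R a b).
pose P (d y : R) := forall y' : R, `|y' - y| < d -> `|v y' - v y| <= e.
have H (y : R) : `[a, b]%classic y -> \forall z \near y & r \near (0 : R)^'+, P r z.
  move=> _; have [d d0 Hd] := (continuous_epsP v y).1 (cv y) _ e20.
  exists ([set z | `|z - y| < d / 2], [set r : R | r < d / 2]) => /=.
    split; last by apply: nbhs_right_lt; lra.
    apply/nbhs_ballP; exists (d / 2) => /=; first lra.
    by move=> z; rewrite /ball /= distrC.
  move=> [z r] [/= h1 h2] y' h3.
  have k1 := Hd z ltac:(lra).
  have k2 : `|v y' - v y| < e / 2.
    apply: Hd; have -> : y' - y = (y' - z) + (z - y) by ring.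
    by apply: le_lt_trans (ler_normD _ _) _; lra.
  have -> : v y' - v z = (v y' - v y) - (v z - v y) by ring.
  by apply: le_trans (ler_normB _ _) _; lra.
have near0 := (compact_near_coveringP _).1 cK R (0 : R)^'+ P _ H.
have : \forall d \near (0 : R)^'+, 0 < d /\ `[a, b]%classic `<=` P d.
  by apply: filterS2 (near0 _) (nbhs_right_gt 0) => d.
move=> /filter_ex[d [d0 Hd]]; exists d => // y y' yab.
by apply: Hd; rewrite /= in_itv.
Qed.

(* Letting [P] be either [c < y] or [c <= y] provides the same step function with
   both one-sided values at the jumps. *)
Lemma step_approximation (v : R -> R) (B b e : R) : continuous v -> 0 < e ->
  exists s : seq (R * R), forall (y : R) (P : R -> bool), B <= y <= b ->
    (forall c : R, c < y -> P c) -> (forall c : R, P c -> c <= y) ->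
    `|v y - \sum_(ac <- s) ac.1 * (P ac.2)%:R| <= e.
Proof.
move=> cv e0; have [d d0 Hd] := uniform_continuity B b cv e0.
pose h : R := d / 2; have h0 : 0 < h by rewrite /h; lra.
(* Starting one step before [B] ensures that [P (c 0)] always holds, so the first coefficient
   [v (c 0)] is always counted. *)
pose c (k : nat) : R := B - h + k%:R * h.
have cS k : c k.+1 = c k + h by rewrite /c -natr1; ring.
pose al (k : nat) : R := if k is k'.+1 then v (c k) - v (c k') else v (c 0).
have [N cN] : exists N : nat, b < c N.
  exists (Num.bound `|(b - (B - h)) / h|).
  rewrite /c -ltrBlDl -ltr_pdivrMr //; apply: le_lt_trans (ler_norm _) _.
  exact/archi_boundP/normr_ge0.
exists [seq (al k, c k) | k <- iota 0 N.+1] => y P yBb P1 P2.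
rewrite big_map /=.
(* The coefficients are increments of [v] on the grid, so the sum telescopes to [v] at the last grid
   level where [P] holds. *)
have key n : exists k : nat, [/\ (k <= n)%N, P (c k),
    \sum_(j <- iota 0 n.+1) al j * (P (c j))%:R = v (c k) & (k = n) \/ ~~ P (c k.+1)].
  elim: n => [|n [k [kn Pk sE kE]]].
    exists 0; have P0 : P (c 0) by apply: P1; rewrite /c mul0r; lra.
    by split=> //; [rewrite big_seq1 P0 mulr1|left].
  rewrite -[n.+2]addn1 iotaD big_cat /= add0n big_seq1 sE.
  have [Pn|nPn] := boolP (P (c n.+1)).
    exists n.+1; split=> //; last by left.
    have -> : k = n.
      apply/eqP; rewrite eqn_leq kn leqNgt /=; apply/negP => kn'.
      case: kE => [E|/negP[]]; first by rewrite E ltnn in kn'.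
      apply: P1; apply: lt_le_trans (P2 _ Pn).
      by rewrite /c ltrD2l ltr_pM2r // ltr_nat ltnS.
    by rewrite /al mulr1; ring.
  exists k; split=> //; [exact: leq_trans kn _|by rewrite mulr0 addr0|right].
  by case: kE => [->|].
have [k [kN Pk -> kE]] := key N.
have nPk : ~~ P (c k.+1).
  case: kE => // kN'; move: Pk; rewrite kN' => /P2; lra.
have yk : y <= c k.+1 by rewrite leNgt; apply/negP => /P1; apply/negP.
have ky := P2 _ Pk; move: yk; rewrite cS => yk.
by rewrite distrC; apply: Hd => //; apply/ltr_normlP; split; rewrite /h in yk *; lra.
Qed.

End Grid.

(** * Time slices of the transported function *)

Section Slice.
Context {R : realType} (f g u0 v0 : R -> R) (u Theta : R -> R -> R).
Hypothesis HS : hopf_lax_setting f g u0 u.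
Hypothesis hTheta : secant_weight f Theta.
Local Notation ym := (y_minus g u0 u).
Local Notation yp := (y_plus g u0 u).
Local Notation X := (front g u0 u).
Local Notation speed := (front_speed g u0 u Theta).
Local Notation sw := (shock_weight g u0 u Theta).

Definition front_indicator (c t x : R) : R :=
  sw (X c t) t * \1_`[X c t, +oo[ x + (1 - sw (X c t) t) * \1_`]X c t, +oo[ x.

Definition front_sum (s : seq (R * R)) (t x : R) : R :=
  \sum_(ac <- s) ac.1 * front_indicator ac.2 t x.

Lemma transportedE (t x : R) : 0 < t ->
  transported g u0 v0 u Theta x t = sw x t * v0 (yp x t) + (1 - sw x t) * v0 (ym x t).
Proof.
move=> t0; rewrite /transported /shock_weight; case: ltP => // h.
have -> : yp x t = ym x t by apply/le_anti; rewrite h (ym_le_yp HS).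
by ring.
Qed.

(** The weight may be taken at [x] because away from the front the two indicators agree. It then no
    longer depends on [c] and factors out of sums over levels. *)
Lemma front_indicatorE (c t x : R) : 
  front_indicator c t x = sw x t * (X c t <= x)%R%:R + (1 - sw x t) * (X c t < x)%R%:R.
Proof.
rewrite /front_indicator !indicE !mem_setE !in_itv /= !andbT.
by case: ltgtP => [_|_|->] /=; ring.
Qed.

(** One step function approximates [v0] at both extreme minimizers: the test [X c t <= x] selects
    the levels for [yp x t], and [X c t < x] those for [ym x t]. The list is chosen before [t] and
    [x], so the error is uniform in time. *)
Lemma front_sum_approximation (B b e : R) : continuous v0 -> 0 < e ->
  exists s : seq (R * R), forall t x : R, 0 < t -> B <= ym x t -> yp x t <= b ->
    `|transported g u0 v0 u Theta x t - front_sum s t x| <= e.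
Proof.
move=> cv e0; have [s Hs] := step_approximation B b cv e0; exists s => t x t0 Bx xb.
have my := ym_le_yp HS x t0.
have h1 := Hs (yp x t) (fun c => X c t <= x) ltac:(lra) (fun c => front_le HS t0)
  (fun c => front_le_yp HS t0).
have h2 := Hs (ym x t) (fun c => X c t < x) ltac:(lra)
  (fun c h => etrans (front_lt HS c x t0) h)
  (fun c h => ltW (etrans (esym (front_lt HS c x t0)) h)).
rewrite transportedE // /front_sum.
have -> : \sum_(ac <- s) ac.1 * front_indicator ac.2 t x =
    sw x t * (\sum_(ac <- s) ac.1 * (X ac.2 t <= x)%R%:R) +
    (1 - sw x t) * (\sum_(ac <- s) ac.1 * (X ac.2 t < x)%R%:R).
  rewrite !mulr_sumr -big_split /=; apply: eq_bigr => ac _.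
  by rewrite front_indicatorE; ring.
have /andP[w0 w1] := shock_weight01 HS hTheta x t0.
move: h1 h2; set S1 : R := \sum_(_ <- _) _; set S2 : R := \sum_(_ <- _) _.
move=> /ler_normlP[a1 a2] /ler_normlP[a3 a4]; apply/ler_normlP; split; nra.
Qed.

Lemma measurable_front_indicator (c t : R) : measurable_fun setT (front_indicator c t).
Proof.
apply: measurable_funD; apply: measurable_funM => //.
Qed.

Lemma measurable_front_sum (s : seq (R * R)) (t : R) : measurable_fun setT (front_sum s t).
Proof.
elim: s => [|ac s IH].
  by rewrite (_ : front_sum [::] t = cst 0) //; apply/funext => x; rewrite /front_sum big_nil.
rewrite (_ : front_sum (ac :: s) t = fun x => ac.1 * front_indicator ac.2 t x + front_sum s t x).
  apply: measurable_funD => //; apply: measurable_funM => //; exact: measurable_front_indicator.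
by apply/funext => x; rewrite /front_sum big_cons.
Qed.

Lemma front_indicator_le1 (c t x : R) : 0 < t -> `|front_indicator c t x| <= 1.
Proof.
move=> t0; have /andP[w0 w1] := shock_weight01 HS hTheta x t0.
rewrite front_indicatorE; case: (X c t <= x); case: (X c t < x) => /=; apply/ler_normlP; split; lra.
Qed.

Lemma front_sum_bounded (s : seq (R * R)) : exists C : R, forall t x : R, 0 < t ->
  `|front_sum s t x| <= C.
Proof.
exists (\sum_(ac <- s) `|ac.1|) => t x t0; apply: le_trans (ler_norm_sum _ _ _) _.
apply: ler_sum => ac _; rewrite normrM ler_piMr //; exact: front_indicator_le1.
Qed.

Lemma yp_right_lt (x t e : R) : 0 < t -> 0 < e -> exists2 d : R, 0 < d &
  forall x' : R, x <= x' -> x' < x + d -> yp x t <= yp x' t < yp x t + e.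
Proof.
move=> t0 e0; have [d d0 Hd] := minimizers_usc HS x t0 e0; exists d => // x' h1 h2.
rewrite (yp_nd HS t0) //=.
by apply: (Hd x' t _ _ _ (ypP HS x' t0).1).2; rewrite ?subrr ?normr0 // ger0_norm; lra.
Qed.

Lemma yp_right_cvg (x t : R) : 0 < t -> yp^~ t @ x^'+ --> yp x t.
Proof.
move=> t0; apply/cvgrPdist_lt => e e0; have [d d0 Hd] := yp_right_lt x t0 e0.
near=> x'; have h1 : x < x' by [].
have h2 : x' < x + d by near: x'; apply: nbhs_right_lt; lra.
have /andP[k1 k2] := Hd x' (ltW h1) h2; apply/ltr_normlP; split; lra.
Unshelve. all: by end_near.
Qed.

Lemma yp_left_cvg (x t : R) : 0 < t -> yp^~ t @ x^'- --> ym x t.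
Proof.
move=> t0; apply/cvgrPdist_lt => e e0; have [d d0 Hd] := minimizers_usc HS x t0 e0.
near=> x'; have h1 : x' < x by [].
have h2 : x - d < x' by near: x'; apply: nbhs_left_gt; lra.
have k1 := yp_le_ym HS t0 h1.
have k2 : ym x t - e < yp x' t.
  apply: (Hd x' t _ _ _ (ypP HS x' t0).1).1; rewrite ?subrr ?normr0 //.
  by apply/ltr_normlP; split; lra.
apply/ltr_normlP; split; lra.
Unshelve. all: by end_near.
Qed.

Lemma Rintegral_indic d (T : measurableType d) (m : {finite_measure set T -> \bar R})
  (A : set T) : measurable A -> m.-integrable setT (EFin \o \1_A) /\ \int[m]_x \1_A x = fine (m A).
Proof.
move=> mA; split; last by rewrite /Rintegral integral_indic // setIT.
apply: (@bounded_integrable _ _ _ m setT measurableT _ (\1_A) 1) => //.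
- by rewrite ltey_eq fin_num_measure.
- by move=> x _; rewrite indicE; case: (x \in A); rewrite ?normr1 ?normr0.
Qed.

(** * The flux measure on one time slice *)

Section Flux.
Variables (p : R -> R) (a b B C0 C1 t : R).
Hypotheses (t0 : 0 < t) (ab : a < b) (cp : continuous p).
Hypothesis p_bound : forall x : R, a <= x <= b -> `|p x| <= C0.
Hypothesis p_lip : forall x y : R, a <= x <= b -> a <= y <= b -> `|p y - p x| <= C1 * `|y - x|.
Hypothesis p_left : forall x : R, x <= a -> p x = 0.
Hypothesis p_right : forall x : R, b <= x -> p x = 0.
Hypothesis B_le : B <= ym a t.

Let F (x : R) : R := p x * derive1 f (rho_plus g u0 u x t).
(** Constant from the product rule for [p * (x - yp) / t]: [C0] bounds [p], and [C1 * (b - B)]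
    bounds its Lipschitz constant times [x - yp]. The majorant [D] uses that [x] and [yp] are both
    nondecreasing. *)
Let Lip : R := (C0 + C1 * (b - B)) / t.
Let D (x : R) : R := Lip * (clip a b x + yp (clip a b x) t).

Let FE (x : R) : F x = p x * ((x - yp x t) / t).
Proof. by rewrite /F (f_rho_plus HS). Qed.

Lemma flux_variation (x y : R) : x <= y -> `|F y - F x| <= D y - D x.
Proof.
have t0' := t0; have ab' := ab; have B_le' := B_le.
move=> xy.
have F0l (z : R) : z <= a -> F z = 0 by move=> h; rewrite /F p_left // mul0r.
have F0r (z : R) : b <= z -> F z = 0 by move=> h; rewrite /F p_right // mul0r.
have Fclip (z : R) : F (clip a b z) = F z.
  have [za|az] := leP z a.
    have zb : z <= b by lra.
    by rewrite /clip (min_l zb) (max_l za) (F0l a) // (F0l z).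
  have [bz|zb] := leP b z.
    by rewrite /clip (min_r bz) (max_r (ltW ab)) (F0r b) // (F0r z).
  by rewrite /clip (min_l (ltW zb)) (max_r (ltW az)).
rewrite -(Fclip x) -(Fclip y) /D -mulrBr.
have := clip_le a b xy; have := clip_in x ab; have := clip_in y ab.
move: (clip a b x) (clip a b y) => {xy}x {}y yab xab xy.
have C00 : 0 <= C0 by apply: le_trans (p_bound xab); exact: normr_ge0.
have C10 : 0 <= C1.
  have := p_lip (_ : a <= a <= b) (_ : a <= b <= b); rewrite !lexx ltW //= => /(_ isT isT) h.
  have : 0 <= C1 * `|b - a| := le_trans (normr_ge0 _) h.
  by rewrite pmulr_lge0 // gtr0_norm; lra.
have Y := yp_nd HS t0 xy.
have Bx : B <= yp x t.
  apply: le_trans B_le _; apply: le_trans (ym_le_yp HS a t0) _.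
  by apply: (yp_nd HS t0); case/andP: xab.
have yx := yp_le HS x t0.
rewrite !FE.
have -> : p y * ((y - yp y t) / t) - p x * ((x - yp x t) / t) =
  (p y * ((y - x) - (yp y t - yp x t)) + (p y - p x) * (x - yp x t)) / t.
  by field; rewrite gt_eqF.
rewrite normrM (gtr0_norm (_ : 0 < t^-1)) ?invr_gt0 // /Lip mulrAC ler_pM2r ?invr_gt0 //.
apply: le_trans (ler_normD _ _) _; rewrite !normrM.
have h1 : `|p y| * `|y - x - (yp y t - yp x t)| <= C0 * ((y - x) + (yp y t - yp x t)).
  apply: ler_pM => //; first exact: p_bound.
  by apply/ler_normlP; split; lra.
have h2 : `|p y - p x| * `|x - yp x t| <= C1 * (y - x) * (b - B).
  apply: ler_pM => //; first by rewrite -(ger0_norm (_ : 0 <= y - x)) ?subr_ge0 //; exact: p_lip.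
  by rewrite ger0_norm; lra.
have h3 : 0 <= C1 * (b - B) * (yp y t - yp x t).
  by rewrite !mulr_ge0 //; lra.
move: h1 h2 h3; lra.
Qed.

Lemma flux_right_cvg (x : R) : F @ x^'+ --> F x.
Proof.
rewrite FE; rewrite (_ : F = fun x => p x * ((x - yp x t) / t)); last by apply/funext => z; exact: FE.
apply: cvgM; first by apply: cvg_at_right_filter; exact: cp.
apply: cvgM; last exact: cvg_cst.
by apply: cvgB; [apply: cvg_at_right_filter; exact: cvg_id|exact: yp_right_cvg].
Qed.

Lemma flux_left_cvg (x : R) : F @ x^'- --> p x * ((x - ym x t) / t).
Proof.
rewrite (_ : F = fun x => p x * ((x - yp x t) / t)); last by apply/funext => z; exact: FE.
apply: cvgM; first by apply: cvg_at_left_filter; exact: cp.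
apply: cvgM; last exact: cvg_cst.
by apply: cvgB; [apply: cvg_at_left_filter; exact: cvg_id|exact: yp_left_cvg].
Qed.

Lemma flux_majorant_right_cvg (x : R) : D @ x^'+ --> D x.
Proof.
have ab' := ab; apply: cvgM; first exact: cvg_cst.
have cl (y : R) : x <= y -> clip a b x <= clip a b y <= clip a b x + (y - x).
  by move=> xy; rewrite clip_le //= /clip /Num.max /Num.min; do !case: ifPn; rewrite -?leNgt; lra.
apply/cvgrPdist_lt => e e0.
have [d d0 Hd] := @yp_right_lt (clip a b x) t (e / 2) t0 ltac:(lra).
near=> y; have h1 : x < y by [].
have h2 : y < x + d by near: y; apply: nbhs_right_lt; lra.
have h3 : y < x + e / 2 by near: y; apply: nbhs_right_lt; lra.
have /andP[c1 c2] := cl y (ltW h1).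
have /andP[k1 k2] := Hd (clip a b y) c1 ltac:(lra).
apply/ltr_normlP; split; lra.
Unshelve. all: by end_near.
Qed.

(** A single Jordan decomposition serves all integrands, so integrals of different functions can be
    compared through the total variation. The factor [2 * (b - B)] bounds the joint increment of [x]
    and [yp] over [[a, b]]. *)
Lemma flux_functional : exists L : (R -> R) -> R,
  [/\ (forall (v : R -> R) (C : R), measurable_fun setT v ->
         (forall x : R, a <= x <= b -> `|v x| <= C) -> is_stieltjes_integral F v (L v)),
      (forall (v w : R -> R) (C e : R), measurable_fun setT v -> measurable_fun setT w ->
         (forall x : R, a <= x <= b -> `|v x| <= C) -> (forall x : R, a <= x <= b -> `|w x| <= C) ->
         (forall x : R, a <= x <= b -> `|v x - w x| <= e) ->
         `|L v - L w| <= e * (2 * (C0 + C1 * (b - B)) * (b - B) / t)) &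
      (forall s : seq (R * R), L (front_sum s t) =
         \sum_(ac <- s) ac.1 * - (p (X ac.2 t) * speed (X ac.2 t) t))].
Proof.
have F0l (x : R) : x <= a -> F x = 0 by move=> h; rewrite /F p_left ?mul0r.
have F0r (x : R) : b <= x -> F x = 0 by move=> h; rewrite /F p_right ?mul0r.
have [nu [P [N [nuPN]]]] := stieltjes_charge ab flux_variation flux_majorant_right_cvg
  flux_right_cvg F0l F0r.
set mp := jordan_pos nuPN; set mn := jordan_neg nuPN; cbv zeta.
move=> [nuE tot [mp0 mn0] ray cray].
have mA : measurable (`]a, b]%classic : set (measurableTypeR R)) by exact: measurable_itv.
pose L (v : R -> R) : R := \int[mp]_x v x - \int[mn]_x v x.
have itv (v : R -> R) (C : R) : (forall x : R, a <= x <= b -> `|v x| <= C) ->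
    forall x, `]a, b]%classic x -> `|v x| <= C.
  by move=> vC x /=; rewrite in_itv /= => /andP[h1 h2]; apply: vC; rewrite ltW.
have bd (v : R -> R) (C : R) mv vC := concentrated_bounded mA mp0 mv (itv v C vC).
have bd' (v : R -> R) (C : R) mv vC := concentrated_bounded mA mn0 mv (itv v C vC).
have linL (v w : R -> R) (k Cv Cw : R) : measurable_fun setT v -> measurable_fun setT w ->
    (forall x : R, a <= x <= b -> `|v x| <= Cv) -> (forall x : R, a <= x <= b -> `|w x| <= Cw) ->
    L (fun x => k * v x + w x) = k * L v + L w.
  move=> mv mw vC wC; have [iv _] := bd v Cv mv vC; have [iw _] := bd w Cw mw wC.
  have [iv' _] := bd' v Cv mv vC; have [iw' _] := bd' w Cw mw wC.
  rewrite /L !RintegralD // ?RintegralZl //; first by ring.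
  - exact: (integrableZl _ k iv').
  - exact: (integrableZl _ k iv).
exists L; split.
- move=> v C mv vC; exists nu; split => //; exists P, N, nuPN; split => //.
    by have [] := bd v C mv vC.
  by have [] := bd' v C mv vC.
- move=> v w C e mv mw vC wC vwe.
  have -> : L v - L w = L (fun x => -1 * w x + v x).
    by rewrite (linL w v (-1) C C) //; ring.
  have mvw : measurable_fun setT (fun x : measurableTypeR R => -1 * w x + v x).
    by apply: measurable_funD => //; apply: measurable_funM.
  have vw' (x : R) : a <= x <= b -> `|-1 * w x + v x| <= e.
    by move=> /vwe; rewrite mulN1r addrC.
  have [_ b1] := bd _ _ mvw vw'; have [_ b2] := bd' _ _ mvw vw'.
  have e0 : 0 <= e by apply: le_trans (vw' a _); rewrite ?normr_ge0 // lexx ltW.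
  apply: le_trans (ler_normB _ _) _; apply: le_trans (lerD b1 b2) _.
  rewrite -mulrDr ler_wpM2l //; apply: le_trans tot _.
  have C00 : 0 <= C0.
    by apply: le_trans (p_bound (_ : a <= a <= b)); rewrite ?normr_ge0 // lexx ltW.
  have ab' := ab; have B_le' := B_le.
  have C10 : 0 <= C1.
    have := p_lip (_ : a <= a <= b) (_ : a <= b <= b); rewrite !lexx ltW //= => /(_ isT isT) h.
    have : 0 <= C1 * `|b - a| := le_trans (normr_ge0 _) h.
    by rewrite pmulr_lge0 // gtr0_norm; lra.
  have h1 := ym_le_yp HS a t0; have h2 := yp_le HS a t0; have h3 := yp_le HS b t0.
  rewrite /D /clip (min_l (ltW ab)) minxx (max_r (ltW ab)) maxxx -mulrBr /Lip.
  rewrite mulrAC ler_pM2r ?invr_gt0 // [X in _ <= X](_ : _ = (C0 + C1 * (b - B)) * (2 * (b - B))); last by ring.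
  by apply: ler_wpM2l; [rewrite addr_ge0 // mulr_ge0 //; lra|lra].
- have LX (c : R) : L (front_indicator c t) = - (p (X c t) * speed (X c t) t).
    have mI : measurable (`[X c t, +oo[%classic : set (measurableTypeR R)) by exact: measurable_itv.
    have mJ : measurable (`]X c t, +oo[%classic : set (measurableTypeR R)) by exact: measurable_itv.
    have E (m : {finite_measure set (measurableTypeR R) -> \bar R}) :
        \int[m]_x front_indicator c t x =
        sw (X c t) t * fine (m `[X c t, +oo[%classic) + (1 - sw (X c t) t) * fine (m `]X c t, +oo[%classic).
      have [i1 e1] := Rintegral_indic m mI; have [i2 e2] := Rintegral_indic m mJ.
      rewrite -e1 -e2 -!RintegralZl // -RintegralD //.
      - exact: (integrableZl _ _ i1).
      - exact: (integrableZl _ _ i2).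
    rewrite /L (E mp) (E mn).
    (* The closed ray yields the speed of the least minimizer, the open ray that of the greatest;
       the weight of the indicator mixes them into [front_speed]. *)
    have := cray _ _ (@flux_left_cvg (X c t)); have := ray (X c t); rewrite FE /front_speed.
    move: (fine _) (fine _) (fine _) (fine _) => A1 A2 A3 A4 h1 h2.
    transitivity (sw (X c t) t * (A2 - A1) + (1 - sw (X c t) t) * (A4 - A3)); first by ring.
    by rewrite h1 h2; ring.
  elim=> [|ac s IH].
    rewrite big_nil /L (_ : front_sum [::] t = cst 0); last first.
      by apply/funext => x; rewrite /front_sum big_nil.
    by rewrite !Rintegral_cst // !mul0r subrr.
  rewrite big_cons -IH -LX; have [C HC] := front_sum_bounded s.
  rewrite -(linL _ _ ac.1 1 C) //.
  - by congr L; apply/funext => x; rewrite /front_sum big_cons.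
  - exact: measurable_front_indicator.
  - exact: measurable_front_sum.
  - by move=> x _; exact: front_indicator_le1.
  - by move=> x _; exact: HC.
Qed.

End Flux.
End Slice.

Lemma cvg_harmonic_bound {R : realType} (w : nat -> R) (l c : R) :
  (forall n, `|l - w n| <= c * harmonic n) -> w @ \oo --> l.
Proof.
move=> H; apply/cvgrPdist_lt => e e0.
have ch : (fun n => c * harmonic n) @ \oo --> (0 : R).
  by rewrite -(mulr0 c); apply: cvgM; [exact: cvg_cst|exact: cvg_harmonic].
near=> n; apply: le_lt_trans (H n) _; near: n; exact: (cvgr_lt _ ch).
Unshelve. all: by end_near.
Qed.

(** * The transport identity *)

Section Support.
Context d {T : measurableType d} {R : realType} (mu : {measure set T -> \bar R}).

Lemma Rintegral_support (A D : set T) (h : T -> R) : measurable A -> measurable D -> A `<=` D ->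
  (forall x, D x -> ~ A x -> h x = 0) ->
  (mu.-integrable A (EFin \o h) -> mu.-integrable D (EFin \o h)) /\
  \int[mu]_(x in D) h x = \int[mu]_(x in A) h x.
Proof.
move=> mA mD AD h0.
have E : (EFin \o h) \_ D = (EFin \o h) \_ A.
  apply/funext => x; rewrite !patchE; have [Ax|nAx] := pselect (A x).
    by rewrite !mem_set //; exact: AD.
  rewrite (memNset nAx); case: ifPn => // /set_mem Dx.
  by rewrite /= h0.
split; last by rewrite /Rintegral !(integral_mkcond _ (fun x => (h x)%:E)) E.
by move=> /(integrable_mkcond _ mA) iA; apply/(integrable_mkcond _ mD); rewrite E.
Qed.

Lemma uniform_limit_integral (A : set T) (f_ : nat -> T -> R) (f : T -> R) (c : R) :
  measurable A -> (mu A < +oo)%E -> (forall n, mu.-integrable A (EFin \o f_ n)) ->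
  (forall n x, A x -> `|f x - f_ n x| <= c * harmonic n) ->
  mu.-integrable A (EFin \o f) /\
  (fun n => \int[mu]_(x in A) f_ n x) @ \oo --> \int[mu]_(x in A) f x.
Proof.
move=> mA Afin fi fc.
have mf_ n : measurable_fun A (f_ n) by apply/measurable_EFinP; case/integrableP: (fi n).
have mf : measurable_fun A f.
  by apply: measurable_fun_cvg mf_ _ => x Ax; apply: cvg_harmonic_bound => n; exact: fc.
have mB n : measurable_fun A (fun x => f x - f_ n x) by exact: measurable_funB.
have iB n : mu.-integrable A (EFin \o (fun x => f x - f_ n x)).
  by apply: (bounded_integrable mA Afin (mB n)) => x Ax; exact: fc.
have i : mu.-integrable A (EFin \o f).
  have := integrableD mA (iB 0%N) (fi 0%N).
  suff -> : ((EFin \o (fun x => (f x - f_ 0%N x)%R)) \+ (EFin \o f_ 0%N))%E = EFin \o f by [].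
  by apply/funext => x /=; rewrite -EFinD subrK.
split => //; apply: (@cvg_harmonic_bound _ _ _ (c * fine (mu A))) => n.
rewrite -RintegralB // mulrAC; apply: normr_Rintegral_le => //.
by move=> x Ax; exact: fc.
Qed.

End Support.

(** * Measurability, integrals of front indicators, test functions *)

Section Assembly.
Context {R : realType} (f g u0 v0 : R -> R) (u Theta : R -> R -> R).
Notation mu := (@lebesgue_measure R).
Hypothesis HS : hopf_lax_setting f g u0 u.
Hypothesis hTheta : secant_weight f Theta.
Hypothesis cv0 : continuous v0.
Local Notation ym := (y_minus g u0 u).
Local Notation yp := (y_plus g u0 u).
Local Notation X := (front g u0 u).
Local Notation sw := (shock_weight g u0 u Theta).
Local Notation v := (transported g u0 v0 u Theta).
Local Notation fsum := (front_sum g u0 u Theta).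
Local Notation find := (front_indicator g u0 u Theta).

(** The [n]-th front sum is accurate where the minimizers lie in [[- n, n]]; each [x] satisfies this
    eventually, so [v] is a pointwise limit of measurable functions. *)
Lemma measurable_transported (t : R) : 0 < t -> measurable_fun setT (v^~ t).
Proof.
move=> t0.
have H n : exists s : seq (R * R), forall x : R, - n%:R <= ym x t -> yp x t <= n%:R ->
    `|v x t - fsum s t x| <= harmonic n.
  have hn : 0 < harmonic n :> R by rewrite invr_gt0.
  have [s Hs] := front_sum_approximation HS hTheta (- n%:R) n%:R cv0 hn.
  by exists s => x; exact: Hs.
have [s Hs] := choice H.
apply: (@measurable_fun_cvg _ _ _ _ (fun n => fsum (s n) t)).
  by move=> n; exact: measurable_front_sum.
move=> x _; apply/cvgrPdist_lt => e e0.
have ch : harmonic @ \oo --> (0 : R) by exact: cvg_harmonic.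
pose N := (Num.bound `|ym x t| + Num.bound `|yp x t|)%N.
near=> n; apply: (@le_lt_trans _ _ (harmonic n)); last by near: n; exact: (cvgr_lt _ ch).
have nN : (N <= n)%N by near: n; exact: nbhs_infty_ge.
have h1 : `|ym x t| < (Num.bound `|ym x t|)%:R by apply/archi_boundP/normr_ge0.
have h2 : `|yp x t| < (Num.bound `|yp x t|)%:R by apply/archi_boundP/normr_ge0.
have h3 : (Num.bound `|ym x t|)%:R <= n%:R :> R.
  by rewrite ler_nat (leq_trans (leq_addr _ _) nN).
have h4 : (Num.bound `|yp x t|)%:R <= n%:R :> R.
  by rewrite ler_nat (leq_trans (leq_addl _ _) nN).
by apply: Hs; [have := ler_norm (- ym x t); rewrite normrN|have := ler_norm (yp x t)]; lra.
Unshelve. all: by end_near.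
Qed.

Lemma transported_bound (B b V t x : R) : (forall y : R, B <= y <= b -> `|v0 y| <= V) ->
  0 < t -> B <= ym x t -> yp x t <= b -> `|v x t| <= V.
Proof.
move=> v0V t0 h1 h2; have h3 := ym_le_yp HS x t0.
have /ler_normlP[a1 a2] := v0V (yp x t) ltac:(lra).
have /ler_normlP[a3 a4] := v0V (ym x t) ltac:(lra).
have /andP[w0 w1] := shock_weight01 HS hTheta x t0.
rewrite (transportedE _ _ HS) //; apply/ler_normlP; split; nra.
Qed.

Lemma Rintegral_front_indicator (k : R -> R) (c t a b K : R) : continuous k ->
  (forall x : R, x <= a -> k x = 0) -> (forall x : R, b <= x -> k x = 0) -> b <= K -> X c t <= K ->
  mu.-integrable setT (EFin \o (fun x => k x * find c t x)) /\
  \int[mu]_x (k x * find c t x) = \int[mu]_(x in `[X c t, K]) k x.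
Proof.
move=> ck ka kb bK XK.
have ko (x : R) : ~ `[a, b]%classic x -> k x = 0.
  move=> /= /negP; rewrite in_itv /= negb_and -!ltNge => /orP[h|h].
    by apply: ka; exact: ltW.
  by apply: kb; exact: ltW.
have ki : mu.-integrable setT (EFin \o k).
  have [h _] := @Rintegral_support _ _ _ mu `[a, b]%classic setT k
    (measurable_itv _) measurableT (@subsetT _ _) (fun x _ => @ko x).
  by apply: h; apply: continuous_itv_integrable; exact: continuous_subspaceT.
have iI (D : set R) : measurable D -> mu.-integrable setT (EFin \o (fun x => k x * \1_D x)) /\
    \int[mu]_x (k x * \1_D x) = \int[mu]_(x in D) k x.
  move=> mD.
  have E1 : \int[mu]_(x in D) (k x * \1_D x) = \int[mu]_(x in D) k x.
    by apply: eq_Rintegral => x xD; rewrite indicE xD mulr1.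
  have o1 (x : R) : setT x -> ~ D x -> k x * \1_D x = 0.
    by move=> _ nD; rewrite indicE memNset // mulr0.
  have [h1 h2] := @Rintegral_support _ _ _ mu D setT _ mD measurableT (@subsetT _ _) o1.
  split; last by rewrite h2.
  have iD : mu.-integrable D (EFin \o k) by apply: integrableS ki.
  apply: h1; apply: eq_integrable iD => // x xD /=.
  by rewrite indicE xD mulr1.
have mI : measurable (`[X c t, +oo[%classic : set R) by exact: measurable_itv.
have mJ : measurable (`]X c t, +oo[%classic : set R) by exact: measurable_itv.
have [i1 e1] := iI _ mI; have [i2 e2] := iI _ mJ.
have F : (fun x => k x * find c t x) = (fun x => sw (X c t) t * (k x * \1_`[X c t, +oo[ x) +
    (1 - sw (X c t) t) * (k x * \1_`]X c t, +oo[ x)).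
  by apply/funext => x; rewrite /front_indicator; ring.
have i1' := integrableZl measurableT (sw (X c t) t) i1.
have i2' := integrableZl measurableT (1 - sw (X c t) t) i2.
split; first by rewrite F; exact: (integrableD measurableT i1' i2').
rewrite F RintegralD // !RintegralZl // e1 e2 Rintegral_itv_obnd_cbnd; last first.
  by apply: integrableS ki.
have o2 (x : R) : `[X c t, +oo[%classic x -> ~ `[X c t, K]%classic x -> k x = 0.
  rewrite /= !in_itv /= andbT => h1; rewrite h1 /= => /negP; rewrite -ltNge => Kx.
  by apply: kb; apply: le_trans bK (ltW Kx).
have [|_ ->] := @Rintegral_support _ _ _ mu `[X c t, K]%classic `[X c t, +oo[%classic k
  (measurable_itv _) mI _ o2; last by ring.
by apply: subset_itvl; rewrite bnd_simp.
Qed.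

Section TestFunction.
Variables (phi : R -> R -> R) (b : R).
Hypothesis phiC : forall k, Ck k phi.
Hypothesis phi0 : forall x t : R, 0 <= t -> b <= `|x| \/ b <= t -> phi x t = 0.

Lemma test_continuous : continuous2 phi. Proof. by have [] := phiC 1. Qed.

Lemma test_derivable (x t : R) : derivable (phi^~ t) x 1 /\ derivable (phi x) t 1.
Proof. by have [_ h _ _] := phiC 1; exact: h. Qed.

Lemma test_dx_continuous : continuous2 (dx phi). Proof. by have [_ _ h _] := phiC 1. Qed.

Lemma test_dt : [/\ continuous2 (dt phi), (forall x t : R, derivable (dt phi x) t 1) &
  continuous2 (dt (dt phi))].
Proof. by have [_ _ _ [h1 h2 _ h3]] := phiC 2; split => // x t; have [] := h2 x t. Qed.

Lemma dt_test0 (x t : R) : 0 < t -> b <= `|x| \/ b < t -> dt phi x t = 0.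
Proof.
move=> t0 xt; apply/eqP; rewrite -normr_le0; apply/ler_addgt0Pl => e e0; rewrite addr0.
have [d d0 Hd] := derivable_eps (test_derivable x t).2 e0.
have [r r0 Hr] : exists2 r : R, 0 < r & forall h : R, `|h| < r -> phi x (t + h) = 0.
  case: xt => [bx|bt].
    by exists t => // h /ltr_normlP[h1 h2]; apply: phi0; [lra|left].
  exists (Num.min t (t - b)); first by rewrite lt_min t0 subr_gt0.
  move=> h; rewrite lt_min => /andP[/ltr_normlP[h1 h2] /ltr_normlP[h3 h4]].
  by apply: phi0; [lra|right; lra].
pose h : R := Num.min d r / 2.
have m0 : 0 < Num.min d r by rewrite lt_min d0.
have md : Num.min d r <= d by rewrite ge_min lexx.
have mr : Num.min d r <= r by rewrite ge_min lexx orbT.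
have h0 : 0 < h by rewrite /h; lra.
have := Hd h; rewrite gt_eqF // (gtr0_norm h0) => /(_ isT ltac:(rewrite /h; lra)).
rewrite Hr ?(gtr0_norm h0) //; last by rewrite /h; lra.
rewrite -[t in phi x t]addr0 Hr ?normr0 // subrr mul0r sub0r normrN /dt.
exact: ltW.
Qed.

(** At [t = b] the function [phi] is known to vanish only on one side in time; continuity of
    [dt phi] supplies the value there. *)
Lemma dt_test_right (x t : R) : 0 < t -> b <= t -> dt phi x t = 0.
Proof.
move=> t0; rewrite le_eqVlt => /predU1P[bt|bt]; last by apply: dt_test0 => //; right.
have [cdt _ _] := test_dt.
apply/eqP; rewrite -normr_le0; apply/ler_addgt0Pl => e e0; rewrite addr0.
have [d d0 Hd] := continuous2_eps x t cdt e0.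
have := Hd x (t + d / 2); rewrite subrr normr0 => /(_ d0).
have -> : t + d / 2 - t = d / 2 by ring.
rewrite gtr0_norm; last lra.
move=> /(_ ltac:(lra)); rewrite dt_test0 ?sub0r ?normrN; [exact: ltW|lra|right; lra].
Qed.

End TestFunction.

End Assembly.

(** * The time integral as [tau] tends to 0 *)

Section Improper.
Context {R : realType} (b : R).
Notation mu := (@lebesgue_measure R).
Hypothesis b_gt0 : 0 < b.

(** No integrability of [J] near 0 is available. The identity expresses its tail integral by
    [Phi tau] and integrals of the bounded [q], and these converge. *)
Lemma improper_identity (q J Phi : R -> R) (C l : R) : 0 <= C ->
  (forall t : R, 0 < t -> t < b -> `|q t| <= C) ->
  (forall t : R, b <= t -> q t = 0) -> (forall t : R, b <= t -> J t = 0) ->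
  (forall tau : R, 0 < tau -> tau < b ->
     [/\ mu.-integrable `[tau, b] (EFin \o q), mu.-integrable `[tau, b] (EFin \o J) &
       \int[mu]_(t in `[tau, b]) q t + \int[mu]_(t in `[tau, b]) J t = - Phi tau]) ->
  Phi @ 0^'+ --> l ->
  mu.-integrable `]0, +oo[ (EFin \o q) /\
  is_improper_integral J (- l - \int[mu]_(t in `]0, +oo[) q t).
Proof.
have b0 := b_gt0; move=> C0 qC q0 J0 tr Phil.
have mI : measurable (`]0, b]%classic : set (measurableTypeR R)) by exact: measurable_itv.
have qb (t : R) : `]0, b]%classic t -> `|q t| <= C.
  rewrite /= in_itv /= => /andP[t1]; rewrite le_eqVlt => /predU1P[->|]; last exact: qC.
  by rewrite q0 // normr0.
have mu0 (t : R) : 0 <= t -> mu `]0%R, t]%classic = t%:E.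
  rewrite le_eqVlt => /predU1P[<-|t0]; rewrite lebesgue_measure_itv /= lte_fin ?ltxx //.
  by rewrite t0 sube0.
have fin0 (t : R) : 0 <= t -> (mu `]0%R, t]%classic < +oo)%E by move=> /mu0 ->; exact: ltry.
have mq : measurable_fun (`]0, b]%classic : set (measurableTypeR R)) q.
  have -> : `]0, b]%classic = \bigcup_n (`[Num.min (harmonic n) (b / 2), b]%classic : set R).
    apply/seteqP; split=> [t /=|t [n _] /=]; rewrite !in_itv /=; last first.
      (* The minimum with [b / 2] keeps the left ends strictly between 0 and [b], where the
         hypothesis on [tau] applies. *)
      move=> /andP[t1 ->]; rewrite andbT; apply: lt_le_trans t1.
      by rewrite lt_min invr_gt0 ltr0Sn /=; lra.
    move=> /andP[t1 t2].
    have ch : harmonic @ \oo --> (0 : R) by exact: cvg_harmonic.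
    have [n _ /(_ n (leqnn n)) /= Hn] := cvgr_lt _ ch _ t1.
    by exists n => //=; rewrite in_itv /= t2 andbT ge_min (ltW Hn).
  apply/measurable_fun_bigcup => [n|n]; first exact: measurable_itv.
  have [||iq _ _] := tr (Num.min (harmonic n) (b / 2)).
  - by rewrite lt_min invr_gt0 ltr0Sn /=; lra.
  - by rewrite gt_min; apply/orP; right; lra.
  - by apply/measurable_EFinP; case/integrableP: iq.
have iqb : mu.-integrable `]0, b] (EFin \o q).
  apply: (@bounded_integrable _ _ _ mu _ mI _ _ C mq qb).
  exact: fin0 (ltW b0).
have sub (c : itv_bound R) : [set` Interval c (BRight b)] `<=` [set` Interval c (BInfty R false)].
  by apply: subset_itvl; rewrite bnd_simp.
have [H1 H2] := @Rintegral_support _ _ _ mu `]0, b]%classic `]0, +oo[%classic q mI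
  (measurable_itv _) (sub _)
  (fun t h1 h2 => q0 t ltac:(move: h1 h2; rewrite /= !in_itv /= andbT => -> /= /negP; rewrite -ltNge => /ltW //)).
split; first exact: H1.
have Jtail (tau : R) : 0 < tau -> tau < b -> mu.-integrable `[tau, +oo[ (EFin \o J) /\
    \int[mu]_(t in `[tau, +oo[) J t = \int[mu]_(t in `[tau, b]) J t.
  move=> tau0 taub; have [_ iJ _] := tr tau tau0 taub.
  have [H3 H4] := @Rintegral_support _ _ _ mu `[tau, b]%classic `[tau, +oo[%classic J
    (measurable_itv _) (measurable_itv _) (sub _)
    (fun t h1 h2 => J0 t ltac:(move: h1 h2; rewrite /= !in_itv /= andbT => -> /= /negP; rewrite -ltNge => /ltW //)).
  by split; [exact: H3|exact: H4].
split=> [tau tau0|].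
  have [||iJ _] := Jtail (Num.min tau (b / 2)).
  - by rewrite lt_min tau0 /=; lra.
  - by rewrite gt_min; apply/orP; right; lra.
  - apply: integrableS iJ => //; apply: subset_itvr.
    by rewrite bnd_simp ge_min lexx.
have E (tau : R) : 0 < tau -> tau < b -> \int[mu]_(t in `[tau, +oo[) J t =
    - Phi tau - \int[mu]_(t in `]0, +oo[) q t + \int[mu]_(t in `]0, tau]) q t.
  move=> tau0 taub; have [_ ->] := Jtail tau tau0 taub; have [iq _ <-] := tr tau tau0 taub.
  have := Rintegral_itvB iqb (_ : (BRight 0 <= BRight tau)%O) (_ : (BRight tau <= BRight b)%O).
  rewrite !bnd_simp => /(_ (ltW tau0) (ltW taub)).
  rewrite (@Rintegral_itv_obnd_cbnd _ tau); last first.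
    by apply: integrableS iq => //; apply: subset_itvr; rewrite bnd_simp.
  by rewrite H2 => <-; ring.
apply/cvgrPdist_lt => /= e e0.
have e20 : 0 < e / 2 by lra.
move/cvgrPdist_lt: Phil => /(_ _ e20)[d d0 Hd].
pose r := Num.min b (Num.min d (e / 2 / (C + 1))).
have C1 : 0 < C + 1 by lra.
have r0 : 0 < r by rewrite !lt_min b0 d0 divr_gt0.
exists r => // tau /=; rewrite sub0r normrN => taur tau0.
move: taur; rewrite gtr0_norm // !lt_min => /and3P[h1 h2 h3].
rewrite (E tau tau0 h1).
have := Hd tau; rewrite /= sub0r normrN gtr0_norm // => /(_ h2 tau0) /ltr_normlP[h4 h5].
have : `|\int[mu]_(t in `]0, tau]) q t| <= C * fine (mu `]0, tau]%classic).
  apply: normr_Rintegral_le.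
  - exact: measurable_itv.
  - exact: fin0 (ltW tau0).
  - apply: measurable_funS mq => //; apply: subset_itvl; by rewrite bnd_simp ltW.
  - move=> t; rewrite /= in_itv /= => /andP[t1 t2]; apply: qC => //; exact: le_lt_trans h1.
rewrite (mu0 tau (ltW tau0)) /= => /ler_normlP[h6 h7].
have h8 : tau * (C + 1) < e / 2 by rewrite -ltr_pdivlMr.
have h9 : C * tau < e / 2 by nra.
move: h4 h5 h6 h7; set A := \int[mu]_(t in `]0, tau]) q t; set D := \int[mu]_(t in `]0, +oo[) q t.
by move: A D (Phi tau) => A D P h4 h5 h6 h7; apply/ltr_normlP; split; lra.
Qed.

End Improper.

(** * Superposition of fronts and passage to the limit *)

Section Transport.
Context {R : realType} (f g u0 v0 : R -> R) (u Theta : R -> R -> R).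
Notation mu := (@lebesgue_measure R).
Hypothesis HS : hopf_lax_setting f g u0 u.
Hypothesis hTheta : secant_weight f Theta.
Hypothesis cv0 : continuous v0.
Local Notation ym := (y_minus g u0 u).
Local Notation yp := (y_plus g u0 u).
Local Notation X := (front g u0 u).
Local Notation speed := (front_speed g u0 u Theta).
Local Notation v := (transported g u0 v0 u Theta).
Local Notation fsum := (front_sum g u0 u Theta).
Local Notation find := (front_indicator g u0 u Theta).

Variables (phi : R -> R -> R) (b B : R).
Hypotheses (phiC : forall k, Ck k phi) (b_gt0 : 0 < b).
Hypothesis phi0 : forall x t : R, 0 <= t -> b <= `|x| \/ b <= t -> phi x t = 0.
Hypothesis B_le : forall t : R, 0 < t -> t < b + 2 -> B <= ym (- b) t.

(* An abscissa beyond the support of [phi] and beyond the front up to time [b + 1]. *)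
Definition front_cap (c : R) : R := Num.max (X c (b + 1)) b.
(** For the front indicator of level [c] in place of [v], [Hc] and [qc] are the space integrals
    against [phi] and [dt phi], and [Jc] is the flux integral. *)
Let Hc (c t : R) : R := front_integral g u0 u phi c (front_cap c) t.
Let qc (c t : R) : R := front_integral g u0 u (dt phi) c (front_cap c) t.
Let Jc (c t : R) : R := - (phi (X c t) t * speed (X c t) t).

Lemma front_le_cap (c t : R) : 0 < t -> t <= b + 1 -> X c t <= front_cap c.
Proof.
move=> t0 tb; rewrite /front_cap le_max; apply/orP; left; exact: (front_nd HS).
Qed.

(** [qc + Jc] is the right derivative of [Hc], and [Hc] vanishes at time [b] together with [phi]. *)
Lemma front_transport (c tau : R) : 0 < tau -> tau < b ->
  [/\ mu.-integrable `[tau, b] (EFin \o qc c), mu.-integrable `[tau, b] (EFin \o Jc c) &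
   \int[mu]_(t in `[tau, b]) qc c t + \int[mu]_(t in `[tau, b]) Jc c t = - Hc c tau].
Proof.
have b0 := b_gt0; move=> tau0 taub; have bb1 : b < b + 1 by lra.
have [cdt ddt cdtt] := test_dt phiC.
have cphi := test_continuous phiC.
have dphi (x t : R) : derivable (phi x) t 1 := (test_derivable phiC x t).2.
have Xcap : X c (b + 1) <= front_cap c by apply: front_le_cap; lra.
have [L HL] := front_integral_lipschitz HS tau0 cphi dphi cdt Xcap.
have [L' HL'] := front_integral_lipschitz HS tau0 cdt ddt cdtt Xcap.
have rd (t : R) : tau <= t <= b ->
    (Hc c (t + h) - Hc c t) / h @[h --> 0^'+] --> qc c t + Jc c t.
  move=> tb; apply: (front_integral_right_derivative HS hTheta _ _ cphi dphi cdt Xcap); lra.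
have [md bd E] := FTC_right_derivative taub bb1 HL rd.
have cq : {within `[tau, b], continuous (qc c)}.
  by apply: (@lipschitz_continuous_within _ _ L') => t t' h1 h2; apply: HL'; lra.
have iq : mu.-integrable `[tau, b] (EFin \o qc c) by exact: continuous_itv_integrable.
(* [Jc] contains the front speed, about whose dependence on time nothing else is known; it is
   measurable and bounded as a right derivative minus the continuous [qc]. *)
have id : mu.-integrable `[tau, b] (EFin \o (fun t => qc c t + Jc c t)).
  apply: (@bounded_integrable _ _ _ mu `[tau, b]%classic _ (itv_fin _ _) _ L) => //.
have JE : (fun t => qc c t + Jc c t - qc c t) = Jc c by apply/funext => t; ring.
have iJ : mu.-integrable `[tau, b] (EFin \o Jc c).
  rewrite -JE; have := @integrableB _ _ _ mu `[tau, b]%classic (measurable_itv _) _ _ id iq.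
  by [].
split => //; rewrite -RintegralD // E.
rewrite -/(Hc c b) -/(Hc c tau); have -> : Hc c b = 0; last by rewrite sub0r.
rewrite /Hc /front_integral; transitivity (\int[mu]_(x in `[X c b, front_cap c]) (0 : R)).
  by apply: eq_Rintegral => x _; apply: phi0; [exact: ltW|right].
by rewrite Rintegral_cst // mul0r.
Qed.

Definition sum_fronts (k : R -> R -> R) (s : seq (R * R)) (t : R) : R :=
  \sum_(ac <- s) ac.1 * k ac.2 t.

Lemma sum_fronts_cons (k : R -> R -> R) (ac : R * R) (s : seq (R * R)) :
  sum_fronts k (ac :: s) = fun t => ac.1 * k ac.2 t + sum_fronts k s t.
Proof. by apply/funext => t; rewrite /sum_fronts big_cons. Qed.

Lemma sum_fronts_transport (s : seq (R * R)) (tau : R) : 0 < tau -> tau < b ->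
  [/\ mu.-integrable `[tau, b] (EFin \o sum_fronts qc s),
      mu.-integrable `[tau, b] (EFin \o sum_fronts Jc s) &
   \int[mu]_(t in `[tau, b]) sum_fronts qc s t + \int[mu]_(t in `[tau, b]) sum_fronts Jc s t =
   - sum_fronts Hc s tau].
Proof.
move=> tau0 taub; elim: s => [|ac s [iq iJ E]].
  have z (k : R -> R -> R) : sum_fronts k [::] = cst 0.
    by apply/funext => t; rewrite /sum_fronts big_nil.
  have i0 : mu.-integrable `[tau, b] (EFin \o (cst 0 : R -> R)).
    by apply: continuous_itv_integrable; apply: continuous_subspaceT => x; exact: cvg_cst.
  by rewrite !z; split => //; rewrite !Rintegral_cst // !mul0r addr0 oppr0.
have [iq1 iJ1 E1] := front_transport ac.2 tau0 taub.
have mI : measurable (`[tau, b]%classic : set (measurableTypeR R)) by exact: measurable_itv.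
have iq2 := integrableZl mI ac.1 iq1; have iJ2 := integrableZl mI ac.1 iJ1.
rewrite !sum_fronts_cons; split.
- exact: (integrableD mI iq2 iq).
- exact: (integrableD mI iJ2 iJ).
- rewrite !RintegralD // !RintegralZl //.
  have -> : - (ac.1 * Hc ac.2 tau + sum_fronts Hc s tau) =
    ac.1 * (- Hc ac.2 tau) + - sum_fronts Hc s tau by ring.
  by rewrite -E -E1; ring.
Qed.

Lemma Rintegral_front_sum (k : R -> R -> R) (s : seq (R * R)) (t : R) : continuous2 k ->
  (forall x : R, b <= `|x| -> k x t = 0) -> 0 < t -> t <= b + 1 ->
  mu.-integrable setT (EFin \o (fun x => k x t * fsum s t x)) /\
  \int[mu]_x (k x t * fsum s t x) =
    sum_fronts (fun c t => front_integral g u0 u k c (front_cap c) t) s t.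
Proof.
have b0 := b_gt0; move=> ck k0 t0 tb; elim: s => [|ac s [i E]].
  have z : (fun x => k x t * fsum [::] t x) = cst 0.
    by apply/funext => x; rewrite /front_sum big_nil mulr0.
  rewrite z; split; last by rewrite Rintegral_cst // mul0r /sum_fronts big_nil.
  exact: (@integrable0 _ _ _ mu setT).
have kl (x : R) : x <= - b -> k x t = 0.
  by move=> h; apply: k0; have := ler_norm (- x); rewrite normrN; lra.
have kr (x : R) : b <= x -> k x t = 0 by move=> h; apply: k0; have := ler_norm x; lra.
have bcap : b <= front_cap ac.2 by rewrite le_max lexx orbT.
have [i1 E1] := Rintegral_front_indicator Theta (continuous2_fst ck) kl kr bcap
  (front_le_cap ac.2 t0 tb).
have E2 : (fun x => k x t * fsum (ac :: s) t x) =
    (fun x => ac.1 * (k x t * find ac.2 t x) + k x t * fsum s t x).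
  by apply/funext => x; rewrite /front_sum big_cons; ring.
have i2 := integrableZl measurableT ac.1 i1.
rewrite E2; split; first exact: (integrableD measurableT i2 i).
rewrite RintegralD // RintegralZl // E1 E.
by rewrite (sum_fronts_cons (fun c t => front_integral g u0 u k c (front_cap c) t)).
Qed.

Lemma phi_out (x t : R) : 0 <= t -> b <= `|x| -> phi x t = 0.
Proof. by move=> h1 h2; apply: phi0 => //; left. Qed.

Lemma dt_phi_out (x t : R) : 0 < t -> b <= `|x| -> dt phi x t = 0.
Proof. by move=> h1 h2; apply: (dt_test0 phiC phi0) => //; left. Qed.

Lemma minimizers_range (x t : R) : 0 < t -> t < b + 2 -> - b <= x <= b ->
  B <= ym x t /\ yp x t <= b.
Proof.
move=> t0 tb /andP[h1 h2]; split; last by apply: le_trans h2; exact: (yp_le HS).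
by apply: le_trans (B_le t0 tb) _; exact: (ym_nd HS).
Qed.

Lemma v0_bound (p q : R) : exists2 V : R, 0 <= V & forall y : R, p <= y <= q -> `|v0 y| <= V.
Proof.
have [pq|qp] := leP p q; last by exists 0 => // y /andP[h1 h2]; lra.
have cn : {within `[p, q], continuous (fun y => `|v0 y|)}.
  by apply: continuous_subspaceT => y; apply: cvg_norm; exact: cv0.
have [c _ m] := EVT_max pq cn; exists `|v0 c| => // y ypq.
Qed.

Lemma space_integral (k : R -> R) (t C : R) : continuous k -> (forall x : R, b <= `|x| -> k x = 0) ->
  (forall x : R, - b <= x <= b -> `|k x| <= C) -> 0 < t -> 0 <= C ->
  mu.-integrable setT (EFin \o (fun x => k x * v x t)) /\
  (forall (s : seq (R * R)) (e : R), t <= b + 1 ->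
    mu.-integrable setT (EFin \o (fun x => k x * fsum s t x)) ->
    (forall x : R, - b <= x <= b -> `|v x t - fsum s t x| <= e) ->
    `|\int[mu]_x (k x * v x t) - \int[mu]_x (k x * fsum s t x)| <= C * e * (2 * b)).
Proof.
have b0 := b_gt0; move=> ck kout kC t0 C0.
have out (h : R -> R) (x : R) : setT x -> ~ `[- b, b]%classic x -> k x * h x = 0.
  move=> _ /= /negP; rewrite in_itv /= negb_and -!ltNge => hx; rewrite kout ?mul0r //.
  by case/orP: hx => hx; [have := ler_norm (- x); rewrite normrN|have := ler_norm x]; lra.
have mA : measurable (`[- b, b]%classic : set R) by exact: measurable_itv.
have mk : measurable_fun (`[- b, b]%classic : set R) k.
  by apply: continuous_itv_measurable; exact: continuous_subspaceT.
have mv : measurable_fun (`[- b, b]%classic : set R) (v^~ t).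
  by apply: measurable_funS (measurable_transported HS hTheta cv0 t0).
have [V V0 HV] := v0_bound (ym (- b) t) b.
have vV (x : R) : - b <= x <= b -> `|v x t| <= V.
  move=> /andP[x1 x2]; apply: (transported_bound HS hTheta HV t0).
    exact: (ym_nd HS).
  by apply: le_trans x2; exact: (yp_le HS).
have mkv : measurable_fun (`[- b, b]%classic : set R) (fun x => k x * v x t) by exact: measurable_funM.
have [i _] := @Rintegral_support _ _ _ mu _ setT (fun x => k x * v x t) mA measurableT
  (@subsetT _ _) (out _).
have iv : mu.-integrable setT (EFin \o (fun x => k x * v x t)).
  apply: i; apply: (@bounded_integrable _ _ _ mu `[- b, b]%classic mA (itv_fin _ _) _ (C * V)) => //.
  move=> x /=; rewrite in_itv /= => xb; rewrite normrM; apply: ler_pM => //; [exact: kC|exact: vV].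
split=> // s e tb ifs vfe.
rewrite -RintegralB // (_ : (fun x => _) = (fun x => k x * (v x t - fsum s t x))); last first.
  by apply/funext => x; ring.
have [_ ->] := @Rintegral_support _ _ _ mu _ setT (fun x => k x * (v x t - fsum s t x)) mA
  measurableT (@subsetT _ _) (out _).
have -> : 2 * b = fine (mu `[- b, b]%classic) by rewrite fine_itv; lra.
apply: normr_Rintegral_le => //; first exact: itv_fin.
  apply: measurable_funM => //; apply: measurable_funB => //.
  by apply: measurable_funS (measurable_front_sum _ _ _ _ _ _) .
move=> x /=; rewrite in_itv /= => xb; rewrite normrM; apply: ler_pM => //; [exact: kC|exact: vfe].
Qed.

Lemma phi_bounds : exists C0 C1 C2 : R,
  [/\ 0 <= C0, 0 <= C1, 0 <= C2,
     (forall x t : R, - b <= x <= b -> 0 <= t <= b + 2 -> `|phi x t| <= C0 /\ `|dt phi x t| <= C2) &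
     (forall x y t : R, - b <= x <= b -> - b <= y <= b -> 0 <= t <= b + 2 ->
        `|phi y t - phi x t| <= C1 * `|y - x|)].
Proof.
have [cdt _ _] := test_dt phiC.
have [C0 C00 H0] := continuous2_bound (- b) b 0 (b + 2) (test_continuous phiC).
have [C2 C20 H2] := continuous2_bound (- b) b 0 (b + 2) cdt.
(* The variables are exchanged so that [lipschitz_snd] gives a Lipschitz bound in space. *)
have cdx : continuous2 (dt (fun t x => phi x t)).
  move=> [t x]; apply/cvgrPdist_lt => e e0.
  have [d d0 Hd] := continuous2_eps x t (test_dx_continuous phiC) e0.
  exists (ball t d, ball x d) => [|[t' x'] [/= h1 h2]].
    by split; apply: nbhsx_ballx.
  by rewrite distrC; apply: Hd; rewrite distrC.
have [C1 C10 H1] := lipschitz_snd 0 (b + 2) (- b) b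
  (fun t x => (test_derivable phiC x t).1) cdx.
exists C0, C1, C2; split => //.
- by move=> x t xb tb; split; [exact: H0|exact: H2].
- by move=> x y t xb yb tb; exact: H1.
Qed.

(** [K / t] comes from the total variation of the flux, with [K] the same for all times. The
    comparison with front sums is all that the limit passage needs to know about the measures. *)
Lemma stieltjes_exists : exists2 K : R, 0 <= K & forall t : R, 0 < t -> exists j : R,
  is_stieltjes_integral (fun x => phi x t * derive1 f (rho_plus g u0 u x t)) (v^~ t) j /\
  forall (s : seq (R * R)) (e : R), (forall x : R, - b <= x <= b -> `|v x t - fsum s t x| <= e) ->
    `|j - sum_fronts Jc s t| <= e * (K / t).
Proof.
have b0 := b_gt0.
have [C0 [C1 [C2 [C00 C10 _ Hp HL]]]] := phi_bounds.
have Bb : B <= - b.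
  have := B_le (_ : 0 < 1) (_ : 1 < b + 2) => /(_ ltac:(lra) ltac:(lra)).
  have := ym_le_yp HS (- b) (@ltr01 R); have := yp_le HS (- b) (@ltr01 R); lra.
exists (2 * (C0 + C1 * (b - B)) * (b - B)).
  by rewrite !mulr_ge0 ?addr_ge0 ?mulr_ge0 //; lra.
move=> t t0; have nb : - b < b by lra.
have cp : continuous (phi^~ t) by exact: continuous2_fst (test_continuous phiC).
have pl (x : R) : x <= - b -> phi x t = 0.
  move=> h; apply: phi_out; first exact: ltW.
  by have := ler_norm (- x); rewrite normrN; lra.
have pr (x : R) : b <= x -> phi x t = 0.
  by move=> h; apply: phi_out; [exact: ltW|have := ler_norm x; lra].
have [V V0 HV] := v0_bound (ym (- b) t) b.
have vV (x : R) : - b <= x <= b -> `|v x t| <= V.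
  move=> /andP[x1 x2]; apply: (transported_bound HS hTheta HV t0).
    exact: (ym_nd HS).
  by apply: le_trans x2; exact: (yp_le HS).
have mv := measurable_transported HS hTheta cv0 t0.
have JE (s : seq (R * R)) : sum_fronts Jc s t =
    \sum_(ac <- s) ac.1 * - (phi (X ac.2 t) t * speed (X ac.2 t) t) by [].
have fin (L : (R -> R) -> R) (K : R) :
  (forall (w w' : R -> R) (C e : R), measurable_fun setT w -> measurable_fun setT w' ->
     (forall x : R, - b <= x <= b -> `|w x| <= C) -> (forall x : R, - b <= x <= b -> `|w' x| <= C) ->
     (forall x : R, - b <= x <= b -> `|w x - w' x| <= e) -> `|L w - L w'| <= e * K) ->
  (forall s : seq (R * R), L (fsum s t) =
     \sum_(ac <- s) ac.1 * - (phi (X ac.2 t) t * speed (X ac.2 t) t)) ->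
  forall (s : seq (R * R)) (e : R), (forall x : R, - b <= x <= b -> `|v x t - fsum s t x| <= e) ->
    `|L (v^~ t) - sum_fronts Jc s t| <= e * K.
  move=> L2 L3 s e vs; rewrite JE -L3; have [C HC] := front_sum_bounded HS hTheta s.
  apply: (L2 _ _ (Num.max V C)) => //; first exact: measurable_front_sum.
  - by move=> x xb; rewrite le_max vV.
  - by move=> x xb; rewrite le_max HC // orbT.
have [tb|bt] := ltP t (b + 2).
  have tb' : 0 <= t <= b + 2 by lra.
  have [L [L1 L2 L3]] := flux_functional HS hTheta t0 nb cp
    (fun x xb => (Hp x t xb tb').1) (fun x y xb yb => HL x y t xb yb tb') pl pr (B_le t0 tb).
  by exists (L (v^~ t)); split; [exact: L1 mv vV|exact: fin L2 L3].
(* At such late times [B] is no lower bound for the minimizers, but the flux vanishes: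
   [flux_functional] applies with constants 0 and with [ym (- b) t] in place of [B]. *)
have p0 (x : R) : phi x t = 0 by apply: phi0; [exact: ltW|right; lra].
have z0 (x : R) : - b <= x <= b -> `|phi x t| <= 0 by rewrite p0 normr0.
have z1 (x y : R) : - b <= x <= b -> - b <= y <= b -> `|phi y t - phi x t| <= 0 * `|y - x|.
  by rewrite !p0 subrr normr0 mul0r.
have [L [L1 L2 L3]] := flux_functional HS hTheta t0 nb cp z0 z1 pl pr (lexx _).
exists (L (v^~ t)); split; first exact: L1 mv vV.
move=> s e vs; apply: le_trans (fin L _ L2 L3 s e vs) _.
have e0 : 0 <= e by apply: le_trans (vs 0 _); rewrite ?normr_ge0 //; lra.
rewrite mul0r addr0 mulr0 !mul0r mulr0.
apply: mulr_ge0 => //; apply: divr_ge0; last exact: ltW.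
by rewrite !mulr_ge0 ?addr_ge0 ?mulr_ge0 //; lra.
Qed.

Lemma front_sum_sequence (t1 B1 : R) : (forall t x : R, 0 < t -> t < t1 -> - b <= x <= b -> B1 <= ym x t) ->
  exists s : nat -> seq (R * R), forall (n : nat) (t x : R), 0 < t -> t < t1 -> - b <= x <= b ->
    `|v x t - fsum (s n) t x| <= harmonic n.
Proof.
move=> HB.
have H n : exists s : seq (R * R), forall t x : R, 0 < t -> t < t1 -> - b <= x <= b ->
    `|v x t - fsum s t x| <= harmonic n.
  have hn : 0 < harmonic n :> R by rewrite invr_gt0.
  have [s Hs] := front_sum_approximation HS hTheta B1 b cv0 hn.
  exists s => t x t0 tt1 xb; apply: Hs => //; first exact: HB.
  by case/andP: xb => _; apply: le_trans; exact: (yp_le HS).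
have [s Hs] := choice H; by exists s.
Qed.

Lemma transport_identity (K : R) (J : R -> R) : 0 <= K ->
  (forall t : R, 0 < t -> forall (s : seq (R * R)) (e : R),
     (forall x : R, - b <= x <= b -> `|v x t - fsum s t x| <= e) ->
     `|J t - sum_fronts Jc s t| <= e * (K / t)) ->
  forall tau : R, 0 < tau -> tau < b ->
  [/\ mu.-integrable `[tau, b] (EFin \o (fun t => \int[mu]_x (dt phi x t * v x t))),
      mu.-integrable `[tau, b] (EFin \o J) &
    \int[mu]_(t in `[tau, b]) (\int[mu]_x (dt phi x t * v x t)) + \int[mu]_(t in `[tau, b]) J t =
    - \int[mu]_x (phi x tau * v x tau)].
Proof.
have b0 := b_gt0; move=> K0 HJ tau tau0 taub.
have [C0 [C1 [C2 [C00 C10 C20 Hp HL]]]] := phi_bounds.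
have [cdt _ _] := test_dt phiC.
have [s Hs] := @front_sum_sequence (b + 2) B
  (fun t x t0 tb xb => (minimizers_range t0 tb xb).1).
have mI : measurable (`[tau, b]%classic : set (measurableTypeR R)) by exact: measurable_itv.
have qn (n : nat) (t : R) : `[tau, b]%classic t ->
    `|\int[mu]_x (dt phi x t * v x t) - sum_fronts qc (s n) t| <= C2 * (2 * b) * harmonic n.
  rewrite /= in_itv /= => /andP[t1 t2]; have t0 : 0 < t by lra.
  have [_ H] := space_integral (continuous2_fst (t := t) cdt) (fun x => dt_phi_out t0)
    (fun x xb => (Hp x t xb ltac:(lra)).2) t0 C20.
  have [i E] := Rintegral_front_sum (s n) cdt (fun x => dt_phi_out t0) t0 ltac:(lra).
  rewrite mulrAC -mulrA -E mulrA; apply: H => //; first lra.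
  by move=> x xb; apply: Hs => //; lra.
have Jn (n : nat) (t : R) : `[tau, b]%classic t ->
    `|J t - sum_fronts Jc (s n) t| <= K / tau * harmonic n.
  rewrite /= in_itv /= => /andP[t1 t2]; have t0 : 0 < t by lra.
  apply: (@le_trans _ _ (harmonic n * (K / t))).
    by apply: HJ => // x xb; apply: Hs => //; lra.
  rewrite mulrC ler_wpM2r ?invr_ge0 // ler_wpM2l // lef_pV2 ?posrE //.
have phin (n : nat) : `|(- \int[mu]_x (phi x tau * v x tau)) - (- sum_fronts Hc (s n) tau)|
    <= C0 * (2 * b) * harmonic n.
  have [_ H] := space_integral (continuous2_fst (t := tau) (test_continuous phiC))
    (fun x => phi_out (ltW tau0)) (fun x xb => (Hp x tau xb ltac:(lra)).1) tau0 C00.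
  have [i E] := Rintegral_front_sum (s n) (test_continuous phiC)
    (fun x => phi_out (ltW tau0)) tau0 ltac:(lra).
  rewrite -opprD normrN mulrAC -mulrA -E mulrA; apply: H => //; first lra.
  by move=> x xb; apply: Hs => //; lra.
have tr n := sum_fronts_transport (s n) tau0 taub.
have [iq cq] := uniform_limit_integral mI (itv_fin _ _)
  (fun n => let: And3 h _ _ := tr n in h) qn.
have [iJ cJ] := uniform_limit_integral mI (itv_fin _ _)
  (fun n => let: And3 _ h _ := tr n in h) Jn.
split => //.
have c1 := cvgD cq cJ.
have c2 : (fun n => - sum_fronts Hc (s n) tau) @ \oo --> - \int[mu]_x (phi x tau * v x tau).
  exact: cvg_harmonic_bound phin.
have E : (fun n => \int[mu]_(t in `[tau, b]) sum_fronts qc (s n) t) +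
    (fun n => \int[mu]_(t in `[tau, b]) sum_fronts Jc (s n) t) =
    (fun n => - sum_fronts Hc (s n) tau).
  by apply/funext => n; case: (tr n).
move: c1; rewrite E => /(_ eventually_filter) c1.
by rewrite -(cvg_lim (@Rhausdorff R) c1) (cvg_lim (@Rhausdorff R) c2).
Qed.

Lemma itv_out (x : R) : ~ `[- b, b]%classic x -> b <= `|x|.
Proof.
move=> /= /negP; rewrite in_itv /= negb_and -!ltNge => /orP[h|h].
  by have := ler_norm (- x); rewrite normrN; lra.
by have := ler_norm x; lra.
Qed.

Lemma transported_init (x : R) : v x t @[t --> 0^'+] --> v0 x.
Proof.
apply/cvgrPdist_lt => /= e e0; have e20 : 0 < e / 2 by lra.
have [d d0 Hd] := (continuous_epsP v0 x).1 (cv0 (x := x)) _ e20.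
have [r r0 Hr] := minimizers_init HS x d0.
exists r => // t /=; rewrite sub0r normrN => + t0; rewrite gtr0_norm // => tr.
have vd (y : R) : ym x t <= y <= x -> `|v0 y - v0 x| <= e / 2.
  move=> /andP[y1 y2]; apply/ltW/Hd/ltr_normlP.
  by have := Hr t (ym x t) t0 tr (ymP HS x t0).1; split; lra.
(* The bound is applied to the datum [v0 - v0 x]; as the two weights add up to 1, this merely
   subtracts [v0 x] from [v x t]. *)
have := transported_bound HS hTheta vd t0 (lexx _) (yp_le HS x t0).
have -> : transported g u0 (fun y => v0 y - v0 x) u Theta x t = v x t - v0 x.
  by rewrite /transported; ring.
by rewrite distrC; lra.
Qed.

Lemma initial_trace :
  \int[mu]_x (phi x tau * v x tau) @[tau --> 0^'+] --> \int[mu]_x (v0 x * phi x 0).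
Proof.
have b0 := b_gt0; have [C0 [C1 [C2 [C00 _ _ Hp _]]]] := phi_bounds.
have [V V0 HV] := v0_bound B b.
have mA : measurable (`[- b, b]%classic : set R) by exact: measurable_itv.
have supp (h : R -> R) (t : R) : 0 <= t ->
    \int[mu]_x (phi x t * h x) = \int[mu]_(x in `[- b, b]) (phi x t * h x).
  move=> t0; apply: (@Rintegral_support _ _ _ mu _ setT _ mA measurableT (@subsetT _ _) _).2.
  by move=> x _ /itv_out xb; rewrite phi_out // mul0r.
have -> : \int[mu]_x (v0 x * phi x 0) = \int[mu]_x (phi x 0 * v0 x).
  by apply: eq_Rintegral => x _; rewrite mulrC.
rewrite supp //; apply/cvg_at_rightP => s [s0 cs].
have -> : (fun n => \int[mu]_x (phi x (s n) * v x (s n))) =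
    (fun n => \int[mu]_(x in `[- b, b]) (phi x (s n) * v x (s n))).
  by apply/funext => n; apply: supp; exact: ltW.
have [] := @bounded_convergence _ _ _ mu `[- b, b]%classic mA (itv_fin _ _)
  (fun n x => phi x (s n) * v x (s n)) (fun x => phi x 0 * v0 x) (C0 * V) => //.
- move=> n; apply: measurable_funM.
    apply: continuous_itv_measurable; apply: continuous_subspaceT.
    exact: continuous2_fst (test_continuous phiC).
  by apply: measurable_funS (measurable_transported HS hTheta cv0 (s0 n)).
- move=> x _; apply: cvgM.
    apply/cvgrPdist_lt => e e0.
    have [d d0 Hd] := continuous2_eps x 0 (test_continuous phiC) e0.
    move/cvgrPdist_lt: cs => /(_ _ d0); apply: filterS => n /= h.
    by rewrite distrC; apply: Hd; [rewrite subrr normr0|rewrite distrC].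
  by move/cvg_at_rightP: (@transported_init x) => /(_ s (conj s0 cs)).
- move=> n x /=; rewrite in_itv /= => xb; have sn := s0 n.
  (* Early terms of the sequence may exceed [b], outside the range of the bound on [v]; there [phi]
     vanishes. *)
  have [sb|bs] := ltP (s n) b; last first.
    by rewrite phi0 ?mul0r ?normr0 ?mulr_ge0 //; [exact: ltW|right].
  have sb2 : s n < b + 2 by lra.
  have [h1 h2] := minimizers_range sn sb2 xb.
  rewrite normrM; apply: ler_pM => //; last exact: (transported_bound HS hTheta HV sn).
  by apply: (Hp x _ xb _).1; lra.
Qed.

Lemma space_bound (k : R -> R) (t C : R) : continuous k -> (forall x : R, b <= `|x| -> k x = 0) ->
  (forall x : R, - b <= x <= b -> `|k x * v x t| <= C) -> 0 < t ->
  `|\int[mu]_x (k x * v x t)| <= C * (2 * b).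
Proof.
have b0 := b_gt0; move=> ck kout kC t0.
have mA : measurable (`[- b, b]%classic : set R) by exact: measurable_itv.
have kvout (x : R) : setT x -> ~ `[- b, b]%classic x -> k x * v x t = 0.
  by move=> _ /itv_out xb; rewrite kout ?mul0r.
have [_ ->] := @Rintegral_support _ _ _ mu `[- b, b]%classic setT (fun x => k x * v x t) mA
  measurableT (@subsetT _ _) kvout.
have -> : 2 * b = fine (mu `[- b, b]%classic) by rewrite fine_itv; lra.
apply: normr_Rintegral_le => //; first exact: itv_fin.
apply: measurable_funM.
  by apply: continuous_itv_measurable; exact: continuous_subspaceT.
by apply: measurable_funS (measurable_transported HS hTheta cv0 t0).
Qed.

Lemma sum_fronts_late (s : seq (R * R)) (t : R) : 0 < t -> b <= t -> sum_fronts Jc s t = 0.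
Proof.
move=> t0 bt; rewrite /sum_fronts big1 // => ac _.
by rewrite /Jc phi0 ?mul0r ?oppr0 ?mulr0 //; [exact: ltW|right].
Qed.

Lemma transported_weak : exists (J : R -> R) (l : R),
  [/\ (forall t, 0 < t -> mu.-integrable setT (fun x => (dt phi x t * v x t)%:E)),
      mu.-integrable `]0, +oo[ (fun t => (\int[mu]_(x in setT) (dt phi x t * v x t))%:E),
      (forall t, 0 < t -> is_stieltjes_integral
         (fun x => phi x t * derive1 f (rho_plus g u0 u x t)) (v^~ t) (J t)),
      is_improper_integral J l &
      \int[mu]_(t in `]0, +oo[) (\int[mu]_(x in setT) (dt phi x t * v x t)) + l
      + \int[mu]_(x in setT) (v0 x * phi x 0) = 0].
Proof.
have b0 := b_gt0; have [C0 [C1 [C2 [C00 C10 C20 Hp HL]]]] := phi_bounds.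
have [cdt _ _] := test_dt phiC.
have [K K0 HK] := stieltjes_exists.
have [J HJ] : exists J : R -> R, forall t : R, 0 < t ->
    is_stieltjes_integral (fun x => phi x t * derive1 f (rho_plus g u0 u x t)) (v^~ t) (J t) /\
    forall (s : seq (R * R)) (e : R), (forall x : R, - b <= x <= b -> `|v x t - fsum s t x| <= e) ->
      `|J t - sum_fronts Jc s t| <= e * (K / t).
  have /choice[J HJ] : forall t : R, exists j : R, 0 < t ->
    is_stieltjes_integral (fun x => phi x t * derive1 f (rho_plus g u0 u x t)) (v^~ t) j /\
    forall (s : seq (R * R)) (e : R), (forall x : R, - b <= x <= b -> `|v x t - fsum s t x| <= e) ->
      `|j - sum_fronts Jc s t| <= e * (K / t).
    move=> t; have [t0|t0] := ltP 0 t; first by have [j Hj] := HK t t0; exists j.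
    by exists 0.
  by exists J.
(* [J] is chosen abstractly, so its vanishing is read off from the front sums: their flux integrals
   are 0 from time [b] on and come arbitrarily close to [J t]. *)
have J0 (t : R) : b <= t -> J t = 0.
  move=> bt; have t0 : 0 < t by lra.
  apply/eqP; rewrite -normr_le0; apply/ler_addgt0Pl => e e0; rewrite addr0.
  have Kt : 0 < K / t + 1 by rewrite ltr_wpDl // divr_ge0 // ltW.
  have [s Hs] := front_sum_approximation HS hTheta (ym (- b) t) b cv0 (divr_gt0 e0 Kt).
  have [_ /(_ s (e / (K / t + 1)))] := HJ t t0.
  rewrite (sum_fronts_late s t0 bt) subr0 => H; apply: le_trans (H _) _.
    move=> x /andP[x1 x2]; apply: Hs => //; first exact: (ym_nd HS).
    by apply: le_trans x2; exact: (yp_le HS).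
  rewrite mulrAC ler_pdivrMr // ler_wpM2l ?ltW //; lra.
have [V V0 HV] := v0_bound B b.
have qC (t : R) : 0 < t -> t < b -> `|\int[mu]_x (dt phi x t * v x t)| <= C2 * V * (2 * b).
  move=> t0 tb; apply: space_bound => //; first exact: continuous2_fst cdt.
    by move=> x; exact: dt_phi_out.
  have tb2 : t < b + 2 by lra.
  move=> x xb; have [h1 h2] := minimizers_range t0 tb2 xb.
  rewrite normrM; apply: ler_pM => //; last exact: (transported_bound HS hTheta HV t0).
  by apply: (Hp x t xb _).2; lra.
have q0 (t : R) : b <= t -> \int[mu]_x (dt phi x t * v x t) = 0.
  move=> bt; transitivity (\int[mu]_(x in setT) (0 : R)); last by rewrite Rintegral_cst // mul0r.
  by apply: eq_Rintegral => x _; rewrite (dt_test_right phiC phi0) ?mul0r //; lra.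
have CV : 0 <= C2 * V * (2 * b) by rewrite !mulr_ge0 //; lra.
have [iq iJ] := improper_identity b_gt0 CV qC q0 J0
  (transport_identity K0 (fun t t0 => (HJ t t0).2)) initial_trace.
exists J, ((- \int[mu]_x (v0 x * phi x 0)) -
  \int[mu]_(t in `]0, +oo[) (\int[mu]_x (dt phi x t * v x t))); split.
- move=> t t0; have [C C_ge0 HC] := continuous2_bound (- b) b t t cdt.
  have [h _] := space_integral (continuous2_fst (t := t) cdt) (fun x => dt_phi_out t0)
    (fun x xb => HC x t xb ltac:(by rewrite lexx)) t0 C_ge0.
  exact: h.
- exact: iq.
- by move=> t t0; exact: (HJ t t0).1.
- exact: iJ.
- by ring.
Qed.

End Transport.

(** * From the viscosity solution to the setting *)

Section Setting.
Context {R : realType}.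

Lemma locally_lipschitz_continuous (h : R -> R) :
  [locally [lipschitz h x | x in [set: R]]] -> continuous h.
Proof.
move=> H x; have /(_ (conj I I))/pinfty_ex_gt0[M M0] := H (x, x).
rewrite /dominated_by /within /= => /nbhs_ballP[d /= d0 Hd].
apply/continuous_epsP => e e0.
exists (Num.min d (e / M)); first by rewrite lt_min d0 divr_gt0.
move=> y; rewrite lt_min => /andP[h1 h2].
have Bxy : ball (x, x) d (y, x).
  by split => /=; [rewrite /ball /= distrC|exact: ballxx].
apply: le_lt_trans (Hd _ Bxy (conj I I)) _.
by rewrite /= mulrC -ltr_pdivlMr.
Qed.

Lemma hopf_lax_settingP (f g u0 : R -> R) (u : R -> R -> R) :
  conjugate_pair f g -> continuous u0 -> growth_bound g u0 -> viscosity_solution f u0 u ->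
  (forall x t : R, 0 < t -> u x t = hopf_lax g u0 x t) -> hopf_lax_setting f g u0 u.
Proof.
move=> fg cu0 growth visc hopf; have [cu _ _ _] := visc.
split => //; last by move=> y x t; exact: subsolution_le fg visc cu0.
move=> x t t0.
have no : [set z : R * R | 0 <= z.2]° (x, t).
  exists (setT, [set s : R | 0 < s]) => [|z [_ /= /ltW //]].
  by split; [exact: filterT|exact: (@lt_nbhsr _ (0 : R))].
by have := cu (x, t); rewrite /continuous_at -(nbhs_subspace_interior no).
Qed.

End Setting.

Theorem theorem2p3 (R : realType) (f g u0 v0 : R -> R) (u Theta : R -> R -> R)
  (hfg : conjugate_pair f g)
  (hu0_mono : {homo u0 : x y / x <= y})
  (hu0_lip : [locally [lipschitz u0 x | x in [set: R]]])
  (hu0_growth : growth_bound g u0)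
  (hu_visc : viscosity_solution f u0 u)
  (hu_hopf : forall x t : R, 0 < t -> u x t = hopf_lax g u0 x t)
  (hTheta : secant_weight f Theta)
  (hv0 : continuous v0) :
  weak_transport_solution v0
    (fun x t => derive1 f (rho_plus g u0 u x t))
    (transported g u0 v0 u Theta).
Proof.
have cu0 := locally_lipschitz_continuous hu0_lip.
have HS := hopf_lax_settingP hfg cu0 hu0_growth hu_visc hu_hopf.
(* This [b] is positive and exceeds [M], so the weak inequalities with [b] imply the strict ones
   with [M]. *)
move=> phi [phiC [M phiM]]; pose b : R := `|M| + 1.
have b0 : 0 < b by rewrite ltr_wpDl.
have [B HB] := minimizers_lbound HS (- b) (addr_gt0 b0 (@ltr0n R 2)).
have B_le (t : R) : 0 < t -> t < b + 2 -> B <= y_minus g u0 u (- b) t.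
  by move=> t0 tb; apply: HB (ymP HS (- b) t0).1.
apply: (transported_weak HS hTheta hv0 phiC b0 _ B_le) => x t t0 xt.
have Mb : M < b by have := ler_norm M; rewrite /b; lra.
by apply: phiM => //; case: xt => h; [left|right]; exact: lt_le_trans h.
Qed.
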